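(* Let $E=(E^0,E^1,r,s)$ be a graph, $H$ a Hilbert space, and $\tau_1,\tau_2:\mathcal{T}_{X(E)}\to B(H)$ two faithful non-degenerate $*$-representations such that $\{\tau_1(\delta_v):v\in E^0\}'=\{\tau_2(\delta_v):v\in E^0\}'$; call this von Neumann algebra $W$. Suppose that $Ad_{\tau_1}$ and $Ad_{\tau_2}$ are conjugate $*$-endomorphisms of $W$. Then there is a coherent unitary equivalence $(U,\alpha)$ between $X(E)$ and itself such that $\tau_2$ and $\tau_1\circ\Gamma_{U,\alpha}$ are unitarily equivalent $*$-representations of $\mathcal{T}_{X(E)}$.
   Context: A graph is a tuple $E=(E^0,E^1,r,s)$ with vertex set $E^0$, edge set $E^1$ and range and source maps $r,s:E^1\to E^0$; $E^0$ and $E^1$ are assumed at most countable, and $E^0$ is regarded as a discrete space. A $C^*$-correspondence over a $C^*$-algebra $A$ is a right Hilbert $A$-module $X$ together with a $*$-homomorphism $\phi=\phi_X:A\to L(X)$, where $L(X)$ is the algebra of adjointable $A$-module maps on $X$. The graph correspondence $X(E)$ is the set of functions $x:E^1\to\mathbb{C}$ for which $\hat{x}(v):=\sum_{e\in s^{-1}(v)}|x(e)|^2$ defines a function $\hat{x}\in C_0(E^0)$. It is a $C^*$-correspondence over $C_0(E^0)$ via $(x\cdot a)(e)=x(e)a(s(e))$, $(\phi(a)x)(e)=a(r(e))x(e)$, $\langle x,y\rangle(v)=\sum_{e\in s^{-1}(v)}\overline{x(e)}y(e)$. The functions $\delta_e\in X(E)$ ($e\in E^1$) and $\delta_v\in C_0(E^0)$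 ($v\in E^0$) are the point masses. A Toeplitz representation of a $C^*$-correspondence $X$ over $A$ in a $C^*$-algebra $B$ is a pair $(\sigma,\pi)$ of a linear map $\sigma:X\to B$ and a $*$-homomorphism $\pi:A\to B$ with $\sigma(x\cdot a)=\sigma(x)\pi(a)$, $\sigma(\phi(a)x)=\pi(a)\sigma(x)$ and $\pi(\langle x,y\rangle)=\sigma(x)^*\sigma(y)$ for all $x,y\in X$, $a\in A$. The Toeplitz algebra $\mathcal{T}_X$ is the universal $C^*$-algebra carrying a Toeplitz representation $(\sigma_u,\pi_u)$ of $X$: for every Toeplitz representation $(\sigma,\pi)$ of $X$ in a $C^*$-algebra $B$ there is a unique $*$-homomorphism $\rho:\mathcal{T}_X\to B$ with $\sigma=\rho\circ\sigma_u$ and $\pi=\rho\circ\pi_u$. Elements of $X(E)$ and $C_0(E^0)$ are identified with their images in $\mathcal{T}_{X(E)}$ under $\sigma_u$ and $\pi_u$. A coherent unitary equivalence between correspondences $X$ over $A$ and $Y$ over $B$ is a pair $(U,\alpha)$ of a bijective linear map $U:X\to Y$ and a $*$-isomorphism $\alpha:A\to B$ such that $U(x\cdot a)=(Ux)\cdot\alpha(a)$, $U(\phi_X(a)x)=\phi_Y(\alpha(a))Ux$ and $\langle Ux,y\rangle_Y=\alpha(\langle x,U^{-1}y\rangle_X)$ for all $x\in X$, $y\in Y$, $a\in A$. For such $(U,\alpha)$ between $X(E)$ and itself, $\Gamma_{U,\alpha}:\mathcal{T}_{X(E)}\to\mathcal{T}_{X(E)}$ denotes the induced $*$-automorphism,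 satisfying $\Gamma_{U,\alpha}(\delta_e)=U\delta_e$ and $\Gamma_{U,\alpha}(\delta_v)=\alpha(\delta_v)$ for all $e\in E^1$, $v\in E^0$. For a $*$-representation $\tau:\mathcal{T}_{X(E)}\to B(H)$, $Ad_\tau$ is the $*$-endomorphism of the von Neumann algebra $\{\tau(\delta_v):v\in E^0\}'$ given by $Ad_\tau(w)=\sum_{e\in E^1}\tau(\delta_e)w\tau(\delta_e)^*$ (sum converging in the strong operator topology). The prime denotes the commutant in $B(H)$. Two $*$-endomorphisms $\beta_1,\beta_2$ of $W$ are conjugate if there is a $*$-automorphism $\gamma$ of $W$ such that $\beta_1\circ\gamma=\gamma\circ\beta_2$. *)

(* Defs.v *)
From HB Require Import structures.
From mathcomp Require Import all_boot all_order all_algebra finmap.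
From mathcomp Require Import all_classical all_reals all_analysis.
From mathcomp Require Import complex ring lra.
From mathcomp Require Import showcase.summability.

Set Implicit Arguments.
Unset Strict Implicit.
Unset Printing Implicit Defensive.
Import Order.TTheory GRing.Theory Num.Theory.
Import numFieldNormedType.Exports.
Local Open Scope classical_set_scope.
Local Open Scope ring_scope.
Local Open Scope complex_scope.

(* C*-algebras are not assumed unital, so the product is not the one of a
   MathComp ring structure.  Norms take their values in R[i] because
   normedModType K uses K-valued norms; they are nonnegative, hence real. *)
HB.mixin Record isCStarAlgebra (R : realType) A
    & CompleteNormedModule R[i] A := {
  cmul : A -> A -> A;
  cstar : A -> A;
  cmulA : associative cmul;
  cmulDl : left_distributive cmul +%R;
  cmulDr : right_distributive cmul +%R;
  cmulZl : forall (k : R[i]) a b, cmul (k *: a) b = k *: cmul a b;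
  cmulZr : forall (k : R[i]) a b, cmul a (k *: b) = k *: cmul a b;
  cnormM : forall a b, `|cmul a b| <= `|a| * `|b|;
  cstarK : involutive cstar;
  cstarD : {morph cstar : a b / a + b};
  cstarZ : forall (k : R[i]) a, cstar (k *: a) = conjc k *: cstar a;
  cstarM : forall a b, cstar (cmul a b) = cmul (cstar b) (cstar a);
  cnorm_star : forall a, `|cmul (cstar a) a| = `|a| ^+ 2
}.

#[short(type="cstarAlgType")]
HB.structure Definition CStarAlgebra (R : realType) :=
  {A of isCStarAlgebra R A & CompleteNormedModule R[i] A}.

Section c0.
Variables (R : realType) (T : Type).
Implicit Types (f g : T -> R[i]) (e M : R).

(* f vanishes at infinity for the discrete topology on T: compact = finite *)
Definition vanishing f :=
  forall e : R, 0 < e -> finite_set [set v | e%:C <= `|f v|].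

Local Notation nc := (@ComplexField.Normc.normc R).

Lemma ncE (z : R[i]) : `|z| = (nc z)%:C.
Proof. by []. Qed.

Lemma nc_ge0 (z : R[i]) : 0 <= nc z.
Proof. by rewrite -ler0c -ncE. Qed.

Lemma nc_sq (z : R[i]) : nc z ^+ 2 = complex.Re z ^+ 2 + complex.Im z ^+ 2.
Proof. by apply: complexI; rewrite add_Re2_Im2 ncE rmorphXn. Qed.

Lemma ncN (z : R[i]) : nc (- z) = nc z.
Proof. by apply: complexI; rewrite -!ncE normrN. Qed.

Lemma ncD (z w : R[i]) : nc (z + w) <= nc z + nc w.
Proof. by rewrite -lecR rmorphD -!ncE ler_normD. Qed.

Lemma ncB (z w : R[i]) : nc (z - w) = nc (w - z).
Proof. by rewrite -ncN opprB. Qed.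

Lemma ncM (z w : R[i]) : nc (z * w) = nc z * nc w.
Proof. by apply: complexI; rewrite rmorphM -!ncE normrM. Qed.

Lemma nc0 : nc 0 = 0.
Proof. by apply: complexI; rewrite -ncE normr0. Qed.

Lemma ncJ (z : R[i]) : nc (conjc z) = nc z.
Proof. by case: z => a b /=; rewrite sqrrN. Qed.

Lemma nc_eq0 (z : R[i]) : nc z = 0 -> z = 0.
Proof. by move=> h; apply/eqP; rewrite -normr_eq0 ncE h. Qed.

Lemma ler_Re_nc (z : R[i]) : `|complex.Re z| <= nc z.
Proof.
by rewrite -ler_sqr ?nnegrE ?nc_ge0// real_normK ?num_real// nc_sq lerDl sqr_ge0.
Qed.

Lemma ler_Im_nc (z : R[i]) : `|complex.Im z| <= nc z.
Proof.
by rewrite -ler_sqr ?nnegrE ?nc_ge0// real_normK ?num_real// nc_sq lerDr sqr_ge0.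
Qed.

Lemma nc_le_ReIm (z : R[i]) : nc z <= `|complex.Re z| + `|complex.Im z|.
Proof.
rewrite -ler_sqr ?nnegrE ?nc_ge0 ?addr_ge0// nc_sq sqrrD.
rewrite !real_normK ?num_real//.
by have := mulr_ge0 (normr_ge0 (complex.Re z)) (normr_ge0 (complex.Im z)); lra.
Qed.

Lemma vanishingE f :
  vanishing f <-> forall e, 0 < e -> finite_set [set v | e <= nc (f v)].
Proof.
split=> h e /h; apply: sub_finite_set => v /=; by rewrite ncE lecR.
Qed.

Lemma vanishing_le f g : vanishing g -> (forall v, nc (f v) <= nc (g v)) ->
  vanishing f.
Proof.
move=> /vanishingE hg fg; apply/vanishingE => e /hg; apply: sub_finite_set.
by move=> v /= /le_trans; apply.
Qed.

Lemma vanishing0 : vanishing 0.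
Proof.
apply/vanishingE => e e0; rewrite (_ : mkset _ = set0)//.
apply/seteqP; split=> // v.
have h : nc ((0 : T -> R[i]) v) = 0 by exact: nc0.
by rewrite /mkset h leNgt e0.
Qed.

Lemma vanishingD f g : vanishing f -> vanishing g -> vanishing (f + g).
Proof.
move=> /vanishingE hf /vanishingE hg; apply/vanishingE => e e0.
have e2 : 0 < e / 2 by rewrite divr_gt0.
apply: sub_finite_set (_ : _ `<=` [set v | e / 2 <= nc (f v)] `|` [set v | e / 2 <= nc (g v)]) _.
  move=> v /= h.
  case: (leP (e / 2) (nc (f v))) => [|h1]; [by left|right].
  by have := ncD (f v) (g v); lra.
by rewrite finite_setU; split; [exact: hf|exact: hg].
Qed.

Lemma vanishingZ (k : R[i]) f : vanishing f -> vanishing (k *: f).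
Proof.
move=> /vanishingE hf; apply/vanishingE => e e0.
have k1 : 0 < nc k + 1 by have := nc_ge0 k; lra.
have := hf _ (divr_gt0 e0 k1); apply: sub_finite_set => v /=.
rewrite ncM ler_pdivrMr// => /le_trans; apply.
by rewrite mulrDr mulr1 mulrC lerDl nc_ge0.
Qed.

Lemma vanishingM f g : vanishing f -> (exists M, forall v, nc (g v) <= M) ->
  vanishing (fun v => f v * g v).
Proof.
move=> /vanishingE hf [M hM]; apply/vanishingE => e e0.
have M1 : 0 < `|M| + 1 by have := normr_ge0 M; lra.
have := hf _ (divr_gt0 e0 M1); apply: sub_finite_set => v /=.
rewrite ncM ler_pdivrMr// => /le_trans; apply; rewrite ler_wpM2l ?nc_ge0//.
by have := hM v; have := ler_norm M; lra.
Qed.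

Lemma vanishing_bounded f : vanishing f -> exists2 M, 0 <= M & forall v, nc (f v) <= M.
Proof.
move=> /vanishingE /(_ 1 ltr01) fin.
have /finite_fsetP[A hA] : finite_set [set nc (f v) | v in [set v | 1 <= nc (f v)]].
  exact: finite_image.
have [M hM] : exists M : R, forall x : R, x \in A -> x <= M.
  exists (\sum_(x <- A) `|x|) => x xA.
  by rewrite (big_fsetD1 x)//= (le_trans (ler_norm x))// lerDl sumr_ge0.
exists (Num.max 1 M); first by rewrite le_max ler01.
move=> v; rewrite le_max; case: (leP (nc (f v)) 1) => //= h.
apply: hM; suff : [set` A] (nc (f v)) by [].
by rewrite -hA; exists v => //=; exact: ltW.
Qed.

Definition c0_pred : {pred T -> R[i]} := [pred f | `[<vanishing f>]].

Record c0 := C0 { c0_fun :> T -> R[i] ; c0P : c0_fun \in c0_pred }.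

HB.instance Definition _ := [isSub for c0_fun].
HB.instance Definition _ := [Choice of c0 by <:].

Lemma c0_submod_closed : submod_closed c0_pred.
Proof.
split=> [|k f g]; rewrite !inE; first exact: vanishing0.
by move=> hf hg; apply: vanishingD => //; exact: vanishingZ.
Qed.

HB.instance Definition _ := GRing.isSubmodClosed.Build R[i] _ c0_pred c0_submod_closed.
HB.instance Definition _ := [SubChoice_isSubLmodule of c0 by <:].

Implicit Types a b : c0.

Lemma c0_vanishing a : vanishing a.
Proof. by apply/asboolP; have := c0P a; rewrite inE. Qed.

Lemma c0_eq a b : (forall v, a v = b v) -> a = b.
Proof. by move=> h; apply: val_inj; apply/funext. Qed.

Definition mk_c0 f (hf : vanishing f) : c0 := C0 (asboolT hf).

Definition c0_norm a : R := sup (range (fun v => nc (a v))).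

Lemma c0_norm_ub a v : nc (a v) <= c0_norm a.
Proof.
have [M _ hM] := vanishing_bounded (c0_vanishing a).
apply: ub_le_sup; last by exists v.
by exists M => _ [w _ <-].
Qed.

Lemma c0_norm_le a M : 0 <= M -> (forall v, nc (a v) <= M) -> c0_norm a <= M.
Proof.
move=> M0 h; rewrite /c0_norm.
have [->|/set0P ne] := eqVneq (range (fun v => nc (a v))) set0.
  by rewrite sup0.
by apply: ge_sup => // _ [v _ <-].
Qed.

Lemma c0_norm_ge0 a : 0 <= c0_norm a.
Proof.
rewrite /c0_norm.
have [->|/set0P[_ [v _ _]]] := eqVneq (range (fun v => nc (a v))) set0.
  by rewrite sup0.
exact: le_trans (nc_ge0 (a v)) (c0_norm_ub a v).
Qed.

Let norm a : R[i] := (c0_norm a)%:C.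

Let ler_normD a b : norm (a + b) <= norm a + norm b.
Proof.
rewrite -rmorphD lecR; apply: c0_norm_le.
  by rewrite addr_ge0 ?c0_norm_ge0.
by move=> v; rewrite (le_trans (ncD _ _))// lerD ?c0_norm_ub.
Qed.

Let normrZ (k : R[i]) a : norm (k *: a) = `|k| * norm a.
Proof.
rewrite ncE -rmorphM; congr _%:C.
have le1 (l : R[i]) b : c0_norm (l *: b) <= nc l * c0_norm b.
  apply: c0_norm_le; first by rewrite mulr_ge0 ?nc_ge0 ?c0_norm_ge0.
  by move=> v; rewrite ncM ler_wpM2l ?nc_ge0 ?c0_norm_ub.
apply/eqP; rewrite eq_le le1/=.
have [->|k0] := eqVneq k 0; first by rewrite nc0 mul0r c0_norm_ge0.
have nck : 0 < nc k.
  by rewrite lt0r nc_ge0 andbT; apply: contra_neq k0 => /nc_eq0.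
have := le1 k^-1 (k *: a); rewrite scalerA mulVf// scale1r.
have -> : nc k^-1 = (nc k)^-1.
  by apply: (mulfI (lt0r_neq0 nck)); rewrite -ncM divff//= divff ?gt_eqF// expr1n expr0n/= addr0 sqrtr1.
by rewrite ler_pdivlMl.
Qed.

Let normr0_eq0 a : norm a = 0 -> a = 0.
Proof.
move=> /complexI h; apply: c0_eq => v; apply: nc_eq0.
by apply/eqP; rewrite eq_le nc_ge0 andbT -h c0_norm_ub.
Qed.

HB.instance Definition _ :=
  Lmodule_isNormed.Build R[i] c0 ler_normD normrZ normr0_eq0.

Lemma c0_normE a : `|a| = (c0_norm a)%:C.
Proof. by []. Qed.

Lemma c0_complete (F : set_system c0) : ProperFilter F -> cauchy F -> cvg F.
Proof.
move=> FF /cauchyP cF.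
have {}cF (e : R) : 0 < e -> exists x : c0, F [set a | c0_norm (x - a) < e].
  move=> e0; have [|x xF] := cF e%:C; first by rewrite ltcR.
  exists x; apply: filterS xF => a.
  by rewrite -ball_normE /ball_/= c0_normE ltcR.
have cvgR (g : R[i] -> R) v : (forall z w, `|g z - g w| <= nc (z - w)) ->
    cvg ((fun a : c0 => g (a v)) @ F).
  move=> gle; apply: R_complete; apply/cauchyP => e e0.
  have [x xF] := cF e e0; exists (g (x v)).
  change (F [set a | ball (g (x v)) e (g (a v))]).
  apply: filterS xF => a xa; rewrite /mkset -ball_normE.
  exact: le_lt_trans (gle _ _) (le_lt_trans (c0_norm_ub (x - a) v) xa).
have ReL v : cvg ((fun a : c0 => complex.Re (a v)) @ F).
  by apply: cvgR => z w; rewrite -raddfB ler_Re_nc.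
have ImL v : cvg ((fun a : c0 => complex.Im (a v)) @ F).
  by apply: cvgR => z w; rewrite -raddfB ler_Im_nc.
pose L v : R[i] := lim ((fun a : c0 => complex.Re (a v)) @ F) +i*
  lim ((fun a : c0 => complex.Im (a v)) @ F).
have near_L (e : R) : 0 < e -> F [set a : c0 | forall v, nc (a v - L v) <= e].
  move=> e0; have e4 : 0 < e / 4 by rewrite divr_gt0.
  have [x xF] := cF _ e4; apply: filterS (xF) => a /= xa v.
  have hRe : F [set b : c0 | `|complex.Re (b v) - complex.Re (L v)| <= e / 4].
    by have /cvgrPdistC_le := ReL v; apply.
  have hIm : F [set b : c0 | `|complex.Im (b v) - complex.Im (L v)| <= e / 4].
    by have /cvgrPdistC_le := ImL v; apply.
  have [b [xb [bR bI]]] := filter_ex (filterI xF (filterI hRe hIm)).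
  have h1 : nc (x v - a v) <= c0_norm (x - a) := c0_norm_ub (x - a) v.
  have h2 : nc (x v - b v) <= c0_norm (x - b) := c0_norm_ub (x - b) v.
  have := nc_le_ReIm (b v - L v); rewrite !raddfB => h0.
  have h3 := ncD (a v - x v) (x v - L v); have h4 := ncD (x v - b v) (b v - L v).
  rewrite !addrA !subrK in h3 h4; rewrite (ncB (a v)) in h3.
  rewrite /mkset in xb bR bI; lra.
have vL : vanishing L.
  apply/vanishingE => e e0; have e2 : 0 < e / 2 by rewrite divr_gt0.
  have [a aL] := filter_ex (near_L _ e2).
  have := (vanishingE a).1 (c0_vanishing a) _ e2; apply: sub_finite_set => v; rewrite /mkset => h.
  have := aL v; have := ncD (L v - a v) (a v); rewrite subrK ncB; lra.
apply/cvg_ex; exists (mk_c0 vL); apply/cvgrPdistC_le => e e0.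
have /complex_realP[eR eE] : e \is Num.real by exact: gtr0_real.
have eR0 : 0 < eR by rewrite -ltcR -eE.
rewrite eE.
apply: filterS (near_L _ eR0) => a aL.
by rewrite c0_normE lecR; apply: c0_norm_le => //; exact: ltW.
Qed.

HB.instance Definition _ := Uniform_isComplete.Build c0 c0_complete.

Lemma c0_mul_subproof a b : vanishing (fun v => a v * b v).
Proof.
apply: vanishingM (c0_vanishing a) _.
by have [M _ h] := vanishing_bounded (c0_vanishing b); exists M.
Qed.

Lemma c0_star_subproof a : vanishing (fun v => conjc (a v)).
Proof. by apply: vanishing_le (c0_vanishing a) _ => v; rewrite ncJ. Qed.

Definition c0_mul a b := mk_c0 (c0_mul_subproof a b).
Definition c0_star a := mk_c0 (c0_star_subproof a).

Let mulA : associative c0_mul.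
Proof. by move=> a b c; apply: c0_eq => v /=; rewrite mulrA. Qed.

Let mulDl : left_distributive c0_mul +%R.
Proof. by move=> a b c; apply: c0_eq => v /=; rewrite mulrDl. Qed.

Let mulDr : right_distributive c0_mul +%R.
Proof. by move=> a b c; apply: c0_eq => v /=; rewrite mulrDr. Qed.

Let mulZl (k : R[i]) a b : c0_mul (k *: a) b = k *: c0_mul a b.
Proof. by apply: c0_eq => v /=; rewrite -mulrA. Qed.

Let mulZr (k : R[i]) a b : c0_mul a (k *: b) = k *: c0_mul a b.
Proof. by apply: c0_eq => v /=; rewrite mulrCA. Qed.

Let normM a b : `|c0_mul a b| <= `|a| * `|b|.
Proof.
rewrite !c0_normE -rmorphM lecR; apply: c0_norm_le.
  by rewrite mulr_ge0 ?c0_norm_ge0.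
by move=> v; rewrite ncM ler_pM ?nc_ge0 ?c0_norm_ub.
Qed.

Let starK : involutive c0_star.
Proof. by move=> a; apply: c0_eq => v /=; rewrite conjcK. Qed.

Let starD : {morph c0_star : a b / a + b}.
Proof. by move=> a b; apply: c0_eq => v; exact: (rmorphD (@conjc R)). Qed.

Let starZ (k : R[i]) a : c0_star (k *: a) = conjc k *: c0_star a.
Proof. by apply: c0_eq => v; exact: (rmorphM (@conjc R)). Qed.

Let starM a b : c0_star (c0_mul a b) = c0_mul (c0_star b) (c0_star a).
Proof. by apply: c0_eq => v /=; rewrite mulrC; exact: (rmorphM (@conjc R)). Qed.

Let norm_star a : `|c0_mul (c0_star a) a| = `|a| ^+ 2.
Proof.
rewrite !c0_normE -rmorphXn; congr _%:C; apply/eqP; rewrite eq_le.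
apply/andP; split.
  apply: c0_norm_le => [|v]; first by rewrite sqr_ge0.
  by rewrite ncM ncJ -expr2 ler_sqr ?nnegrE ?nc_ge0 ?c0_norm_ge0 ?c0_norm_ub.
rewrite -[leRHS]sqr_sqrtr ?c0_norm_ge0// ler_sqr ?nnegrE ?c0_norm_ge0 ?sqrtr_ge0//.
apply: c0_norm_le => [|v]; first by rewrite sqrtr_ge0.
rewrite -[leLHS]ger0_norm ?nc_ge0// -sqrtr_sqr ler_wsqrtr//.
by rewrite (le_trans _ (c0_norm_ub _ v))//= ncM ncJ expr2.
Qed.

HB.instance Definition _ := isCStarAlgebra.Build R c0
  mulA mulDl mulDr mulZl mulZr normM starK starD starZ starM norm_star.

End c0.

(* in a C*-algebra the positive elements are exactly the b^* b *)
Definition cpositive (R : realType) (A : cstarAlgType R) (a : A) :=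
  exists b, a = cmul (cstar b) b.

(* Right Hilbert A-modules, with inner product linear in the second variable.
   The norm is |x| = |<x,x>|^(1/2); completeness is stated for its square. *)
HB.mixin Record isHilbertModule (R : realType) (A : cstarAlgType R) X
    & GRing.Lmodule R[i] X := {
  ract : X -> A -> X;
  hip : X -> X -> A;
  ractDl : forall x y a, ract (x + y) a = ract x a + ract y a;
  ractDr : forall x a b, ract x (a + b) = ract x a + ract x b;
  ractM : forall x a b, ract x (cmul a b) = ract (ract x a) b;
  ractZl : forall (k : R[i]) x a, ract (k *: x) a = k *: ract x a;
  ractZr : forall (k : R[i]) x a, ract x (k *: a) = k *: ract x a;
  hipDr : forall x y z, hip x (y + z) = hip x y + hip x z;
  hipZr : forall (k : R[i]) x y, hip x (k *: y) = k *: hip x y;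
  hip_ract : forall x y a, hip x (ract y a) = cmul (hip x y) a;
  hipC : forall x y, hip y x = cstar (hip x y);
  hip_ge0 : forall x, cpositive (hip x x);
  hip_eq0 : forall x, hip x x = 0 -> x = 0;
  hip_complete : forall u : nat -> X,
    (forall eps : R, 0 < eps -> exists N : nat, forall m n : nat,
      (N <= m)%N -> (N <= n)%N -> `|hip (u m - u n) (u m - u n)| < eps%:C) ->
    exists l, forall eps : R, 0 < eps -> exists N : nat, forall n : nat,
      (N <= n)%N -> `|hip (u n - l) (u n - l)| < eps%:C
}.

#[short(type="hilbertModType")]
HB.structure Definition HilbertModule (R : realType) (A : cstarAlgType R) :=
  {X of isHilbertModule R A X & GRing.Lmodule R[i] X}.

(* lact is the left action phi : A -> L(X); lact_adj says that phi(a) is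
   adjointable with adjoint phi(a^* ). *)
HB.mixin Record isCorrespondence (R : realType) (A : cstarAlgType R) X
    & HilbertModule R A X := {
  lact : A -> X -> X;
  lactDl : forall a b x, lact (a + b) x = lact a x + lact b x;
  lactZl : forall (k : R[i]) a x, lact (k *: a) x = k *: lact a x;
  lactM : forall a b x, lact (cmul a b) x = lact a (lact b x);
  lactDr : forall a x y, lact a (x + y) = lact a x + lact a y;
  lactZr : forall (k : R[i]) a x, lact a (k *: x) = k *: lact a x;
  lact_ract : forall a x b, lact a (ract x b) = ract (lact a x) b;
  lact_adj : forall a x y, hip (lact a x) y = hip x (lact (cstar a) y)
}.

#[short(type="correspondenceType")]
HB.structure Definition Correspondence (R : realType) (A : cstarAlgType R) :=
  {X of isCorrespondence R A X & HilbertModule R A X}.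

Section csum.
Variables (R : realType) (I : choiceType).
Implicit Types (f g : I -> R[i]) (l : R[i]) (A B : {fset I}).

Local Notation nc := (@ComplexField.Normc.normc R).

(* unordered sum: limit of the finite partial sums along the directed set of
   finite subsets of I, in R[i] with its usual topology *)
Definition csum f : R[i] := sum (f : I -> (R[i] : numFieldType)^o).

Definition has_csum f l := forall e : R, 0 < e -> exists A, forall B,
  (A `<=` B)%fset -> nc (\sum_(i <- B) f i - l) <= e.

Definition abs_summable f := exists M : R, forall A, \sum_(i <- A) nc (f i) <= M.

Lemma has_csumE f l : has_csum f l -> csum f = l.
Proof.
move=> h; have FF := @totally_filter I.
apply: (@cvg_lim (R[i] : numFieldType)^o) => //.
apply/(@cvgrPdistC_le _ (R[i] : numFieldType)^o) => e e0.
have /complex_realP[eR eE] : e \is Num.real by exact: gtr0_real.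
have /h[A hA] : 0 < eR by rewrite -ltcR -eE.
exists A => // B /= AB.
by rewrite /partial_sum -(big_seq_fsetE _ B xpredT f) ncE eE lecR hA.
Qed.

Lemma has_csumD f g l1 l2 : has_csum f l1 -> has_csum g l2 ->
  has_csum (fun i => f i + g i) (l1 + l2).
Proof.
move=> hf hg e e0; have e2 : 0 < e / 2 by rewrite divr_gt0.
have [A hA] := hf _ e2; have [B hB] := hg _ e2.
exists (A `|` B)%fset => D; rewrite fsubUset => /andP[/hA h1 /hB h2].
rewrite big_split/= opprD addrACA (le_trans (ncD _ _))//; lra.
Qed.

Lemma has_csumZ k f l : has_csum f l -> has_csum (fun i => k * f i) (k * l).
Proof.
move=> hf e e0; have k1 : 0 < nc k + 1 by have := nc_ge0 k; lra.
have [A hA] := hf _ (divr_gt0 e0 k1); exists A => B /hA.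
rewrite -mulr_sumr -mulrBr ncM ler_pdivlMr// => h.
have := nc_ge0 (\sum_(i <- B) f i - l).
nra.
Qed.

Lemma has_csumJ f l : has_csum f l -> has_csum (fun i => conjc (f i)) (conjc l).
Proof.
move=> hf e e0; have [A hA] := hf _ e0; exists A => B /hA.
by rewrite -(rmorph_sum (@conjc R)) -(rmorphB (@conjc R)) ncJ.
Qed.

Lemma has_csum_le f l (M : R) : has_csum f l ->
  (forall A, nc (\sum_(i <- A) f i) <= M) -> nc l <= M.
Proof.
move=> hf hM; apply/ler_addgt0Pr => e e0.
have [A /(_ A (fsubset_refl _)) h] := hf _ e0.
have := ncD (l - \sum_(i <- A) f i) (\sum_(i <- A) f i).
rewrite subrK ncB; have := hM A; lra.
Qed.

Lemma has_csum_nneg (g : I -> R) (s : R) : (forall i, 0 <= g i) ->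
  (forall A, \sum_(i <- A) g i <= s) ->
  (forall e, 0 < e -> exists A, s - e <= \sum_(i <- A) g i) ->
  has_csum (fun i => (g i)%:C) s%:C.
Proof.
move=> g0 gs sg e e0; have [A hA] := sg _ e0; exists A => B AB.
have : \sum_(i <- A) g i <= \sum_(i <- B) g i.
  rewrite [leRHS](big_fsetID _ (mem A))/=.
  rewrite [X in _ <= X + _](_ : _ = \sum_(i <- A) g i).
    by rewrite lerDl sumr_ge0.
  apply: eq_fbigl => i; rewrite !inE/=.
  by case: (boolP (i \in A)) => iA; rewrite ?andbF// andbT (fsubsetP AB).
rewrite -rmorph_sum -rmorphB/= expr0n addr0 sqrtr_sqr => h.
rewrite ler_norml; have := gs B; lra.
Qed.

Lemma nneg_summable (g : I -> R) (M : R) : (forall i, 0 <= g i) ->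
  (forall A, \sum_(i <- A) g i <= M) ->
  exists s, has_csum (fun i => (g i)%:C) s.
Proof.
move=> g0 gM; pose S := [set \sum_(i <- A) g i | A in [set: {fset I}]].
have hS : has_sup S.
  by split; [exists (\sum_(i <- fset0) g i), fset0|exists M => _ [A _ <-]].
exists (sup S)%:C; apply: has_csum_nneg => // [A|e e0].
  by apply: ub_le_sup; [case: hS|exists A].
have [_ [A _ <-] h] := sup_adherent e0 hS; exists A; exact: ltW.
Qed.

Lemma summable_has_csum f : abs_summable f -> has_csum f (csum f).
Proof.
move=> [M hM]; suff [l hl] : exists l, has_csum f l by rewrite (has_csumE hl).
have [l0 h0] := nneg_summable (fun i => nc_ge0 (f i)) hM.
have h2 (p : R[i] -> R) : (forall z, `|p z| <= nc z) ->
    exists l, has_csum (fun i => (nc (f i) + p (f i))%:C) l.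
  move=> hp; apply: (@nneg_summable _ (2 * M)) => [i|A].
    by have := hp (f i); rewrite ler_norml; lra.
  have : \sum_(i <- A) (nc (f i) + p (f i)) <= \sum_(i <- A) 2 * nc (f i).
    by apply: ler_sum => i _; have := hp (f i); rewrite ler_norml; lra.
  by rewrite -mulr_sumr => /le_trans; apply; rewrite ler_wpM2l.
have [l1 h1] := h2 _ (@ler_Re_nc R); have [l3 h3] := h2 _ (@ler_Im_nc R).
have := has_csumD (has_csumD h1 (has_csumZ (0 +i* 1) h3)) (has_csumZ ((-1) +i* (-1)) h0).
set l := (X in has_csum _ X) => hl; exists l; move: hl; congr has_csum.
apply/funext => i; case: (f i) => a b; set n := nc _.
by rewrite /real_complex_def; apply/eqP; rewrite eq_complex/=; apply/andP; split; apply/eqP; ring.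
Qed.

Lemma has_csum_unique f l1 l2 : has_csum f l1 -> has_csum f l2 -> l1 = l2.
Proof. by move=> /has_csumE <- /has_csumE <-. Qed.

End csum.

Record graph := Graph {
  vertex : countType;
  edge : countType;
  rng : edge -> vertex;
  src : edge -> vertex }.

Section graph_correspondence.
Variables (R : realType) (E : graph).
Implicit Types (x y z : edge E -> R[i]) (v w : vertex E) (A : {fset edge E}).

Local Notation nc := (@ComplexField.Normc.normc R).

Definition xhat x v : \bar R :=
  (\esum_(e in [set e | src e = v]) (nc (x e) ^+ 2)%:E)%R.

Definition xgraph_pred : {pred edge E -> R[i]} :=
  [pred x | `[< (forall v, (xhat x v < +oo)%E) /\
                vanishing (fun v => (fine (xhat x v))%:C) >]].

Definition fsq x v A : R := \sum_(e <- A) (if src e == v then nc (x e) ^+ 2 else 0).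

Lemma fsq_ge0 x v A : 0 <= fsq x v A.
Proof. by apply: sumr_ge0 => e _; case: ifP => // _; rewrite sqr_ge0. Qed.

Lemma xhat_ge0 x v : (0 <= xhat x v)%E.
Proof. by apply: esum_ge0 => e _; rewrite lee_fin sqr_ge0. Qed.

Lemma xhat_lub x v (M : R) : (forall A, fsq x v A <= M) -> (xhat x v <= M%:E)%E.
Proof.
move=> h; apply: ge_ereal_sup => /= _ [F [finF sF] <-].
rewrite fsbig_finite//= sumEFin lee_fin (le_trans _ (h (fset_set F)))//.
rewrite /fsq big_seq [leRHS]big_seq; apply: ler_sum => e.
by rewrite in_fset_set// => /set_mem /sF /= ->; rewrite eqxx.
Qed.

Lemma fsq_le x v A : ((fsq x v A)%:E <= xhat x v)%E.
Proof.
apply: esum_ge; exists [set e | e \in A /\ src e = v].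
  split; last by move=> e [].
  by apply: sub_finite_set (finite_fset A) => e [].
rewrite fsbig_finite/=; last by apply: sub_finite_set (finite_fset A) => e [].
rewrite sumEFin lee_fin /fsq.
rewrite -big_mkcond/= -big_filter le_eqVlt; apply/orP; left; apply/eqP.
apply: perm_big; apply: uniq_perm; rewrite ?filter_uniq ?fset_uniq//.
move=> e; rewrite mem_filter in_fset_set; last by apply: sub_finite_set (finite_fset A) => ? [].
apply/andP/idP => [[/eqP ev eA]|/set_mem/=[eA ->]]; last by rewrite eqxx.
by apply/mem_set.
Qed.

Definition hat x v : R := fine (xhat x v).

Lemma hat_le x v (M : R) : (forall A, fsq x v A <= M) -> hat x v <= M.
Proof.
move=> /xhat_lub h; rewrite /hat -lee_fin fineK//.
by rewrite ge0_fin_numE ?xhat_ge0// (le_lt_trans h)// ltry.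
Qed.

Lemma xgraph_mem x (g : vertex E -> R) : (forall v A, fsq x v A <= g v) ->
  vanishing (fun v => (g v)%:C) -> x \in xgraph_pred.
Proof.
move=> xg vg; rewrite inE; split.
  by move=> v; rewrite (le_lt_trans (xhat_lub (xg v)))// ltry.
apply: vanishing_le vg _ => v; rewrite -lecR -!ncE.
rewrite !ger0_norm ?ler0c ?lecR ?hat_le//; last by rewrite fine_ge0 ?xhat_ge0.
exact: le_trans (fsq_ge0 x v fset0) (xg v fset0).
Qed.

Record xgraph := XGraph { xgraph_fun :> edge E -> R[i] ;
  xgraphP : xgraph_fun \in xgraph_pred }.

Lemma fsq_hat (x : xgraph) v A : fsq x v A <= hat x v.
Proof.
have := xgraphP x; rewrite inE => -[fx _].
rewrite -lee_fin /hat fineK ?fsq_le//.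
by rewrite ge0_fin_numE ?xhat_ge0.
Qed.

Lemma hat_ge0 x v : 0 <= hat x v.
Proof. by rewrite fine_ge0 ?xhat_ge0. Qed.

Lemma hat_vanishing (x : xgraph) : vanishing (fun v => (hat x v)%:C).
Proof. by have := xgraphP x; rewrite inE => -[]. Qed.

Lemma fsq_leD x y z (k1 k2 : R) v A :
  (forall e, nc (z e) ^+ 2 <= k1 * nc (x e) ^+ 2 + k2 * nc (y e) ^+ 2) ->
  fsq z v A <= k1 * fsq x v A + k2 * fsq y v A.
Proof.
move=> h; rewrite /fsq !mulr_sumr -big_split/=; apply: ler_sum => e _.
by case: ifP => // _; rewrite !mulr0 addr0.
Qed.

Lemma ncD_sq (a b : R[i]) : nc (a + b) ^+ 2 <= 2 * nc a ^+ 2 + 2 * nc b ^+ 2.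
Proof.
rewrite !nc_sq; case: a => a1 a2; case: b => b1 b2 /=.
have := sqr_ge0 (a1 - b1); have := sqr_ge0 (a2 - b2); nra.
Qed.

HB.instance Definition _ := [isSub for xgraph_fun].
HB.instance Definition _ := [Choice of xgraph by <:].

Lemma xgraph_submod_closed : submod_closed xgraph_pred.
Proof.
split=> [|k x y xX yX].
  apply: (@xgraph_mem _ (fun=> 0)); last exact: vanishing0.
  by move=> v A; rewrite /fsq big1// => e _; case: ifP => // _; rewrite nc0 expr0n.
pose x' := XGraph xX; pose y' := XGraph yX.
apply: (@xgraph_mem _ (fun v => 2 * nc k ^+ 2 * hat x' v + 2 * hat y' v)).
  move=> v A; apply: (@le_trans _ _ (2 * nc k ^+ 2 * fsq x' v A + 2 * fsq y' v A)).
    apply: fsq_leD => e; rewrite -mulrA -exprMn -ncM; exact: ncD_sq.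
  apply: lerD; (apply: ler_wpM2l; last exact: fsq_hat) => //.
  by rewrite mulr_ge0 ?sqr_ge0.
rewrite [X in vanishing X](_ : _ =
  (2 * nc k ^+ 2)%:C *: (fun v => (hat x' v)%:C) + 2%:C *: (fun v => (hat y' v)%:C)).
  by apply: vanishingD; apply: vanishingZ; exact: hat_vanishing.
apply/funext => v; rewrite rmorphD; congr (_ + _); exact: rmorphM.
Qed.

HB.instance Definition _ := GRing.isSubmodClosed.Build R[i] _ xgraph_pred xgraph_submod_closed.
HB.instance Definition _ := [SubChoice_isSubLmodule of xgraph by <:].

Local Notation X := xgraph.
Local Notation C0E := (c0 R (vertex E)).
Implicit Types (a b : C0E).

Lemma xgraph_eq (x y : X) : (forall e, x e = y e) -> x = y.
Proof. by move=> h; apply: val_inj; apply/funext. Qed.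

Lemma conjcM (z w : R[i]) : conjc (z * w) = conjc z * conjc w.
Proof. exact: (rmorphM (@conjc R)). Qed.

Lemma ract_subproof (x : X) a : (fun e => x e * a (src e)) \in xgraph_pred.
Proof.
apply: (@xgraph_mem _ (fun v => hat x v * nc (a v) ^+ 2)) => [v A|].
  apply: (@le_trans _ _ (fsq x v A * nc (a v) ^+ 2)).
    rewrite /fsq mulr_suml; apply: ler_sum => e _.
    by case: ifP => [/eqP ->|_]; rewrite ?mul0r// ncM exprMn.
  by apply: ler_wpM2r; [exact: sqr_ge0|exact: fsq_hat].
rewrite [X in vanishing X](_ : _ = fun v => (hat x v)%:C * (nc (a v) ^+ 2)%:C).
  apply: vanishingM; first exact: hat_vanishing.
  have [M M0 hM] := vanishing_bounded (c0_vanishing a).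
  exists (M ^+ 2) => v; rewrite -lecR -ncE ger0_norm ?ler0c ?sqr_ge0// lecR.
  by rewrite ler_sqr ?nnegrE ?nc_ge0 ?hM.
by apply/funext => v; exact: rmorphM.
Qed.

Lemma lact_subproof a (x : X) : (fun e => a (rng e) * x e) \in xgraph_pred.
Proof.
have [M M0 hM] := vanishing_bounded (c0_vanishing a).
apply: (@xgraph_mem _ (fun v => M ^+ 2 * hat x v)) => [v A|].
  apply: (@le_trans _ _ (M ^+ 2 * fsq x v A)).
    rewrite /fsq mulr_sumr; apply: ler_sum => e _.
    case: ifP => _; rewrite ?mulr0// ncM exprMn ler_wpM2r ?sqr_ge0//.
    by rewrite ler_sqr ?nnegrE ?nc_ge0 ?hM.
  by apply: ler_wpM2l; [exact: sqr_ge0|exact: fsq_hat].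
rewrite [X in vanishing X](_ : _ = (M ^+ 2)%:C *: (fun v => (hat x v)%:C)).
  by apply: vanishingZ; exact: hat_vanishing.
by apply/funext => v; exact: rmorphM.
Qed.

Definition ip_term x y v (e : edge E) : R[i] :=
  if src e == v then conjc (x e) * y e else 0.

(* <x,y>(v), the sum of conj(x(e)) y(e) over the edges e with source v *)
Definition xip x y v : R[i] := csum (ip_term x y v).

Lemma ip_term_le (x y : X) v A :
  \sum_(e <- A) nc (ip_term x y v e) <= hat x v + hat y v.
Proof.
apply: (@le_trans _ _ (fsq x v A + fsq y v A)); last by rewrite lerD ?fsq_hat.
rewrite /fsq -big_split/=; apply: ler_sum => e _; rewrite /ip_term.
case: ifP => _; last by rewrite nc0 addr0.
rewrite ncM ncJ; have := sqr_ge0 (nc (x e) - nc (y e)).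
by have := mulr_ge0 (nc_ge0 (x e)) (nc_ge0 (y e)); nra.
Qed.

Lemma xip_has_csum (x y : X) v : has_csum (ip_term x y v) (xip x y v).
Proof. by apply: summable_has_csum; exists (hat x v + hat y v) => A; exact: ip_term_le. Qed.

Lemma xip_subproof (x y : X) : vanishing (xip x y).
Proof.
have h : vanishing ((fun v => (hat x v)%:C) + (fun v => (hat y v)%:C)).
  by apply: vanishingD; exact: hat_vanishing.
apply: vanishing_le h _ => v.
rewrite -[((_ + _) v)]/((hat x v)%:C + (hat y v)%:C).
rewrite -rmorphD -lecR -[leRHS]ncE ger0_norm ?ler0c ?addr_ge0 ?hat_ge0// lecR.
apply: has_csum_le (xip_has_csum x y v) _ => A.
rewrite (le_trans _ (ip_term_le x y v A))//.
elim/big_ind2 : _ => //; first by rewrite nc0.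
by move=> z1 m1 z2 m2 h1 h2; rewrite (le_trans (ncD _ _))// lerD.
Qed.

Lemma xip_self (x : X) v : xip x x v = (hat x v)%:C.
Proof.
apply: has_csumE.
rewrite (_ : ip_term x x v = fun e => (if src e == v then nc (x e) ^+ 2 else 0)%:C).
  apply: has_csum_nneg => [e|A|e e0].
  - by case: ifP => // _; rewrite sqr_ge0.
  - exact: fsq_hat.
  - apply/not_existsP => h.
    have : hat x v <= hat x v - e.
      by apply: hat_le => A; apply: ltW; rewrite ltNge; apply/negP; exact: h.
    by lra.
apply/funext => e; rewrite /ip_term; case: ifP => // _.
rewrite nc_sq; case: (x e) => p q; apply/eqP; rewrite eq_complex/=.
by apply/andP; split; apply/eqP; ring.
Qed.

Definition xract (x : X) a : X := XGraph (ract_subproof x a).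
Definition xlact a (x : X) : X := XGraph (lact_subproof a x).
Definition xgraph_ip (x y : X) : C0E := mk_c0 (xip_subproof x y).

Let ractDl (x y : X) a : xract (x + y) a = xract x a + xract y a.
Proof. by apply: xgraph_eq => e; exact: mulrDl. Qed.
Let ractDr (x : X) a b : xract x (a + b) = xract x a + xract x b.
Proof. by apply: xgraph_eq => e; exact: mulrDr. Qed.
Let ractM (x : X) a b : xract x (cmul a b) = xract (xract x a) b.
Proof. by apply: xgraph_eq => e; exact: mulrA. Qed.
Let ractZl (k : R[i]) (x : X) a : xract (k *: x) a = k *: xract x a.
Proof. by apply: xgraph_eq => e; rewrite /= -mulrA. Qed.
Let ractZr (k : R[i]) (x : X) a : xract x (k *: a) = k *: xract x a.
Proof. by apply: xgraph_eq => e; rewrite /= mulrCA. Qed.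

Let ipDr (x y z : X) : xgraph_ip x (y + z) = xgraph_ip x y + xgraph_ip x z.
Proof.
apply: c0_eq => v; apply: has_csumE.
have := has_csumD (xip_has_csum x y v) (xip_has_csum x z v).
congr has_csum; apply/funext => e; rewrite /ip_term.
by case: ifP => _; rewrite ?addr0// -mulrDr.
Qed.

Let ipZr (k : R[i]) (x y : X) : xgraph_ip x (k *: y) = k *: xgraph_ip x y.
Proof.
apply: c0_eq => v; apply: has_csumE.
have := has_csumZ k (xip_has_csum x y v).
congr has_csum; apply/funext => e; rewrite /ip_term.
by case: ifP => _; rewrite ?mulr0// mulrCA.
Qed.

Let ip_ract (x y : X) a : xgraph_ip x (xract y a) = cmul (xgraph_ip x y) a.
Proof.
apply: c0_eq => v; apply: has_csumE.
have := has_csumZ (a v) (xip_has_csum x y v).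
rewrite [a v * _]mulrC; congr has_csum; apply/funext => e; rewrite /ip_term/=.
by case: ifP => [/eqP ->|_]; rewrite ?mulr0// mulrC mulrA.
Qed.

Let ipC (x y : X) : xgraph_ip y x = cstar (xgraph_ip x y).
Proof.
apply: c0_eq => v; apply: has_csumE.
have := has_csumJ (xip_has_csum x y v).
congr has_csum; apply/funext => e; rewrite /ip_term.
by case: ifP => _; rewrite ?conjc0// conjcM conjcK mulrC.
Qed.

Let ip_ge0 (x : X) : cpositive (xgraph_ip x x).
Proof.
have sv : vanishing (fun v => (Num.sqrt (hat x v))%:C).
  apply/vanishingE => e e0; have e2 : 0 < e ^+ 2 by rewrite exprn_gt0.
  have := (vanishingE _).1 (hat_vanishing x) _ e2; apply: sub_finite_set => v.
  rewrite /mkset -!lecR -!ncE !ger0_norm ?ler0c ?hat_ge0 ?sqrtr_ge0// !lecR => h.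
  by rewrite -[leRHS]sqr_sqrtr ?hat_ge0// ler_sqr ?nnegrE ?sqrtr_ge0// ltW.
exists (mk_c0 sv); apply: c0_eq => v; rewrite -[LHS]/(xip x x v) xip_self.
rewrite -[RHS]/(conjc (Num.sqrt (hat x v))%:C * (Num.sqrt (hat x v))%:C).
rewrite -{1}(sqr_sqrtr (hat_ge0 x v)); apply/eqP; rewrite eq_complex/=.
by apply/andP; split; apply/eqP; ring.
Qed.

Lemma nc_hat (x : X) e : nc (x e) ^+ 2 <= hat x (src e).
Proof.
apply: le_trans (fsq_hat x (src e) [fset e]%fset).
by rewrite /fsq big_seq_fset1 eqxx.
Qed.

Let ip_eq0 (x : X) : xgraph_ip x x = 0 -> x = 0.
Proof.
move=> h; apply: xgraph_eq => e; apply: nc_eq0; apply/eqP.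
rewrite -sqrf_eq0 eq_le sqr_ge0 andbT (le_trans (nc_hat x e))//.
by rewrite -lecR -xip_self -[xip x x _]/(xgraph_ip x x (src e)) h.
Qed.

Let ip_normP (x : X) (M : R) : 0 <= M ->
  (forall v, hat x v <= M) <-> `|xgraph_ip x x| <= M%:C.
Proof.
move=> M0; rewrite c0_normE lecR; split=> [h|h v].
  apply: c0_norm_le => // v; rewrite -lecR -ncE -[xgraph_ip x x v]/(xip x x v).
  by rewrite xip_self ger0_norm ?ler0c ?hat_ge0// lecR.
apply: le_trans h; apply: le_trans (c0_norm_ub _ v).
rewrite -lecR -ncE -[xgraph_ip x x v]/(xip x x v).
by rewrite xip_self ger0_norm ?ler0c ?hat_ge0.
Qed.

Lemma fsq_leB x y v A : fsq x v A <= 2 * fsq (x - y) v A + 2 * fsq y v A.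
Proof. by apply: fsq_leD => e; rewrite -{1}(subrK (y e) (x e)); exact: ncD_sq. Qed.

Lemma fsqBC x y v A : fsq (x - y) v A = fsq (y - x) v A.
Proof.
apply: eq_bigr => e _; case: ifP => // _; congr (_ ^+ 2); exact: ncB.
Qed.

Let ip_complete (u : nat -> X) :
  (forall eps : R, 0 < eps -> exists N : nat, forall m n : nat,
    (N <= m)%N -> (N <= n)%N -> `|xgraph_ip (u m - u n) (u m - u n)| < eps%:C) ->
  exists l, forall eps : R, 0 < eps -> exists N : nat, forall n : nat,
    (N <= n)%N -> `|xgraph_ip (u n - l) (u n - l)| < eps%:C.
Proof.
move=> cu.
have {}cu eps : 0 < eps -> exists N : nat, forall m n : nat,
    (N <= m)%N -> (N <= n)%N -> forall v, hat (u m - u n) v <= eps.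
  move=> e0; have [N hN] := cu _ e0; exists N => m n Nm Nn.
  by apply/ip_normP; [exact: ltW|exact: ltW (hN m n Nm Nn)].
have cvgp (p : R[i] -> R) e : (forall z w : R[i], `|p z - p w| <= nc (z - w)) ->
    cvg ((fun n => p (u n e)) @ \oo).
  move=> hp; apply: R_complete; apply/cauchyP => eps e0.
  have [N hN] := cu ((eps / 2) ^+ 2) (exprn_gt0 _ (divr_gt0 e0 (ltr0Sn R 1))).
  exists (p (u N e)); exists N => // n /= Nn; rewrite -ball_normE/=.
  apply: le_lt_trans (hp _ _) _.
  have : nc (u N e - u n e) ^+ 2 <= (eps / 2) ^+ 2.
    exact: le_trans (nc_hat (u N - u n) e) (hN _ _ (leqnn _) Nn _).
  rewrite ler_sqr ?nnegrE ?nc_ge0//; last by rewrite divr_ge0 ?ltW.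
  by move=> /le_lt_trans; apply; lra.
have Rec e : cvg ((fun n => complex.Re (u n e)) @ \oo).
  by apply: cvgp => z w; rewrite -raddfB ler_Re_nc.
have Imc e : cvg ((fun n => complex.Im (u n e)) @ \oo).
  by apply: cvgp => z w; rewrite -raddfB ler_Im_nc.
pose x e : R[i] := lim ((fun n => complex.Re (u n e)) @ \oo) +i*
  lim ((fun n => complex.Im (u n e)) @ \oo).
have ux e (eps : R) : 0 < eps -> exists N : nat, forall n, (N <= n)%N ->
    nc (u n e - x e) <= eps.
  move=> e0; have e2 : 0 < eps / 2 by rewrite divr_gt0.
  have [N1 _ h1] : \forall n \near \oo, `|complex.Re (u n e) - complex.Re (x e)| <= eps / 2.
    by have /cvgrPdistC_le := Rec e; apply.
  have [N2 _ h2] : \forall n \near \oo, `|complex.Im (u n e) - complex.Im (x e)| <= eps / 2.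
    by have /cvgrPdistC_le := Imc e; apply.
  exists (maxn N1 N2) => n; rewrite geq_max => /andP[n1 n2].
  have b1 := h1 n n1; have b2 := h2 n n2; rewrite /mkset in b1 b2.
  by have := nc_le_ReIm (u n e - x e); rewrite !raddfB => b3; lra.
have uxA v A (eps : R) : 0 < eps -> exists N : nat, forall n, (N <= n)%N ->
    fsq ((u n : edge E -> R[i]) - x) v A <= eps.
  rewrite /fsq; elim: (enum_fset A) eps => [|e r IH] eps e0.
    by exists 0 => n _; rewrite big_nil ltW.
  have e2 : 0 < eps / 2 by rewrite divr_gt0.
  have [N1 h1] := IH _ e2.
  have [|N2 h2] := @ux e (Num.min 1 (eps / 2)); first by rewrite lt_min ltr01.
  exists (maxn N1 N2) => n; rewrite geq_max => /andP[n1 n2].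
  rewrite big_cons; have := h1 n n1; have := h2 n n2; rewrite le_min => /andP[b1 b2] b3.
  rewrite -[X in nc X ^+ 2]/(u n e - x e).
  have b4 : nc (u n e - x e) ^+ 2 <= eps / 2.
    by rewrite (le_trans _ b2)// expr2 ler_piMr ?nc_ge0.
  by case: ifP => _; lra.
have uxK (eps : R) : 0 < eps -> exists N : nat, forall n, (N <= n)%N ->
    forall v A, fsq ((u n : edge E -> R[i]) - x) v A <= 4 * eps.
  move=> e0; have [N hN] := cu _ e0; exists N => n Nn v A.
  have [N' hN'] := uxA v A _ e0; pose m := maxn N N'.
  have h1 := hN n m Nn (leq_maxl _ _) v.
  have h2 := hN' m (leq_maxr _ _).
  apply: (@le_trans _ _ (2 * fsq (u n - u m) v A +
      2 * fsq ((u m : edge E -> R[i]) - x) v A)).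
    apply: fsq_leD => e.
    rewrite -[X in nc X ^+ 2 <= _]/(u n e - x e) -(subrKA (u m e)).
    exact: ncD_sq.
  have := fsq_hat (u n - u m) v A; lra.
have xle (eps : R) : 0 < eps -> exists n : nat, forall v A,
    fsq x v A <= 8 * eps + 2 * hat (u n) v.
  move=> e0; have [N hN] := uxK _ e0; exists N => v A.
  have h1 := hN N (leqnn _) v A; have h2 := fsq_hat (u N) v A.
  have h3 := fsq_leB x (u N) v A; rewrite fsqBC in h3; lra.
have xX : x \in xgraph_pred.
  rewrite inE; split=> [v|].
    have [n hn] := xle 1 ltr01.
    by rewrite (le_lt_trans (xhat_lub (hn v)))// ltry.
  apply/vanishingE => e e0; have [|n hn] := xle (e / 16); first by rewrite divr_gt0.
  have e4 : 0 < e / 4 by rewrite divr_gt0.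
  have := (vanishingE _).1 (hat_vanishing (u n)) _ e4; apply: sub_finite_set => v.
  rewrite /mkset -!lecR -!ncE !ger0_norm ?ler0c ?hat_ge0 ?fine_ge0 ?xhat_ge0// !lecR => h.
  by have := hat_le (hn v); rewrite /hat in h *; lra.
exists (XGraph xX) => eps e0; have [|N hN] := uxK (eps / 8); first by rewrite divr_gt0.
exists N => n Nn.
apply: (@le_lt_trans _ _ (eps / 2)%:C); last by rewrite ltcR; lra.
apply/ip_normP; first by rewrite divr_ge0 ?ltW.
move=> v; apply: hat_le => A; have := hN n Nn v A.
by rewrite -[fsq (u n - XGraph xX) v A]/(fsq ((u n : edge E -> R[i]) - x) v A); lra.
Qed.

HB.instance Definition _ := isHilbertModule.Build R C0E X
  ractDl ractDr ractM ractZl ractZr ipDr ipZr ip_ract ipC ip_ge0 ip_eq0 ip_complete.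

Let lactDl a b (x : X) : xlact (a + b) x = xlact a x + xlact b x.
Proof. by apply: xgraph_eq => e; exact: mulrDl. Qed.
Let lactZl (k : R[i]) a (x : X) : xlact (k *: a) x = k *: xlact a x.
Proof. by apply: xgraph_eq => e; rewrite /= -mulrA. Qed.
Let lactM a b (x : X) : xlact (cmul a b) x = xlact a (xlact b x).
Proof. by apply: xgraph_eq => e; rewrite /= mulrA. Qed.
Let lactDr a (x y : X) : xlact a (x + y) = xlact a x + xlact a y.
Proof. by apply: xgraph_eq => e; exact: mulrDr. Qed.
Let lactZr (k : R[i]) a (x : X) : xlact a (k *: x) = k *: xlact a x.
Proof. by apply: xgraph_eq => e; rewrite /= mulrCA. Qed.
Let lact_ract a (x : X) b : xlact a (ract x b) = ract (xlact a x) b.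
Proof. by apply: xgraph_eq => e; rewrite /= mulrA. Qed.
Let lact_adj a (x y : X) : hip (xlact a x) y = hip x (xlact (cstar a) y).
Proof.
apply: c0_eq => v; congr csum; apply/funext => e; rewrite /ip_term/=.
by case: ifP => // _; rewrite conjcM mulrA [conjc (x e) * _]mulrC.
Qed.

HB.instance Definition _ := isCorrespondence.Build R C0E X
  lactDl lactZl lactM lactDr lactZr lact_ract lact_adj.

Lemma delta_vertex_subproof v :
  vanishing (fun w => (w == v)%:R : R[i]).
Proof.
apply/vanishingE => e e0; apply: sub_finite_set (finite_set1 v) => w.
rewrite /mkset; case: (eqVneq w v) => // _.
by rewrite -[(false%:R : R[i])]/(0 : R[i]) nc0 leNgt e0.
Qed.

Lemma delta_edge_subproof (e : edge E) :
  (fun f => (f == e)%:R : R[i]) \in xgraph_pred.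
Proof.
apply: (@xgraph_mem _ (fun v => (v == src e)%:R)) => [v A|].
  have t0 f : f != e ->
      (if src f == v then nc (f == e)%:R ^+ 2 else 0) = 0.
    by move=> /negPf ->; case: ifP => // _; rewrite nc0 expr0n.
  have te : (if src e == v then nc (e == e)%:R ^+ 2 else 0) = (v == src e)%:R.
    by rewrite [v == _]eq_sym; case: ifP => // _; rewrite nc_sq eqxx/= expr1n expr0n addr0.
  rewrite /fsq; case: (boolP (e \in A)) => eA.
    rewrite (big_fsetD1 e)//= te big_seq big1 ?addr0// => f.
    by rewrite !inE => /andP[fe _]; exact: t0.
  rewrite big_seq big1 ?ler0n// => f fA; apply: t0.
  by apply: contraNneq eA => <-.
apply: vanishing_le (delta_vertex_subproof (src e)) _ => v.
by case: (v == src e).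
Qed.

Definition delta_vertex v : C0E := mk_c0 (delta_vertex_subproof v).
Definition delta_edge (e : edge E) : X := XGraph (delta_edge_subproof e).

End graph_correspondence.

HB.mixin Record isHilbertSpace (R : realType) H
    & CompleteNormedModule R[i] H := {
  dot : H -> H -> R[i];
  dotDr : forall x y z, dot x (y + z) = dot x y + dot x z;
  dotZr : forall (k : R[i]) x y, dot x (k *: y) = k * dot x y;
  dotC : forall x y, dot y x = conjc (dot x y);
  dot_norm : forall x, `|x| ^+ 2 = dot x x
}.

#[short(type="hilbertType")]
HB.structure Definition HilbertSpace (R : realType) :=
  {H of isHilbertSpace R H & CompleteNormedModule R[i] H}.

Section cstar_morphisms.
Variable R : realType.

Definition star_hom (A B : cstarAlgType R) (f : A -> B) :=
  [/\ linear f,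
      forall a b, f (cmul a b) = cmul (f a) (f b) &
      forall a, f (cstar a) = cstar (f a)].

Definition star_iso (A B : cstarAlgType R) (f : A -> B) :=
  star_hom f /\ bijective f.

Definition toeplitz_rep (A : cstarAlgType R) (X : correspondenceType A)
    (B : cstarAlgType R) (sigma : X -> B) (pi : A -> B) :=
  [/\ linear sigma,
      star_hom pi,
      forall x a, sigma (ract x a) = cmul (sigma x) (pi a),
      forall a x, sigma (lact a x) = cmul (pi a) (sigma x) &
      forall x y, pi (hip x y) = cmul (cstar (sigma x)) (sigma y)].

(* (T, sigma_u, pi_u) is universal among Toeplitz representations of X; this
   determines it up to a unique isomorphism. *)
Definition toeplitz_algebra (A : cstarAlgType R) (X : correspondenceType A)
    (T : cstarAlgType R) (sigma_u : X -> T) (pi_u : A -> T) :=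
  toeplitz_rep sigma_u pi_u /\
  forall (B : cstarAlgType R) (sigma : X -> B) (pi : A -> B),
    toeplitz_rep sigma pi ->
    exists! rho : T -> B,
      [/\ star_hom rho, sigma = rho \o sigma_u & pi = rho \o pi_u].

Definition coherent_unitary_equivalence (A B : cstarAlgType R)
    (X : correspondenceType A) (Y : correspondenceType B)
    (U : X -> Y) (alpha : A -> B) :=
  [/\ linear U,
      star_iso alpha,
      forall x a, U (ract x a) = ract (U x) (alpha a),
      forall a x, U (lact a x) = lact (alpha a) (U x) &
      exists V : Y -> X, [/\ cancel U V, cancel V U &
        forall x y, hip (U x) y = alpha (hip x (V y))]].

(* Gamma is the automorphism given by the universal property applied to
   (sigma_u \o U, pi_u \o alpha); the two equations determine it. *)
Definition induced_automorphism (A : cstarAlgType R) (X : correspondenceType A)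
    (T : cstarAlgType R) (sigma_u : X -> T) (pi_u : A -> T)
    (U : X -> X) (alpha : A -> A) (Gamma : T -> T) :=
  [/\ star_iso Gamma,
      forall x, Gamma (sigma_u x) = sigma_u (U x) &
      forall a, Gamma (pi_u a) = pi_u (alpha a)].

End cstar_morphisms.

Section operators.
Variables (R : realType) (H : hilbertType R).
Implicit Types (S Q w : H -> H) (W : set (H -> H)).

(* Operators on H are plain functions H -> H; B(H) is the set of those that
   satisfy bounded_op (for linear maps, continuous = bounded). *)
Definition bounded_op S := linear S /\ continuous S.

Definition adjoint_ops S Q := forall x y, dot (S x) y = dot x (Q y).

Definition commutant W : set (H -> H) :=
  [set S | bounded_op S /\ forall Q, W Q -> S \o Q = Q \o S].

(* gamma only matters on W.  Preservation of the adjoint relation is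
   gamma(S^* ) = gamma(S)^*, as S^* lies in W whenever S does. *)
Definition star_automorphism W (gamma : (H -> H) -> (H -> H)) :=
  [/\ set_bij W W gamma,
      forall (k : R[i]) S Q, W S -> W Q ->
        gamma (k *: S + Q) = k *: gamma S + gamma Q,
      forall S Q, W S -> W Q -> gamma (S \o Q) = gamma S \o gamma Q &
      forall S Q, W S -> W Q -> adjoint_ops S Q ->
        adjoint_ops (gamma S) (gamma Q)].

Definition conjugate_endomorphisms W (beta1 beta2 : (H -> H) -> (H -> H)) :=
  exists gamma, star_automorphism W gamma /\
    forall w, W w -> beta1 (gamma w) = gamma (beta2 w).

(* *-representations A -> B(H); the last clause is tau(a^* ) = tau(a)^* *)
Definition star_rep (A : cstarAlgType R) (tau : A -> H -> H) :=
  [/\ forall a, bounded_op (tau a),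
      linear tau,
      forall a b, tau (cmul a b) = tau a \o tau b &
      forall a, adjoint_ops (tau a) (tau (cstar a))].

(* the linear span of the tau(a) k is dense in H *)
Definition nondegenerate_rep (A : cstarAlgType R) (tau : A -> H -> H) :=
  closure [set h | exists n (a : 'I_n -> A) (k : 'I_n -> H),
    h = \sum_(i < n) tau (a i) (k i)] = setT.

End operators.

Definition unitarily_equivalent (R : realType) (A : cstarAlgType R)
    (H K : hilbertType R) (tau : A -> H -> H) (tau' : A -> K -> K) :=
  exists V : H -> K,
    [/\ linear V, bijective V, forall x y, dot (V x) (V y) = dot x y &
        forall a, V \o tau a = tau' a \o V].

Section Ad.
Variables (R : realType) (E : graph) (T : cstarAlgType R).
Variables (sigma_u : xgraph R E -> T) (pi_u : c0 R (vertex E) -> T).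
Variables (H : hilbertType R) (tau : T -> H -> H).

Definition vertex_ops : set (H -> H) :=
  range (fun v => tau (pi_u (delta_vertex R v))).

(* The adjoint of tau(delta_e) is tau(delta_e^* ).  Strong operator convergence
   is convergence at each vector h; the sum over the edges is unordered. *)
Definition Ad (w : H -> H) (h : H) : H :=
  summability.sum (fun e => tau (sigma_u (delta_edge R e))
                  (w (tau (cstar (sigma_u (delta_edge R e))) h))).

End Ad.

(* Main.v *)
Require Import Defs.
From HB Require Import structures.
From mathcomp Require Import all_boot all_order all_algebra finmap.
From mathcomp Require Import all_classical all_reals all_analysis.
From mathcomp Require Import complex ring lra.
From mathcomp Require Import showcase.summability.

Set Implicit Arguments.
Unset Strict Implicit.
Unset Printing Implicit Defensive.
Import Order.TTheory GRing.Theory Num.Theory.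
Import numFieldNormedType.Exports.
Local Open Scope classical_set_scope.
Local Open Scope ring_scope.
Local Open Scope complex_scope.

(* On the commutant W of the vertex projections, i.e. on the block diagonal
   operators, a conjugacy gamma is implemented by a unitary V: it permutes the
   minimal central projections of W, and on the block of a unit vector xi one
   puts V x = gamma(|x><xi|) eta, for a unit vector eta fixed by gamma(|xi><xi|).
   Then B = V tau2(x) V^* satisfies Ad_1(w) B = B w for w in W, so each
   tau1(delta_f)^* B commutes with W, hence is a scalar on blocks; these scalars
   are the coordinates of an element U x of X(E) with tau1(U x) = B.  Everything
   else follows from faithfulness and universality, the latter applied to
   representations in B(H) and in B(l^2), where the Fock representation shows
   that the vertex projections of the Toeplitz algebra are nonzero. *)

(** [T] is given only by its universal property, so there is no dense generated subalgebra to argue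
    on. Statements about all of [T], among them that non-degeneracy makes the vertex projections add
    up to the identity, come from the uniqueness of a homomorphism with prescribed values on the
    generators. For this, B(H) is needed as a C*-algebra; it is built from the operators that have a
    bounded adjoint. The automorphism [gamma] is purely algebraic and comes with no continuity, so
    no infinite sum is ever pushed through it. It is evaluated on single operators, mostly of rank
    one, and sums are formed afterwards from orthogonal vectors. The relation for B rests on
    [Ad_2(w) tau2(x) = tau2(x) w] for w in W. It holds because the sum of the [S_e S_e^*], in
    general not the identity, acts as the identity on the range of each [tau2(x)]. The map U is
    invertible because the same construction, with [tau1] and [tau2] exchanged and V replaced by its
    inverse, yields the reverse map. *)

Lemma conjcD (R : realType) (z w : R[i]) : conjc (z + w) = conjc z + conjc w.
Proof. exact: (rmorphD (@conjc R)). Qed.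

Lemma conjcN (R : realType) (z : R[i]) : conjc (- z) = - conjc z.
Proof. exact: (rmorphN (@conjc R)). Qed.

(** * Semidefinite inner products and the Cauchy-Schwarz inequality *)

Section inner_product.
Variables (R : realType) (V : lmodType R[i]) (ip : V -> V -> R[i]).
Hypothesis ipDr : forall x y z, ip x (y + z) = ip x y + ip x z.
Hypothesis ipZr : forall (k : R[i]) x y, ip x (k *: y) = k * ip x y.
Hypothesis ipC : forall x y, ip y x = conjc (ip x y).
Hypothesis ip_ge0 : forall x, 0 <= ip x x.
Local Notation nc := (@ComplexField.Normc.normc R).

Definition ipsq x : R := complex.Re (ip x x).

Lemma ipsqE x : ip x x = (ipsq x)%:C.
Proof.
have := ip_ge0 x; rewrite lecE /= => /andP[/eqP h _].
by rewrite /ipsq; case: (ip x x) h => a b /= ->.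
Qed.

Lemma ipsq_ge0 x : 0 <= ipsq x.
Proof. by rewrite -ler0c -ipsqE. Qed.

Lemma ipDl x y z : ip (x + y) z = ip x z + ip y z.
Proof. by rewrite ipC ipDr conjcD -!ipC. Qed.

Lemma ipZl (k : R[i]) x y : ip (k *: x) y = conjc k * ip x y.
Proof. by rewrite ipC ipZr conjcM -ipC. Qed.

Lemma ipsqD x y : ipsq (x + y) = ipsq x + ipsq y + 2 * complex.Re (ip x y).
Proof.
rewrite /ipsq ipDr !ipDl (ipC x y); case: (ip x y) => a b; rewrite !raddfD /=.
ring.
Qed.

Lemma ipsqZ (k : R[i]) x : ipsq (k *: x) = nc k ^+ 2 * ipsq x.
Proof.
rewrite {1}/ipsq ipZr ipZl ipsqE nc_sq; case: k => a b /=.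
ring.
Qed.

(** The square of [x - s <y, x> y] is a quadratic polynomial in the real number [s], evaluated at
    [s = 1 / ipsq y]. Since the form is only semidefinite here, [ipsq y = 0] is a separate case,
    settled by a large [s]. *)
Lemma cauchy_schwarz_sq x y : nc (ip x y) ^+ 2 <= ipsq x * ipsq y.
Proof.
set a := nc (ip x y) ^+ 2.
have a0 : 0 <= a by exact: sqr_ge0.
have key (s : R) : 0 <= ipsq x - 2 * s * a + s ^+ 2 * a * ipsq y.
  have := ipsq_ge0 (x + (- s%:C * ip y x) *: y).
  rewrite ipsqD ipsqZ ncM ncN exprMn ipZr (ipC x y) ncJ -/a [nc s%:C ^+ 2]nc_sq/=.
  rewrite /a nc_sq; case: (ip x y) => p q /=; lra.
have y0 := ipsq_ge0 y; have x0 := ipsq_ge0 x.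
have [y1|y1] := eqVneq (ipsq y) 0.
  rewrite y1 mulr0 leNgt; apply/negP => a1.
  (* With this [s] the quadratic equals [- 1]. *)
  have := key ((ipsq x + 1) / (2 * a)); rewrite y1.
  have -> : 2 * ((ipsq x + 1) / (2 * a)) * a = ipsq x + 1 by field; rewrite gt_eqF.
  lra.
have {}y1 : 0 < ipsq y by rewrite lt_neqAle eq_sym y1.
have := key (ipsq y)^-1.
have -> : (ipsq y)^-1 ^+ 2 * a * ipsq y = a / ipsq y by field; rewrite gt_eqF.
move=> h; rewrite -ler_pdivrMr//; move: h; rewrite -mulrA [_^-1 * _]mulrC; lra.
Qed.

Definition ipnorm x : R := Num.sqrt (ipsq x).

Lemma ipnorm_ge0 x : 0 <= ipnorm x. Proof. exact: sqrtr_ge0. Qed.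

Lemma ipnorm_sq x : ipnorm x ^+ 2 = ipsq x.
Proof. by rewrite sqr_sqrtr ?ipsq_ge0. Qed.

Lemma cauchy_schwarz_ip x y : nc (ip x y) <= ipnorm x * ipnorm y.
Proof.
rewrite -ler_sqr ?nnegrE ?nc_ge0 ?mulr_ge0 ?ipnorm_ge0//.
by rewrite exprMn !ipnorm_sq cauchy_schwarz_sq.
Qed.

Lemma ipnormD x y : ipnorm (x + y) <= ipnorm x + ipnorm y.
Proof.
rewrite -ler_sqr ?nnegrE ?addr_ge0 ?ipnorm_ge0// ipnorm_sq ipsqD sqrrD !ipnorm_sq.
have := cauchy_schwarz_ip x y; have := ler_Re_nc (ip x y); rewrite ler_norml.
by move=> /andP[_ h1] h2; have := le_trans h1 h2; lra.
Qed.

Lemma ipnormZ (k : R[i]) x : ipnorm (k *: x) = nc k * ipnorm x.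
Proof. by rewrite /ipnorm ipsqZ sqrtrM ?sqr_ge0// sqrtr_sqr ger0_norm ?nc_ge0. Qed.

End inner_product.

(** * Lengths and inner products in a Hilbert space *)

Section hilbert_basics.
Variables (R : realType) (H : hilbertType R).
Implicit Types (x y z : H) (k : R[i]).
Local Notation nc := (@ComplexField.Normc.normc R).

Definition hlen x : R := complex.Re `|x|.

Lemma hlenE x : `|x| = (hlen x)%:C.
Proof.
have := normr_ge0 x; rewrite lecE /= => /andP[/eqP h _].
by rewrite /hlen; case: (`|x|) h => a b /= ->.
Qed.

Lemma hlen_ge0 x : 0 <= hlen x.
Proof. by rewrite -ler0c -hlenE. Qed.

Lemma dot_ge0 x : 0 <= dot x x.
Proof. by rewrite -dot_norm exprn_ge0. Qed.

Definition hsq x : R := ipsq (@dot R H) x.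

Lemma hlen_sq x : hlen x ^+ 2 = hsq x.
Proof.
by apply: complexI; rewrite rmorphXn/= -hlenE dot_norm /hsq -(ipsqE dot_ge0).
Qed.

Lemma dot_hsq x : dot x x = (hsq x)%:C.
Proof. exact: ipsqE dot_ge0 x. Qed.

Lemma hsq_ge0 x : 0 <= hsq x. Proof. by rewrite -hlen_sq sqr_ge0. Qed.

Lemma ipnorm_dot x : ipnorm (@dot R H) x = hlen x.
Proof. by rewrite /ipnorm -/(hsq x) -hlen_sq sqrtr_sqr ger0_norm ?hlen_ge0. Qed.

Lemma cauchy_schwarz x y : nc (dot x y) <= hlen x * hlen y.
Proof.
rewrite -!ipnorm_dot; exact: (cauchy_schwarz_ip (@dotDr R H) (@dotZr R H) (@dotC R H) dot_ge0).
Qed.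

Lemma dotDl x y z : dot (x + y) z = dot x z + dot y z.
Proof. exact: ipDl (@dotDr R H) (@dotC R H) _ _ _. Qed.

Lemma dotZl k x y : dot (k *: x) y = conjc k * dot x y.
Proof. exact: ipZl (@dotZr R H) (@dotC R H) _ _ _. Qed.

Lemma dot0r x : dot x 0 = 0.
Proof. by rewrite -(scale0r 0) dotZr mul0r. Qed.

Lemma dot0l x : dot 0 x = 0.
Proof. by rewrite dotC dot0r conjc0. Qed.

Lemma dotNr x y : dot x (- y) = - dot x y.
Proof. by rewrite -scaleN1r dotZr mulN1r. Qed.

Lemma dotNl x y : dot (- x) y = - dot x y.
Proof. by rewrite dotC dotNr conjcN -dotC. Qed.

Lemma dotBr x y z : dot x (y - z) = dot x y - dot x z.
Proof. by rewrite dotDr dotNr. Qed.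

Lemma dotBl x y z : dot (x - y) z = dot x z - dot y z.
Proof. by rewrite dotDl dotNl. Qed.

Lemma dot_sumr (I : Type) (r : seq I) (P : pred I) (F : I -> H) x :
  dot x (\sum_(i <- r | P i) F i) = \sum_(i <- r | P i) dot x (F i).
Proof. by elim/big_ind2 : _ => [|? ? ? ? <- <-|//]; rewrite ?dot0r ?dotDr. Qed.

Lemma dot_suml (I : Type) (r : seq I) (P : pred I) (F : I -> H) x :
  dot (\sum_(i <- r | P i) F i) x = \sum_(i <- r | P i) dot (F i) x.
Proof. by elim/big_ind2 : _ => [|? ? ? ? <- <-|//]; rewrite ?dot0l ?dotDl. Qed.

Lemma hsqD x y : hsq (x + y) = hsq x + hsq y + 2 * complex.Re (dot x y).
Proof. exact: ipsqD (@dotDr R H) (@dotC R H) _ _. Qed.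

Lemma hlenD x y : hlen (x + y) <= hlen x + hlen y.
Proof. by have := ler_normD x y; rewrite !hlenE -rmorphD lecR. Qed.

Lemma hlenZ k x : hlen (k *: x) = nc k * hlen x.
Proof. by apply: complexI; have := normrZ k x; rewrite !hlenE ncE -rmorphM. Qed.

Lemma hlenN x : hlen (- x) = hlen x.
Proof. by rewrite /hlen normrN. Qed.

Lemma hlenB x y : hlen (x - y) = hlen (y - x).
Proof. by rewrite -hlenN opprB. Qed.

Lemma hlen0 : hlen 0 = 0.
Proof. by apply: complexI; rewrite -hlenE normr0. Qed.

Lemma hlen_eq0 x : hlen x = 0 -> x = 0.
Proof. by move=> h; apply/eqP; rewrite -normr_eq0 hlenE h. Qed.

Lemma hsq_eq0 x : hsq x = 0 -> x = 0.
Proof. by rewrite -hlen_sq => /eqP; rewrite sqrf_eq0 => /eqP /hlen_eq0. Qed.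

Lemma hsqZ k x : hsq (k *: x) = nc k ^+ 2 * hsq x.
Proof. by rewrite -!hlen_sq hlenZ exprMn. Qed.

Lemma hlen_small x : (forall e : R, 0 < e -> hlen x <= e) -> x = 0.
Proof.
move=> h; apply: hlen_eq0; apply/eqP; rewrite eq_le hlen_ge0 andbT.
by apply/ler_addgt0Pr => e e0; rewrite add0r h.
Qed.

Lemma dot_injl x y : (forall z, dot z x = dot z y) -> x = y.
Proof.
move=> h; apply/eqP; rewrite -subr_eq0; apply/eqP; apply: hsq_eq0.
by apply: complexI; rewrite -dot_hsq dotBr h subrr.
Qed.

Lemma dot_injr x y : (forall z, dot x z = dot y z) -> x = y.
Proof. by move=> h; apply: dot_injl => z; rewrite dotC h -dotC. Qed.

End hilbert_basics.
Arguments hlen {R H} x.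
Arguments hsq {R H} x.

Section linear_facts.
Variables (R : realType) (V U : lmodType R[i]) (f : V -> U).
Hypothesis lf : linear f.

Lemma linear_for_D x y : f (x + y) = f x + f y.
Proof. by rewrite -[x in LHS]scale1r lf scale1r. Qed.

Lemma linear_for_0 : f 0 = 0.
Proof. by apply: (addrI (f 0)); rewrite -linear_for_D !addr0. Qed.

Lemma linear_for_Z k x : f (k *: x) = k *: f x.
Proof. by rewrite -[k *: x]addr0 lf linear_for_0 addr0. Qed.

Lemma linear_for_N x : f (- x) = - f x.
Proof. by rewrite -scaleN1r linear_for_Z scaleN1r. Qed.

Lemma linear_for_B x y : f (x - y) = f x - f y.
Proof. by rewrite linear_for_D linear_for_N. Qed.

Lemma linear_for_sum (I : Type) (r : seq I) (P : pred I) (F : I -> V) :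
  f (\sum_(i <- r | P i) F i) = \sum_(i <- r | P i) f (F i).
Proof.
by elim/big_ind2 : _ => [|? ? ? ? <- <-|//]; rewrite ?linear_for_0 ?linear_for_D.
Qed.

End linear_facts.

(** * Bounded operators, adjoints and the operator norm *)

Section bounded_operators.
Variables (R : realType) (H : hilbertType R).
Implicit Types (x y z : H) (k : R[i]) (S Q w : H -> H) (M : R).
Local Notation nc := (@ComplexField.Normc.normc R).

Definition op_bound S M := 0 <= M /\ forall x, hlen (S x) <= M * hlen x.

Lemma bounded_opP S : bounded_op S <-> linear S /\ exists M, op_bound S M.
Proof.
split=> [[lS cS]|[lS [M [M0 hM]]]]; split=> //.
  have /cvgrPdist_lt /(_ 1 ltr01) := cS 0.
  rewrite (linear_for_0 lS) => /nbhs_ballP[d /= d0 hd].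
  have /complex_realP[dR dE] : d \is Num.real by exact: gtr0_real.
  have dR0 : 0 < dR by rewrite -ltcR -dE.
  (* The ball of radius [dR] is mapped into the unit ball; rescaling [x] to length [dR / 2] gives
     this constant. *)
  exists (2 / dR); split; first by rewrite divr_ge0// ltW.
  move=> x; have [x0|x0] := eqVneq (hlen x) 0.
    by rewrite (hlen_eq0 x0) (linear_for_0 lS) hlen0 mulr0.
  have {}x0 : 0 < hlen x by rewrite lt_neqAle eq_sym x0 hlen_ge0.
  pose c := dR / (2 * hlen x).
  have c0 : 0 < c by rewrite divr_gt0// mulr_gt0.
  have := hd (c%:C *: x); rewrite -ball_normE /ball_/= !sub0r !normrN !hlenE dE !ltcR.
  rewrite (linear_for_Z lS) !hlenZ.
  have -> : nc c%:C = c by rewrite /= expr0n addr0 sqrtr_sqr gtr0_norm.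
  have -> : c * hlen x = dR / 2 by rewrite /c; field; rewrite gt_eqF.
  move=> /(_ ltac:(lra)); rewrite mulrC -ltr_pdivlMr// => /ltW/le_trans; apply.
  by rewrite /c le_eqVlt; apply/orP; left; apply/eqP; field; rewrite !gt_eqF.
move=> x; apply/cvgrPdist_lt => e e0.
have /complex_realP[eR eE] : e \is Num.real by exact: gtr0_real.
have eR0 : 0 < eR by rewrite -ltcR -eE.
have M1 : 0 < M + 1 by lra.
apply/nbhs_ballP; exists (eR / (M + 1))%:C => /=; first by rewrite ltcR divr_gt0.
move=> y; rewrite -ball_normE /ball_/= hlenE ltcR ltr_pdivlMr// => h.
rewrite -(linear_for_B lS) hlenE eE ltcR; have := hM (x - y).
have := hlen_ge0 (x - y); lra.
Qed.

Lemma mk_bounded_op S M : linear S -> 0 <= M ->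
  (forall x, hlen (S x) <= M * hlen x) -> bounded_op S.
Proof. by move=> lS M0 hM; apply/bounded_opP; split=> //; exists M. Qed.

Lemma bounded_op_comp S Q : bounded_op S -> bounded_op Q -> bounded_op (S \o Q).
Proof.
move=> [lS cS] [lQ cQ]; split=> [k x y|x]; first by rewrite /= lQ lS.
by apply: continuous_comp; [exact: cQ|exact: cS].
Qed.

Lemma bounded_op_id : bounded_op (@idfun H).
Proof. by apply: (@mk_bounded_op _ 1) => // x; rewrite mul1r. Qed.

Lemma bounded_op_lin S Q k : bounded_op S -> bounded_op Q -> bounded_op (k *: S + Q).
Proof.
move=> /bounded_opP[lS [M1 [M10 h1]]] /bounded_opP[lQ [M2 [M20 h2]]].
apply: (@mk_bounded_op _ (nc k * M1 + M2)); last 1 first.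
- move=> x; rewrite -[(k *: S + Q) x]/(k *: S x + Q x).
  apply: le_trans (hlenD _ _) _; rewrite hlenZ mulrDl.
  by rewrite lerD// -mulrA ler_wpM2l ?nc_ge0.
- move=> l x y; rewrite -[LHS]/(k *: S (l *: x + y) + Q (l *: x + y)) lS lQ.
  rewrite -[RHS]/(l *: (k *: S x + Q x) + (k *: S y + Q y)).
  by rewrite !scalerDr !scalerA [k * l]mulrC addrACA.
- by rewrite addr_ge0// mulr_ge0// nc_ge0.
Qed.

Lemma bounded_op0 : bounded_op (0 : H -> H).
Proof.
apply: (@mk_bounded_op _ 0) => // [k x y|x].
  by rewrite -[LHS]/(0 : H) -[RHS]/(k *: 0 + 0 : H) scaler0 addr0.
by rewrite -[(0 : H -> H) x]/(0 : H) hlen0 mul0r.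
Qed.

Lemma adjoint_opsC S Q : adjoint_ops S Q -> adjoint_ops Q S.
Proof. by move=> h x y; rewrite dotC -h -dotC. Qed.

Lemma adjoint_ops_unique S Q1 Q2 : adjoint_ops S Q1 -> adjoint_ops S Q2 -> Q1 = Q2.
Proof. by move=> h1 h2; apply/funext => x; apply: dot_injl => z; rewrite -h1 h2. Qed.

Lemma adjoint_ops_comp S Q S' Q' : adjoint_ops S S' -> adjoint_ops Q Q' ->
  adjoint_ops (S \o Q) (Q' \o S').
Proof. by move=> h1 h2 x y; rewrite /= h1 h2. Qed.

Lemma adjoint_ops_lin S Q S' Q' k : adjoint_ops S S' -> adjoint_ops Q Q' ->
  adjoint_ops (k *: S + Q) (conjc k *: S' + Q').
Proof.
move=> h1 h2 x y; rewrite -[(k *: S + Q) x]/(k *: S x + Q x).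
by rewrite -[(_ + Q') y]/(conjc k *: S' y + Q' y) dotDl dotZl dotDr dotZr h1 h2.
Qed.

(** [hsq (Q x) = dot (S (Q x)) x <= M * hlen (Q x) * hlen x] by Cauchy-Schwarz, and one factor
    [hlen (Q x)] cancels. *)
Lemma op_bound_adjoint S Q M : adjoint_ops S Q -> op_bound S M -> op_bound Q M.
Proof.
move=> h [M0 hM]; split=> // x.
have : hsq (Q x) <= M * hlen (Q x) * hlen x.
  rewrite -lecR -dot_hsq -h; apply: (@le_trans _ _ (nc (dot (S (Q x)) x))%:C).
    have d0 : 0 <= dot (S (Q x)) x by rewrite h dot_ge0.
    by rewrite -{1}(ger0_norm d0) ncE.
  rewrite lecR (le_trans (cauchy_schwarz _ _))// ler_wpM2r ?hlen_ge0//.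
have := hlen_ge0 (Q x); rewrite le_eqVlt => /orP[/eqP <- _|q0].
  by rewrite mulr_ge0// hlen_ge0.
by rewrite -hlen_sq expr2 mulrAC ler_pM2r.
Qed.

Definition opnorm S : R := sup [set hlen (S x) | x in [set x | hlen x <= 1]].

Lemma opnorm_nonempty S : [set hlen (S x) | x in [set x | hlen x <= 1]] !=set0.
Proof. by exists (hlen (S 0)), 0 => //=; rewrite hlen0. Qed.

Lemma opnorm_le S M : op_bound S M -> opnorm S <= M.
Proof.
move=> [M0 hM]; apply: ge_sup; first exact: opnorm_nonempty.
by move=> _ [x /= x1 <-]; rewrite (le_trans (hM x))// ler_piMr.
Qed.

Lemma opnorm_bound S : bounded_op S -> op_bound S (opnorm S).
Proof.
move=> /bounded_opP[lS [M [M0 hM]]].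
have ub x : hlen x <= 1 -> hlen (S x) <= opnorm S.
  move=> x1; apply: ub_le_sup; last by exists x.
  by exists M => _ [y /= y1 <-]; rewrite (le_trans (hM y))// ler_piMr.
split; first by rewrite (le_trans (hlen_ge0 (S 0)))// ub// hlen0.
move=> x; have [x0|x0] := eqVneq (hlen x) 0.
  by rewrite (hlen_eq0 x0) (linear_for_0 lS) hlen0 mulr0.
have {}x0 : 0 < hlen x by rewrite lt_neqAle eq_sym x0 hlen_ge0.
have nci : nc (hlen x)^-1%:C = (hlen x)^-1.
  by rewrite /= expr0n addr0 sqrtr_sqr gtr0_norm// invr_gt0.
have := ub ((hlen x)^-1%:C *: x); rewrite (linear_for_Z lS) !hlenZ nci.
by rewrite mulVf ?gt_eqF// lexx ler_pdivrMl// mulrC => /(_ isT).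
Qed.

Lemma opnorm_ge0 S : bounded_op S -> 0 <= opnorm S.
Proof. by move=> /opnorm_bound[]. Qed.

Lemma opnorm_adjoint S Q : bounded_op S -> bounded_op Q -> adjoint_ops S Q ->
  opnorm Q = opnorm S.
Proof.
move=> bS bQ h; apply/eqP; rewrite eq_le !opnorm_le//.
  exact: op_bound_adjoint (adjoint_opsC h) (opnorm_bound bQ).
exact: op_bound_adjoint h (opnorm_bound bS).
Qed.

End bounded_operators.

(** * The C*-algebra of adjointable bounded operators *)

Section operator_algebra.
Variables (R : realType) (H : hilbertType R).
Local Notation nc := (@ComplexField.Normc.normc R).

(** Having a bounded adjoint is part of membership, which avoids the Riesz representation theorem:
    the operators of a [star_rep] come with their adjoints, and on square-summable families the
    adjoint is constructed by hand. *)
Definition bop_pred : {pred H -> H} :=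
  [pred S | `[< exists Q, [/\ bounded_op S, bounded_op Q & adjoint_ops S Q] >]].

Record bop := Bop { bop_fun :> H -> H ; bopP : bop_fun \in bop_pred }.

HB.instance Definition _ := [isSub for bop_fun].
HB.instance Definition _ := [Choice of bop by <:].

Lemma bop_submod_closed : submod_closed bop_pred.
Proof.
split=> [|k S Q]; rewrite !inE.
  exists 0; split; [exact: bounded_op0|exact: bounded_op0|].
  by move=> x y; rewrite -[_ x]/(0 : H) -[RHS]/(dot x (0 : H)) dot0l dot0r.
move=> [S' [bS bS' aS]] [Q' [bQ bQ' aQ]]; exists (conjc k *: S' + Q').
by split; [exact: bounded_op_lin|exact: bounded_op_lin|exact: adjoint_ops_lin].
Qed.

HB.instance Definition _ := GRing.isSubmodClosed.Build R[i] _ bop_pred bop_submod_closed.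
HB.instance Definition _ := [SubChoice_isSubLmodule of bop by <:].

Implicit Types (S Q : bop) (k : R[i]).

Lemma bop_eq S Q : (forall x, S x = Q x) -> S = Q.
Proof. by move=> h; apply: val_inj; apply/funext. Qed.

Lemma bop_linE k S Q x : (k *: S + Q) x = k *: S x + Q x.
Proof. by []. Qed.

Lemma bop_adjoint_ex S :
  exists Q : H -> H, [/\ bounded_op S, bounded_op Q & adjoint_ops S Q].
Proof. by have := bopP S; rewrite inE. Qed.

Lemma bop_bounded S : bounded_op S.
Proof. by have [? []] := bop_adjoint_ex S. Qed.

Lemma bop_linear S : linear S.
Proof. by case: (bop_bounded S). Qed.

Lemma mk_bop_subproof (S Q : H -> H) :
  bounded_op S -> bounded_op Q -> adjoint_ops S Q -> S \in bop_pred.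
Proof. by move=> bS bQ h; rewrite inE; exists Q; split. Qed.

Definition mk_bop (S Q : H -> H) (bS : bounded_op S) (bQ : bounded_op Q)
  (h : adjoint_ops S Q) : bop := Bop (mk_bop_subproof bS bQ h).

Let norm S : R[i] := (opnorm S)%:C.

Lemma bop_norm_le S x : hlen (S x) <= opnorm S * hlen x.
Proof. by have [] := opnorm_bound (bop_bounded S). Qed.

Lemma bop_norm_ge0 S : 0 <= opnorm S.
Proof. exact: opnorm_ge0 (bop_bounded S). Qed.

Let ler_normD S Q : norm (S + Q) <= norm S + norm Q.
Proof.
rewrite -rmorphD lecR; apply: opnorm_le; split.
  by rewrite addr_ge0 ?bop_norm_ge0.
move=> x; rewrite -[(S + Q) x]/(S x + Q x) (le_trans (hlenD _ _))//.
by rewrite mulrDl lerD ?bop_norm_le.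
Qed.

Let normrZ k S : norm (k *: S) = `|k| * norm S.
Proof.
rewrite ncE -rmorphM; congr _%:C.
have le1 (l : R[i]) Q : opnorm (l *: Q) <= nc l * opnorm Q.
  apply: opnorm_le; split; first by rewrite mulr_ge0 ?nc_ge0 ?bop_norm_ge0.
  move=> x; rewrite -[(l *: Q) x]/(l *: Q x) hlenZ -mulrA.
  by rewrite ler_wpM2l ?nc_ge0 ?bop_norm_le.
apply/eqP; rewrite eq_le le1 andTb.
have [->|k0] := eqVneq k 0; first by rewrite nc0 mul0r bop_norm_ge0.
have nck : 0 < nc k.
  by rewrite lt0r nc_ge0 andbT; apply: contra_neq k0 => /nc_eq0.
have := le1 k^-1 (k *: S); rewrite scalerA mulVf// scale1r.
have -> : nc k^-1 = (nc k)^-1.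
  by apply: (mulfI (lt0r_neq0 nck)); rewrite -ncM divff//= divff ?gt_eqF// expr1n expr0n/= addr0 sqrtr1.
by rewrite ler_pdivlMl.
Qed.

Let normr0_eq0 S : norm S = 0 -> S = 0.
Proof.
move=> /complexI h; apply: bop_eq => x; apply: hlen_eq0.
by apply/eqP; rewrite eq_le hlen_ge0 andbT (le_trans (bop_norm_le S x))// h mul0r.
Qed.

HB.instance Definition _ :=
  Lmodule_isNormed.Build R[i] bop ler_normD normrZ normr0_eq0.

Lemma bop_normE S : `|S| = (opnorm S)%:C.
Proof. by []. Qed.

Definition bop_adj S : H -> H := projT1 (cid (bop_adjoint_ex S)).

Lemma bop_adjP S : [/\ bounded_op S, bounded_op (bop_adj S) & adjoint_ops S (bop_adj S)].
Proof. exact: projT2 (cid (bop_adjoint_ex S)). Qed.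

Lemma bop_adj_adjoint S : adjoint_ops S (bop_adj S).
Proof. by case: (bop_adjP S). Qed.

Lemma bop_adj_bounded S : bounded_op (bop_adj S).
Proof. by case: (bop_adjP S). Qed.

Lemma bop_adjB S Q : bop_adj (S - Q) = bop_adj S - bop_adj Q.
Proof.
apply: adjoint_ops_unique (bop_adj_adjoint (S - Q)) _ => x y.
rewrite -[(S - Q) x]/(S x - Q x) -[(_ - bop_adj Q) y]/(bop_adj S y - bop_adj Q y).
by rewrite dotBl dotBr !bop_adj_adjoint.
Qed.

(** A Cauchy filter of operators converges pointwise, and so do the adjoints; the two limits are
    adjoint to each other. The auxiliary facts are stated for a map [g] because they are used twice,
    for the operators themselves and for [bop_adj], which satisfy the same Lipschitz estimate. *)
Lemma bop_complete (F : set_system bop) : ProperFilter F -> cauchy F -> cvg F.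
Proof.
move=> FF /cauchyP cF.
have {}cF (e : R) : 0 < e -> exists S : bop, F [set Q | opnorm (S - Q) < e].
  move=> e0; have [|x xF] := cF e%:C; first by rewrite ltcR.
  exists x; apply: filterS xF => a.
  by rewrite -ball_normE /ball_/= bop_normE ltcR.
have cvgF (g : bop -> H -> H) x : (forall S Q, hlen (g S x - g Q x) <= opnorm (S - Q) * hlen x) ->
    cvg ((fun S : bop => g S x) @ F).
  move=> hg; apply: cauchy_cvg; apply/cauchyP => e e0.
  have /complex_realP[eR eE] : e \is Num.real by exact: gtr0_real.
  have eR0 : 0 < eR by rewrite -ltcR -eE.
  have x1 : 0 < hlen x + 1 by have := hlen_ge0 x; lra.
  have [S SF] := cF _ (divr_gt0 eR0 x1); exists (g S x).
  change (F [set Q | ball (g S x) e (g Q x)]).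
  apply: filterS SF => Q; rewrite /mkset -ball_normE /ball_/= => h.
  rewrite hlenE eE ltcR (le_lt_trans (hg S Q))//.
  have h0 := bop_norm_ge0 (S - Q).
  apply: le_lt_trans (_ : opnorm (S - Q) * (hlen x + 1) < _).
    by rewrite ler_wpM2l// lerDl.
  by rewrite -ltr_pdivlMr.
have gS S Q x : hlen (S x - Q x) <= opnorm (S - Q) * hlen x.
  exact: (bop_norm_le (S - Q) x).
have gA S Q x : hlen (bop_adj S x - bop_adj Q x) <= opnorm (S - Q) * hlen x.
  have [_ h] := op_bound_adjoint (bop_adj_adjoint (S - Q)) (opnorm_bound (bop_bounded (S - Q))).
  by have := h x; rewrite bop_adjB.
pose L x : H := lim ((fun S : bop => S x) @ F).
pose L' x : H := lim ((fun S : bop => bop_adj S x) @ F).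
have near (g : bop -> H -> H) x : (forall S Q y, hlen (g S y - g Q y) <= opnorm (S - Q) * hlen y) ->
    forall e : R, 0 < e ->
    F [set S : bop | hlen (lim ((fun S : bop => g S x) @ F) - g S x) <= e].
  move=> hg e e0; have /cvgrPdist_le h := cvgF g x (fun S Q => hg S Q x).
  have := h e%:C; rewrite ltcR => /(_ e0); apply: filterS => S.
  by rewrite /mkset hlenE lecR.
have unif (g : bop -> H -> H) :
    (forall S Q y, hlen (g S y - g Q y) <= opnorm (S - Q) * hlen y) ->
    forall e : R, 0 < e ->
    F [set S : bop | forall x, hlen (lim ((fun S : bop => g S x) @ F) - g S x) <= e * hlen x].
  move=> hg e e0; have e2 : 0 < e / 2 by rewrite divr_gt0.
  have [S SF] := cF _ e2; apply: filterS (SF) => Q /= SQ x.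
  apply/ler_addgt0Pr => d d0.
  (* [P] may depend on [x] and [d]: it only mediates between the limit and [Q], and leaves no trace
     in the final bound. *)
  have [P [SP Pd]] := filter_ex (filterI SF (near g x hg d d0)).
  rewrite /mkset in Pd SP.
  have h1 := hg P S x; have h2 := hg S Q x.
  have h3 := hlenD (lim ((fun S : bop => g S x) @ F) - g P x) (g P x - g Q x).
  have h4 := hlenD (g P x - g S x) (g S x - g Q x).
  rewrite !addrA !subrK in h3 h4.
  have SP' : opnorm (P - S) < e / 2.
    by have := normrN (P - S); rewrite opprB !bop_normE => /complexI <-.
  have h5 : opnorm (P - S) * hlen x <= e / 2 * hlen x by rewrite ler_wpM2r ?hlen_ge0// ltW.
  have h6 : opnorm (S - Q) * hlen x <= e / 2 * hlen x by rewrite ler_wpM2r ?hlen_ge0// ltW.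
  lra.
have bounded_lim (g : bop -> H -> H) (l : H -> H) : (forall S, bounded_op (g S)) ->
    (forall e : R, 0 < e -> F [set S : bop | forall x, hlen (l x - g S x) <= e * hlen x]) ->
    bounded_op l.
  move=> bg hl; apply/bounded_opP; split.
    move=> k x y; apply/eqP; rewrite -subr_eq0; apply/eqP; apply: hlen_small => e e0.
    (* The three errors are weighted by these lengths, so a relative error [e / C] adds up to at
       most [e]; the [1] keeps [C] positive. *)
    pose C := hlen (k *: x + y) + nc k * hlen x + hlen y + 1.
    have C1 : 0 < C.
      have := mulr_ge0 (nc_ge0 k) (hlen_ge0 x); have := hlen_ge0 (k *: x + y).
      have := hlen_ge0 y; rewrite /C; lra.
    have [S hS] := filter_ex (hl _ (divr_gt0 e0 C1)); rewrite /mkset in hS.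
    have [lS _] := bg S.
    have -> : l (k *: x + y) - (k *: l x + l y) =
        (l (k *: x + y) - g S (k *: x + y)) - (k *: (l x - g S x) + (l y - g S y)).
      have cancel_sub (a b c : H) : a - b - (c - b) = a - c by rewrite opprB addrA subrK.
      rewrite lS -[LHS](cancel_sub _ (k *: g S x + g S y)); congr (_ - _).
      by rewrite scalerBr opprD addrACA.
    have h1 := hlenD (l (k *: x + y) - g S (k *: x + y)) (- (k *: (l x - g S x) + (l y - g S y))).
    rewrite hlenN in h1.
    have h2 := hlenD (k *: (l x - g S x)) (l y - g S y); rewrite hlenZ in h2.
    have h3 := hS (k *: x + y); have h4 := hS x; have h5 := hS y.
    have h6 : nc k * hlen (l x - g S x) <= nc k * (e / C * hlen x) by rewrite ler_wpM2l ?nc_ge0.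
    have h7 : e / C * C = e by rewrite divfK ?gt_eqF.
    have h8 : 0 < e / C by rewrite divr_gt0.
    rewrite {2}/C !mulrDr mulrA [e / C * nc k]mulrC -mulrA in h7; lra.
  have [S hS] := filter_ex (hl 1 ltr01); rewrite /mkset in hS.
  have [M0 hM] := opnorm_bound (bg S).
  exists (opnorm (g S) + 1); split; first by rewrite addr_ge0.
  move=> x; have h1 := hlenD (l x - g S x) (g S x); rewrite subrK in h1.
  by have := hS x; have := hM x; lra.
have bL : bounded_op L := bounded_lim _ _ bop_bounded (unif (fun S => S) gS).
have bL' : bounded_op L' := bounded_lim _ _ bop_adj_bounded (unif bop_adj gA).
have aL : adjoint_ops L L'.
  move=> x y; apply/eqP; rewrite -subr_eq0; apply/eqP; apply: nc_eq0; apply/eqP.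
  rewrite eq_le nc_ge0 andbT; apply/ler_addgt0Pr => e e0; rewrite add0r.
  pose C := 2 * (hlen x * hlen y) + 1.
  have xy := mulr_ge0 (hlen_ge0 x) (hlen_ge0 y).
  have C1 : 0 < C by rewrite /C; lra.
  have eC := divr_gt0 e0 C1.
  have [S [h1 h2]] := filter_ex (filterI (unif (fun S => S) gS _ eC) (unif bop_adj gA _ eC)).
  have {}h1 := h1 x; have {}h2 := h2 y; rewrite -/(L x) -/(L' y) in h1 h2.
  have -> : dot (L x) y - dot x (L' y) = dot (L x - S x) y - dot x (L' y - bop_adj S y).
    by rewrite dotBl dotBr bop_adj_adjoint opprB addrA subrK.
  have h3 := ncD (dot (L x - S x) y) (- dot x (L' y - bop_adj S y)); rewrite ncN in h3.
  have h4 := cauchy_schwarz (L x - S x) y.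
  have h5 := cauchy_schwarz x (L' y - bop_adj S y).
  have h6 := ler_wpM2r (hlen_ge0 y) h1; have h7 := ler_wpM2l (hlen_ge0 x) h2.
  have h8 : e / C * C = e by rewrite divfK ?gt_eqF.
  rewrite {2}/C in h8.
  rewrite -mulrA in h6; rewrite mulrCA in h7; lra.
apply/cvg_ex; exists (mk_bop bL bL' aL); apply/cvgrPdist_le => e e0.
have /complex_realP[eR eE] : e \is Num.real by exact: gtr0_real.
have eR0 : 0 < eR by rewrite -ltcR -eE.
rewrite eE; apply: filterS (unif (fun S => S) gS _ eR0) => S hS.
rewrite bop_normE lecR; apply: opnorm_le; split; first exact: ltW.
exact: hS.
Qed.

HB.instance Definition _ := Uniform_isComplete.Build bop bop_complete.

Definition bop_mul S Q : bop :=
  mk_bop (bounded_op_comp (bop_bounded S) (bop_bounded Q))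
    (bounded_op_comp (bop_adj_bounded Q) (bop_adj_bounded S))
    (adjoint_ops_comp (bop_adj_adjoint S) (bop_adj_adjoint Q)).

Definition bop_star S : bop :=
  mk_bop (bop_adj_bounded S) (bop_bounded S) (adjoint_opsC (bop_adj_adjoint S)).

Lemma bop_star_adjoint S : adjoint_ops S (bop_star S).
Proof. exact: bop_adj_adjoint. Qed.

Lemma bop_starP S Q : adjoint_ops S Q -> bop_star S = Q.
Proof. by move=> h; apply: val_inj; exact: adjoint_ops_unique (bop_adj_adjoint S) h. Qed.

Let mulA : associative bop_mul.
Proof. by move=> a b c; apply: bop_eq. Qed.

Let mulDl : left_distributive bop_mul +%R.
Proof. by move=> a b c; apply: bop_eq. Qed.

Let mulDr : right_distributive bop_mul +%R.
Proof. by move=> a b c; apply: bop_eq => x; exact: linear_for_D (bop_linear a) _ _. Qed.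

Let mulZl k a b : bop_mul (k *: a) b = k *: bop_mul a b.
Proof. exact: bop_eq. Qed.

Let mulZr k a b : bop_mul a (k *: b) = k *: bop_mul a b.
Proof. by apply: bop_eq => x; exact: linear_for_Z (bop_linear a) _ _. Qed.

Let normM a b : `|bop_mul a b| <= `|a| * `|b|.
Proof.
rewrite !bop_normE -rmorphM lecR; apply: opnorm_le; split.
  by rewrite mulr_ge0 ?bop_norm_ge0.
move=> x; apply: le_trans (bop_norm_le a (b x)) _.
by rewrite -mulrA ler_wpM2l ?bop_norm_ge0 ?bop_norm_le.
Qed.

Let starK : involutive bop_star.
Proof. by move=> a; apply: bop_starP; exact: adjoint_opsC (bop_adj_adjoint a). Qed.

Let starD : {morph bop_star : a b / a + b}.
Proof.
move=> a b; apply: bop_starP => x y.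
rewrite -[(a + b) x]/(a x + b x) -[(_ + bop_star b) y]/(bop_star a y + bop_star b y).
by rewrite dotDl dotDr !bop_adj_adjoint.
Qed.

Let starZ k a : bop_star (k *: a) = conjc k *: bop_star a.
Proof.
apply: bop_starP => x y; rewrite -[(k *: a) x]/(k *: a x).
by rewrite -[(_ *: bop_star a) y]/(conjc k *: bop_star a y) dotZl dotZr bop_adj_adjoint.
Qed.

Let starM a b : bop_star (bop_mul a b) = bop_mul (bop_star b) (bop_star a).
Proof. by apply: bop_starP; exact: adjoint_ops_comp (bop_adj_adjoint a) (bop_adj_adjoint b). Qed.

Let norm_star a : `|bop_mul (bop_star a) a| = `|a| ^+ 2.
Proof.
have na : opnorm (bop_star a) = opnorm a.
  exact: opnorm_adjoint (bop_bounded a) (bop_adj_bounded a) (bop_adj_adjoint a).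
have a0 := bop_norm_ge0 a.
apply/eqP; rewrite eq_le; apply/andP; split.
  by have := normM (bop_star a) a; rewrite !bop_normE na expr2.
rewrite !bop_normE -rmorphXn lecR; set m := opnorm (bop_mul _ _).
have m0 : 0 <= m by exact: bop_norm_ge0.
rewrite -[leRHS]sqr_sqrtr// ler_sqr ?nnegrE ?sqrtr_ge0//.
apply: opnorm_le; split; first exact: sqrtr_ge0.
move=> x; rewrite -ler_sqr ?nnegrE ?hlen_ge0 ?mulr_ge0 ?sqrtr_ge0 ?hlen_ge0//.
rewrite exprMn sqr_sqrtr// hlen_sq -lecR -dot_hsq bop_adj_adjoint.
have -> : dot x (bop_adj a (a x)) = (nc (dot x (bop_adj a (a x))))%:C.
  have d0 : 0 <= dot x (bop_adj a (a x)) by rewrite -bop_adj_adjoint dot_ge0.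
  by rewrite -{1}(ger0_norm d0) ncE.
rewrite lecR (le_trans (cauchy_schwarz _ _))// expr2 mulrCA ler_wpM2l ?hlen_ge0//.
exact: bop_norm_le (bop_mul (bop_star a) a) x.
Qed.

HB.instance Definition _ := isCStarAlgebra.Build R bop
  mulA mulDl mulDr mulZl mulZr normM starK starD starZ starM norm_star.

End operator_algebra.

(** * Unordered sums of vectors *)

Section hilbert_sums.
Variables (R : realType) (H : hilbertType R) (I : choiceType).
Implicit Types (x y : I -> H) (l m : H) (A B : {fset I}).
Local Notation nc := (@ComplexField.Normc.normc R).

Definition has_hsum x l := forall e : R, 0 < e -> exists A, forall B,
  (A `<=` B)%fset -> hlen (\sum_(i <- B) x i - l) <= e.

Lemma has_hsumP x l :
  has_hsum x l <-> partial_sum x @ totally --> l.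
Proof.
have FF := @totally_filter I; split=> h.
  apply/cvgrPdistC_le => e e0.
  have /complex_realP[eR eE] : e \is Num.real by exact: gtr0_real.
  have /h[A hA] : 0 < eR by rewrite -ltcR -eE.
  exists A => // B /= AB.
  by rewrite /partial_sum -(big_seq_fsetE _ B xpredT x) hlenE eE lecR hA.
move=> e e0; have /cvgrPdistC_le /(_ e%:C) := h; rewrite ltcR => /(_ e0)[A _ hA].
exists A => B AB; have := hA B AB.
by rewrite /partial_sum -(big_seq_fsetE _ B xpredT x) hlenE lecR.
Qed.

Lemma has_hsumE x l : has_hsum x l -> summability.sum x = l.
Proof.
have FF := @totally_filter I; move=> /has_hsumP h.
exact: (cvg_lim (@norm_hausdorff _ H) h).
Qed.

Lemma has_hsum_unique x l m : has_hsum x l -> has_hsum x m -> l = m.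
Proof. by move=> /has_hsumE <- /has_hsumE <-. Qed.

Lemma has_hsum_op (S : H -> H) x l : bounded_op S -> has_hsum x l ->
  has_hsum (S \o x) (S l).
Proof.
move=> /bounded_opP[lS [M [M0 hM]]] hx e e0; have M1 : 0 < M + 1 by lra.
have [A hA] := hx _ (divr_gt0 e0 M1); exists A => B /hA.
rewrite ler_pdivlMr// -(linear_for_sum lS) -(linear_for_B lS) => h.
have := hM (\sum_(i <- B) x i - l).
have := hlen_ge0 (\sum_(i <- B) x i - l); lra.
Qed.

Lemma has_hsum_dot (k : H) x l : has_hsum x l ->
  has_csum (fun i => dot k (x i)) (dot k l).
Proof.
move=> hx e e0; have M1 : 0 < hlen k + 1 by have := hlen_ge0 k; lra.
have [A hA] := hx _ (divr_gt0 e0 M1); exists A => B /hA.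
rewrite ler_pdivlMr// -dot_sumr -dotBr => h.
have := cauchy_schwarz k (\sum_(i <- B) x i - l).
have := hlen_ge0 (\sum_(i <- B) x i - l); lra.
Qed.

Lemma has_hsum_dotl (k : H) x l : has_hsum x l ->
  has_csum (fun i => dot (x i) k) (dot l k).
Proof.
move=> /(has_hsum_dot k) /has_csumJ; rewrite -dotC; congr has_csum.
by apply/funext => i; rewrite -dotC.
Qed.

Lemma has_hsum1 x j : (forall i, i != j -> x i = 0) -> has_hsum x (x j).
Proof.
move=> h e e0; exists [fset j]%fset => B; rewrite fsub1set => jB.
rewrite (big_fsetD1 j)//= big_seq big1 ?addr0 ?subrr ?hlen0 ?ltW// => i.
by rewrite !inE => /andP[/h].
Qed.

Lemma has_hsum_lin (k : R[i]) x y l m : has_hsum x l -> has_hsum y m ->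
  has_hsum (fun i => k *: x i + y i) (k *: l + m).
Proof.
move=> hx hy e e0; have k1 : 0 < nc k + 1 by have := nc_ge0 k; lra.
have e2 : 0 < e / 2 by lra.
have [A hA] := hx _ (divr_gt0 e2 k1); have [B hB] := hy _ e2.
exists (A `|` B)%fset => D; rewrite fsubUset => /andP[/hA h1 /hB h2].
rewrite big_split/= -scaler_sumr opprD addrACA -scalerBr.
apply: le_trans (hlenD _ _) _; rewrite hlenZ.
move: h1; rewrite ler_pdivlMr// => h1.
have := hlen_ge0 (\sum_(i <- D) x i - l); lra.
Qed.

Lemma hsq_sum x B : (forall i j, i != j -> dot (x i) (x j) = 0) ->
  hsq (\sum_(i <- B) x i) = \sum_(i <- B) hsq (x i).
Proof.
move=> orth; apply: complexI; rewrite -dot_hsq dot_suml rmorph_sum.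
rewrite big_seq [RHS]big_seq; apply: eq_bigr => i iB.
rewrite dot_sumr (big_fsetD1 i)//= dot_hsq big_seq big1 ?addr0// => j.
by rewrite !inE eq_sym => /andP[/orth].
Qed.

Lemma has_hsum_le x l (M : R) : 0 <= M -> has_hsum x l ->
  (forall B, hlen (\sum_(i <- B) x i) <= M) -> hlen l <= M.
Proof.
move=> M0 hx hM; apply/ler_addgt0Pr => e e0.
have [A /(_ A (fsubset_refl _)) h] := hx _ e0.
have := hlenD (l - \sum_(i <- A) x i) (\sum_(i <- A) x i).
rewrite subrK hlenB; have := hM A; lra.
Qed.

(* The partial sums of an orthogonal square-summable family are Cauchy by
   Pythagoras. *)
Lemma orthogonal_has_hsum x (M : R) :
  (forall i j, i != j -> dot (x i) (x j) = 0) ->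
  (forall B, \sum_(i <- B) hsq (x i) <= M) ->
  has_hsum x (summability.sum x) /\ hsq (summability.sum x) <= M.
Proof.
move=> orth hM; have FF := @totally_filter I.
have [s hs] := nneg_summable (fun i => hsq_ge0 (x i)) hM.
have cx : cvg (partial_sum x @ totally).
  apply: cauchy_cvg; apply/cauchyP => e e0.
  have /complex_realP[eR eE] : e \is Num.real by exact: gtr0_real.
  have eR0 : 0 < eR by rewrite -ltcR -eE.
  (* The partial sums of squares over [A] and over [B] are both this close to the limit [s], so the
     terms in [B] but not in [A] contribute at most [eR ^+ 2 / 2]. *)
  have [|A hA] := hs (eR ^+ 2 / 4); first by rewrite divr_gt0// exprn_gt0.
  exists (\sum_(i <- A) x i); exists A => // B /= AB.
  rewrite -ball_normE /ball_/= hlenE eE ltcR /partial_sum.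
  rewrite -(big_seq_fsetE _ B xpredT x)/= hlenB.
  rewrite -ltr_sqr ?nnegrE ?hlen_ge0 ?(ltW eR0)// hlen_sq.
  have split_sum (V : zmodType) (f : I -> V) :
      \sum_(i <- B) f i = \sum_(i <- A) f i + \sum_(i <- (B `\` A)%fset) f i.
    rewrite (big_fsetID _ (mem A))/=; congr (_ + _).
      apply: eq_fbigl => i; rewrite !inE/=.
      by case: (boolP (i \in A)) => iA; rewrite ?andbF// andbT (fsubsetP AB).
    by apply: eq_fbigl => i; rewrite !inE/= andbC.
  have diff_sum (V : zmodType) (f : I -> V) :
      \sum_(i <- B) f i - \sum_(i <- A) f i = \sum_(i <- (B `\` A)%fset) f i.
    by rewrite split_sum addrAC subrr add0r.
  rewrite diff_sum hsq_sum//.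
  have h1 := hA A (fsubset_refl _); have h2 := hA B AB.
  have := ncD (\sum_(i <- B) (hsq (x i))%:C - s) (s - \sum_(i <- A) (hsq (x i))%:C).
  rewrite addrA subrK diff_sum [nc (s - _)]ncB -rmorph_sum.
  have := exprn_gt0 2 eR0.
  have := ler_Re_nc (\sum_(i <- (B `\` A)%fset) hsq (x i))%:C.
  rewrite ler_norml => /andP[_] /=; lra.
have hx : has_hsum x (summability.sum x) by apply/has_hsumP.
split=> //; have M0 : 0 <= M by have := hM fset0; rewrite big_seq_fset0.
rewrite -hlen_sq -[leRHS]sqr_sqrtr// ler_sqr ?nnegrE ?hlen_ge0 ?sqrtr_ge0//.
apply: has_hsum_le hx _ => [|B]; first exact: sqrtr_ge0.
by rewrite -ler_sqr ?nnegrE ?hlen_ge0 ?sqrtr_ge0// hlen_sq sqr_sqrtr// hsq_sum.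
Qed.

End hilbert_sums.

(** * Partial isometries with orthogonal ranges *)

Section adjoints.
Variables (R : realType) (H : hilbertType R).

Lemma adjoint_linear (S Q : H -> H) : adjoint_ops S Q -> linear S.
Proof.
move=> h k x y; apply: dot_injr => z.
by rewrite h dotDl dotZl dotDl dotZl !h.
Qed.

End adjoints.

(* Each S i (S' i) is a projection, and these have orthogonal ranges. *)
Section orthogonal_partial_isometries.
Variables (R : realType) (H : hilbertType R) (I : choiceType).
Variables (S S' : I -> H -> H).
Hypothesis adjS : forall i, adjoint_ops (S i) (S' i).
Hypothesis orthS : forall i j h, i != j -> S' i (S j h) = 0.
Hypothesis pisoS : forall i h, S i (S' i (S i h)) = S i h.
Implicit Types (w : H -> H) (h k : H) (B : {fset I}).

Let linS i : linear (S i) := adjoint_linear (adjS i).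
Let linS' i : linear (S' i) := adjoint_linear (adjoint_opsC (adjS i)).

(** [S' (S h)] and [S h] have the same length because [S S' S = S]; hence [hsq (S h) = dot h (S' (S
    h)) <= hlen h * hlen (S h)]. *)
Lemma piso_bound i : op_bound (S i) 1.
Proof.
split=> // h; rewrite mul1r -ler_sqr ?nnegrE ?hlen_ge0// !hlen_sq.
have SS : hsq (S' i (S i h)) = hsq (S i h).
  by apply: complexI; rewrite -!dot_hsq -adjS pisoS.
have d0 : 0 <= dot h (S' i (S i h)) by rewrite -adjS dot_ge0.
have h1 : hsq (S i h) <= hlen h * hlen (S' i (S i h)).
  rewrite -lecR -dot_hsq adjS -(ger0_norm d0) ncE lecR; exact: cauchy_schwarz.
have h2 : hlen (S' i (S i h)) = hlen (S i h).
  by apply/eqP; rewrite -(@eqrXn2 _ 2) ?hlen_ge0// !hlen_sq SS.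
rewrite h2 -hlen_sq in h1; rewrite -!hlen_sq ler_sqr ?nnegrE ?hlen_ge0//.
have := hlen_ge0 (S i h); rewrite le_eqVlt => /orP[/eqP <-|q0].
  exact: hlen_ge0.
by move: h1; rewrite expr2 ler_pM2r.
Qed.

Lemma piso_bounded i : bounded_op (S i).
Proof. by apply/bounded_opP; split; [exact: linS|exists 1; exact: piso_bound]. Qed.

Lemma piso_adj_bounded i : bounded_op (S' i).
Proof.
apply/bounded_opP; split; first exact: linS'.
by exists 1; exact: op_bound_adjoint (adjS i) (piso_bound i).
Qed.

Lemma piso_orth w k i j : i != j -> dot (S i (w (S' i k))) (S j (w (S' j k))) = 0.
Proof. by move=> ij; rewrite adjS orthS// dot0r. Qed.

(** Pythagoras for the projections [S i \o S' i]. The equality, and not just the inequality of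
    Bessel, is what later identifies the limits of expansions. *)
Lemma piso_bessel_eq k B :
  hsq (k - \sum_(i <- B) S i (S' i k)) = hsq k - \sum_(i <- B) hsq (S' i k).
Proof.
have SS i : hsq (S i (S' i k)) = hsq (S' i k).
  by apply: complexI; rewrite -!dot_hsq -(adjoint_opsC (adjS i)) -!adjS pisoS.
rewrite /hsq (ipsqD (@dotDr R H) (@dotC R H)) -!/(hsq _).
rewrite -[- _ as X in hsq X]scaleN1r hsqZ dotNr dot_sumr.
rewrite (@hsq_sum _ _ _ (fun i => S i (S' i k))); last exact: (piso_orth idfun).
rewrite (eq_bigr _ (fun i _ => SS i)).
have -> : \sum_(i <- B) dot k (S i (S' i k)) = (\sum_(i <- B) hsq (S' i k))%:C.
  by rewrite rmorph_sum; apply: eq_bigr => i _; rewrite -(adjoint_opsC (adjS i)) dot_hsq.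
rewrite ncN nc_sq /=; ring.
Qed.

Lemma piso_bessel k B : \sum_(i <- B) hsq (S' i k) <= hsq k.
Proof. by rewrite -subr_ge0 -piso_bessel_eq hsq_ge0. Qed.

(** The endomorphism [Ad] for an abstract family: the edge operators give [Ad] itself, a family of
    projections with [w = idfun] gives the sum of these projections. *)
Definition piso_sum w k : H := summability.sum (fun i => S i (w (S' i k))).

Let piso_sum_key w (M : R) k : op_bound w M ->
  has_hsum (fun i => S i (w (S' i k))) (piso_sum w k) /\
  hsq (piso_sum w k) <= M ^+ 2 * hsq k.
Proof.
move=> [M0 hM]; apply: orthogonal_has_hsum; first exact: piso_orth.
move=> B; apply: le_trans (_ : \sum_(i <- B) M ^+ 2 * hsq (S' i k) <= _).
  apply: ler_sum => i _; rewrite -!hlen_sq -exprMn.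
  rewrite ler_sqr ?nnegrE ?mulr_ge0 ?hlen_ge0//.
  by have [_ /(_ (w (S' i k)))] := piso_bound i; rewrite mul1r => /le_trans; apply.
by rewrite -mulr_sumr ler_wpM2l ?sqr_ge0 ?piso_bessel.
Qed.

Lemma piso_has_hsum w k : bounded_op w ->
  has_hsum (fun i => S i (w (S' i k))) (piso_sum w k).
Proof. by move=> /bounded_opP[_ [M hM]]; have [] := piso_sum_key k hM. Qed.

Lemma piso_sum_bounded w : bounded_op w -> bounded_op (piso_sum w).
Proof.
move=> bw; have /bounded_opP[lw [M hM]] := bw; apply: (@mk_bounded_op _ _ _ M).
- move=> c x y; apply: has_hsum_unique (piso_has_hsum (c *: x + y) bw) _.
  rewrite (_ : (fun i => _) = fun i => c *: S i (w (S' i x)) + S i (w (S' i y))).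
    exact: has_hsum_lin (piso_has_hsum x bw) (piso_has_hsum y bw).
  by apply/funext => i; rewrite linS' lw linS.
- by case: hM.
- move=> k; have [_] := piso_sum_key k hM; case: hM => M0 _.
  by rewrite -!hlen_sq -exprMn ler_sqr ?nnegrE ?mulr_ge0 ?hlen_ge0.
Qed.

Lemma piso_adj_sum w k j : bounded_op w ->
  S' j (piso_sum w k) = S' j (S j (w (S' j k))).
Proof.
move=> bw; apply: has_hsum_unique (has_hsum_op (piso_adj_bounded j) (piso_has_hsum k bw)) _.
apply: (@has_hsum1 _ _ _ (S' j \o (fun i => S i (w (S' i k)))) j) => i ij /=.
by rewrite orthS// eq_sym.
Qed.

End orthogonal_partial_isometries.

(** * The Hilbert space of square-summable families *)

Section square_summable.
Variables (R : realType) (I : countType).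
Local Notation nc := (@ComplexField.Normc.normc R).

(* For the graph with one vertex, X(E) is the Hilbert space l^2(E^1). *)
Definition rose : graph := @Graph unit I (fun=> tt) (fun=> tt).

Definition ell2 := xgraph R rose.
HB.instance Definition _ := GRing.Lmodule.on ell2.

Implicit Types (x y z : ell2) (i j : I) (k : R[i]) (A : {fset I}).

Definition ell2_dot x y : R[i] := xip (x : xgraph R rose) (y : xgraph R rose) tt.

Lemma ell2_dotDr x y z : ell2_dot x (y + z) = ell2_dot x y + ell2_dot x z.
Proof. exact: (congr1 (fun a : c0 R unit => a tt) (@hipDr R _ (xgraph R rose) x y z)). Qed.

Lemma ell2_dotZr k x y : ell2_dot x (k *: y) = k * ell2_dot x y.
Proof. exact: (congr1 (fun a : c0 R unit => a tt) (@hipZr R _ (xgraph R rose) k x y)). Qed.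

Lemma ell2_dotC x y : ell2_dot y x = conjc (ell2_dot x y).
Proof. exact: (congr1 (fun a : c0 R unit => a tt) (@hipC R _ (xgraph R rose) x y)). Qed.

Lemma ell2_dot_self x : ell2_dot x x = (hat (x : xgraph R rose) tt)%:C.
Proof. exact: xip_self. Qed.

Lemma ell2_dot_ge0 x : 0 <= ell2_dot x x.
Proof. by rewrite ell2_dot_self ler0c hat_ge0. Qed.

Lemma ell2_sqE x : ipsq ell2_dot x = hat (x : xgraph R rose) tt.
Proof. by rewrite /ipsq ell2_dot_self. Qed.

Lemma ell2_eq0 x : ell2_dot x x = 0 -> x = 0.
Proof.
move=> h; apply: (@hip_eq0 R _ (xgraph R rose)); apply: c0_eq => -[]; exact: h.
Qed.

Local Notation norm x := (ipnorm ell2_dot x)%:C.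

Let ler_normD x y : norm (x + y) <= norm x + norm y.
Proof.
rewrite -rmorphD lecR.
exact: ipnormD ell2_dotDr ell2_dotZr ell2_dotC ell2_dot_ge0 x y.
Qed.

Let normrZ k x : norm (k *: x) = `|k| * norm x.
Proof.
by rewrite ncE (ipnormZ ell2_dotZr ell2_dotC ell2_dot_ge0) rmorphM.
Qed.

Let normr0_eq0 x : norm x = 0 -> x = 0.
Proof.
move=> /complexI h; apply: ell2_eq0.
by rewrite (ipsqE ell2_dot_ge0) -(ipnorm_sq ell2_dot_ge0) h expr0n.
Qed.

HB.instance Definition _ :=
  Lmodule_isNormed.Build R[i] ell2 ler_normD normrZ normr0_eq0.

Lemma ell2_normE x : `|x| = (ipnorm ell2_dot x)%:C.
Proof. by []. Qed.

Lemma ell2_hip_norm x (e : R) : 0 < e ->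
  (`|hip (x : xgraph R rose) x| < (e ^+ 2)%:C) = (ipnorm ell2_dot x < e).
Proof.
move=> e0; rewrite c0_normE ltcR.
have -> : c0_norm (hip (x : xgraph R rose) x) = ipnorm ell2_dot x ^+ 2.
  rewrite (ipnorm_sq ell2_dot_ge0) ell2_sqE.
  have h : nc ((hip (x : xgraph R rose) x : c0 R unit) tt) = hat (x : xgraph R rose) tt.
    rewrite -[(hip _ _ : c0 R unit) tt]/(ell2_dot x x) ell2_dot_self /= expr0n addr0.
    by rewrite sqrtr_sqr ger0_norm ?hat_ge0.
  apply/eqP; rewrite eq_le; apply/andP; split.
    by apply: c0_norm_le => [|[]]; rewrite ?hat_ge0// h.
  by rewrite -h c0_norm_ub.
by rewrite ltr_sqr ?nnegrE ?ipnorm_ge0// ltW.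
Qed.

(** Completeness is inherited from the Hilbert module, where it is stated for sequences. A Cauchy
    filter contains balls of radius [1 / (n + 1)] with centres [u n]; any two of them meet, so [u]
    is Cauchy, and its limit is the limit of the filter. *)
Lemma ell2_complete (F : set_system ell2) : ProperFilter F -> cauchy F -> cvg F.
Proof.
move=> FF /cauchyP cF.
pose N := ipnorm ell2_dot.
have ND x y : N (x + y) <= N x + N y.
  exact: ipnormD ell2_dotDr ell2_dotZr ell2_dotC ell2_dot_ge0 x y.
have NB x y : N (x - y) = N (y - x).
  by have := normrN (x - y); rewrite opprB !ell2_normE => /complexI.
have /choice[u hu] (n : nat) : exists x : ell2, F [set y | N (x - y) < n.+1%:R^-1].
  have [|x xF] := cF n.+1%:R^-1%:C; first by rewrite ltcR invr_gt0.
  exists x; apply: filterS xF => a.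
  by rewrite -ball_normE /ball_/= ell2_normE ltcR.
have small (e : R) : 0 < e -> exists n : nat, forall m, (n <= m)%N -> m.+1%:R^-1 < e.
  move=> e0; have [n nP] := ltr_add_invr (y := 0) (x := 0 + e) ltac:(by rewrite add0r).
  exists n => m nm; rewrite !add0r in nP; apply: le_lt_trans nP.
  by rewrite lef_pV2 ?posrE// ler_nat.
have [|l hl] := @hip_complete R _ (xgraph R rose) u.
  move=> e e0; have se : 0 < Num.sqrt e by rewrite sqrtr_gt0.
  have [n hn] := small _ (divr_gt0 se (ltr0Sn R 1)); exists n => p q np nq.
  rewrite -(sqr_sqrtr (ltW e0)) (ell2_hip_norm (u p - u q))//.
  have [y [h1 h2]] := filter_ex (filterI (hu p) (hu q)).
  have h3 := ND (u p - y) (y - u q); rewrite addrA subrK in h3.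
  apply: le_lt_trans h3 _; rewrite [ltRHS]splitr ltrD//.
    exact: lt_trans h1 (hn _ np).
  by rewrite NB; exact: lt_trans h2 (hn _ nq).
apply/cvg_ex; exists (l : ell2); apply/cvgrPdist_lt => e e0.
have /complex_realP[eR eE] : e \is Num.real by exact: gtr0_real.
have eR0 : 0 < eR by rewrite -ltcR -eE.
have e2 : 0 < eR / 2 by rewrite divr_gt0.
have [n1 h1] := small _ e2; have [n2 h2] := hl _ (exprn_gt0 2 e2).
pose n := maxn n1 n2; apply: filterS (hu n) => y; rewrite /mkset => hy.
have h3 := ND (l - u n) (u n - y); rewrite addrA subrK in h3.
rewrite ell2_normE eE ltcR; apply: le_lt_trans h3 _; rewrite [ltRHS]splitr ltrD//.
  by rewrite NB -(ell2_hip_norm (u n - l))//; exact: h2 (leq_maxr _ _).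
exact: lt_trans hy (h1 n (leq_maxl _ _)).
Qed.

HB.instance Definition _ := Uniform_isComplete.Build ell2 ell2_complete.

Let dot_norm x : `|x| ^+ 2 = ell2_dot x x.
Proof.
by rewrite ell2_normE -rmorphXn/= (ipnorm_sq ell2_dot_ge0) -(ipsqE ell2_dot_ge0).
Qed.

HB.instance Definition _ :=
  isHilbertSpace.Build R ell2 ell2_dotDr ell2_dotZr ell2_dotC dot_norm.

Lemma ell2_hsqE x : hsq x = hat (x : xgraph R rose) tt.
Proof. exact: ell2_sqE. Qed.

Lemma ell2_dotP x y : has_csum (fun i => conjc (x i) * y i) (dot x y).
Proof. by have := xip_has_csum (x : xgraph R rose) y tt. Qed.

Definition ell2_delta i : ell2 := delta_edge R (i : edge rose).

Lemma ell2_deltaE i j : ell2_delta i j = (j == i)%:R.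
Proof. by []. Qed.

Lemma has_csum1 (f : I -> R[i]) i : (forall j, j != i -> f j = 0) -> has_csum f (f i).
Proof.
move=> h e e0; exists [fset i]%fset => B; rewrite fsub1set => iB.
rewrite (big_fsetD1 i)//= big_seq big1 ?addr0 ?subrr ?nc0 ?ltW// => j.
by rewrite !inE => /andP[/h].
Qed.

Lemma dot_delta i x : dot (ell2_delta i) x = x i.
Proof.
apply: has_csum_unique (ell2_dotP (ell2_delta i) x) _.
have -> : x i = conjc (ell2_delta i i) * x i by rewrite ell2_deltaE eqxx conjc1 mul1r.
apply: (has_csum1 (f := fun j => conjc (ell2_delta i j) * x j)) => j /negPf ji.
by rewrite ell2_deltaE ji conjc0 mul0r.
Qed.

Lemma ell2_sum_eval (T : Type) (r : seq T) (F : T -> ell2) j :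
  (\sum_(t <- r) F t) j = \sum_(t <- r) F t j.
Proof. by rewrite -dot_delta dot_sumr; apply: eq_bigr => t _; exact: dot_delta. Qed.

(** The coordinate projections are partial isometries with orthogonal ranges, so the Bessel identity
    turns the squared error of a partial sum into a tail of the convergent series of the
    [nc (x i) ^+ 2]. *)
Lemma ell2_expand x : has_hsum (fun i => x i *: ell2_delta i) x.
Proof.
have hx : has_csum (fun i => (nc (x i) ^+ 2)%:C) (hsq x)%:C.
  rewrite -dot_hsq; have := ell2_dotP x x; congr has_csum; apply/funext => i.
  by rewrite nc_sq; case: (x i) => p q; apply/eqP; rewrite eq_complex/=; apply/andP; split; apply/eqP; ring.
move=> e e0; have [A hA] := hx _ (exprn_gt0 2 e0); exists A => B /hA h.
rewrite hlenB -ler_sqr ?nnegrE ?hlen_ge0 ?(ltW e0)// hlen_sq.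
pose S i (y : ell2) : ell2 := y i *: ell2_delta i.
have SE i (y : ell2) : (S i y : edge rose -> R[i]) i = y i.
  by rewrite -[LHS]/(y i * ell2_delta i i) ell2_deltaE eqxx mulr1.
have SS i y : S i (S i y) = S i y by rewrite {1}/S SE.
have adjS i : adjoint_ops (S i) (S i).
  by move=> y z; rewrite dotZl dotZr dot_delta mulrC [dot y _]dotC dot_delta.
have orthS i j y : i != j -> S i (S j y) = 0.
  move=> ij; rewrite {1}/S; have -> : (S j y : edge rose -> R[i]) i = 0.
    by rewrite -[LHS]/(y j * ell2_delta j i) ell2_deltaE (negPf ij) mulr0.
  by rewrite scale0r.
have pisoS i y : S i (S i (S i y)) = S i y by rewrite !SS.
have hsqS i : hsq (S i x) = nc (x i) ^+ 2.
  rewrite hsqZ -[RHS]mulr1; congr (_ * _); apply: complexI.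
  by rewrite -dot_hsq dot_delta ell2_deltaE eqxx.
have -> : \sum_(i <- B) x i *: ell2_delta i = \sum_(i <- B) S i (S i x).
  by apply: eq_bigr => i _; rewrite SS.
rewrite (piso_bessel_eq adjS orthS pisoS).
rewrite (eq_bigr (fun i => nc (x i) ^+ 2)); last by move=> i _; exact: hsqS.
apply: le_trans h.
have := ler_Re_nc (\sum_(i <- B) (nc (x i) ^+ 2)%:C - (hsq x)%:C).
rewrite -rmorph_sum -rmorphB ler_norml => /andP[+ _].
rewrite lerNl; apply: le_trans; rewrite -[leRHS]/(- (_ - _)) opprB.
exact: lexx.
Qed.

End square_summable.

Section ell2_operators.
Variables (R : realType) (I : countType).
Local Notation nc := (@ComplexField.Normc.normc R).
Local Notation K := (ell2 R I).
Implicit Types (x y : K) (i j : I) (A : {fset I}).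

Lemma ell2_mem (f : I -> R[i]) (C : R) :
  (forall A, \sum_(i <- A) nc (f i) ^+ 2 <= C) ->
  (f : edge (rose I) -> R[i]) \in @xgraph_pred R (rose I).
Proof.
move=> h; apply: (@xgraph_mem R (rose I) _ (fun=> C)) => [v A|].
  exact: le_trans (h A).
by move=> e e0; exact: (@finite_finset unit).
Qed.

Definition mk_ell2 (f : I -> R[i]) (C : R)
  (h : forall A, \sum_(i <- A) nc (f i) ^+ 2 <= C) : K := XGraph (ell2_mem h).

Lemma ell2_hsq_le x (C : R) :
  (forall A, \sum_(i <- A) nc (x i) ^+ 2 <= C) -> hsq x <= C.
Proof. by move=> h; rewrite ell2_hsqE; apply: hat_le => A; exact: h. Qed.

Lemma ell2_hsq_ge x A : \sum_(i <- A) nc (x i) ^+ 2 <= hsq x.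
Proof. by rewrite ell2_hsqE; exact: (fsq_hat (x : xgraph R (rose I)) tt A). Qed.

Lemma ell2_eq x y : (forall i, x i = y i) -> x = y.
Proof. exact: (@xgraph_eq R (rose I)). Qed.

Lemma ell2_linE (c : R[i]) x y i : (c *: x + y) i = c * x i + y i.
Proof. by []. Qed.

(** The coordinates of [S' y] have to be [dot (S (ell2_delta R i)) y]. A finite sum [s] of their
    squares equals [dot (S z) y], where [z] combines the point masses with these coefficients and
    [hsq z = s]. Hence [s <= M * hlen z * hlen y], which bounds [s] by [M ^+ 2 * hsq y]. *)
Lemma ell2_adjoint_ex (S : K -> K) : bounded_op S ->
  exists S' : K -> K, bounded_op S' /\ adjoint_ops S S'.
Proof.
move=> bS; have /bounded_opP[lS [M hS]] := bS; have [M0 hM] := hS.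
have bnd y A : \sum_(i <- A) nc (dot (S (ell2_delta R i)) y) ^+ 2 <= M ^+ 2 * hsq y.
  pose c i := dot (S (ell2_delta R i)) y; pose z : K := \sum_(i <- A) c i *: ell2_delta R i.
  set s := \sum_(i <- A) _.
  have sC : s%:C = \sum_(i <- A) conjc (c i) * c i.
    rewrite rmorph_sum; apply: eq_bigr => i _; rewrite nc_sq -/(c i).
    case: (c i) => p q; apply/eqP; rewrite eq_complex/=; apply/andP; split; apply/eqP; ring.
  have s0 : 0 <= s by apply: sumr_ge0 => i _; exact: sqr_ge0.
  have zz : hsq z = s.
    apply: complexI; rewrite -dot_hsq sC {1}/z dot_suml big_seq [RHS]big_seq.
    apply: eq_bigr => i iA; rewrite dotZl dot_delta; congr (_ * _).
    rewrite /z ell2_sum_eval (big_fsetD1 i)//= big_seq big1 => [|j].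
      by rewrite addr0 -[LHS]/(c i * ell2_delta R i i) ell2_deltaE eqxx mulr1.
    rewrite !inE => /andP[ji _].
    by rewrite -[LHS]/(c j * ell2_delta R j i) ell2_deltaE eq_sym (negPf ji) mulr0.
  have sz : dot (S z) y = s%:C.
    rewrite sC /z (linear_for_sum lS) dot_suml; apply: eq_bigr => i _.
    by rewrite (linear_for_Z lS) dotZl.
  have h1 : s <= M * hlen z * hlen y.
    rewrite -lecR -sz -[leLHS]ger0_norm ?sz ?ler0c// -sz ncE lecR.
    by rewrite (le_trans (cauchy_schwarz _ _))// ler_wpM2r ?hlen_ge0.
  have : s * s <= s * (M ^+ 2 * hsq y).
    rewrite -{3}zz -!hlen_sq mulrCA -!exprMn -expr2.
    by rewrite ler_sqr ?nnegrE ?mulr_ge0 ?hlen_ge0// mulrA.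
  have := s0; rewrite le_eqVlt => /orP[/eqP <- _|sp]; last by rewrite ler_pM2l.
  by rewrite mulr_ge0 ?sqr_ge0 ?hsq_ge0.
pose S' y := mk_ell2 (bnd y).
have lS' : linear S'.
  move=> k y z; apply: ell2_eq => i.
  by rewrite -[LHS]/(dot (S (ell2_delta R i)) (k *: y + z)) dotDr dotZr.
have bS' : bounded_op S'.
  apply: (@mk_bounded_op _ _ _ M) => // y.
  rewrite -ler_sqr ?nnegrE ?mulr_ge0 ?hlen_ge0// exprMn !hlen_sq.
  by apply: ell2_hsq_le => A; exact: bnd.
exists S'; split=> // x y.
have h1 := has_hsum_dotl y (has_hsum_op bS (ell2_expand x)).
have h2 := has_hsum_dotl (S' y) (ell2_expand x).
apply: has_csum_unique h1 _; move: h2; congr has_csum; apply/funext => i.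
by rewrite /= (linear_for_Z lS) !dotZl dot_delta.
Qed.

End ell2_operators.

(** * The Fock representation *)

Section sum_along_injection.
Variables (I J : choiceType) (j : J -> I).
Hypothesis j_inj : injective j.

(** [B'] depends on [B] alone and not on [F]; the membership clause lets [has_csum_inj] see that
    [B'] is large when [B] is. *)
Lemma sum_preimage (B : {fset I}) : exists B' : {fset J},
  (forall e, (e \in B') = (j e \in B)) /\
  forall (V : nmodType) (F : I -> V), (forall i, (forall e, i != j e) -> F i = 0) ->
    \sum_(i <- B) F i = \sum_(e <- B') F (j e).
Proof.
have fin : finite_set (j @^-1` [set` B]).
  by apply: finite_preimage => [? ? _ _ /j_inj//|]; exact: finite_fset.
pose B' := fset_set (j @^-1` [set` B]).
have B'E e : (e \in B') = (j e \in B).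
  by rewrite in_fset_set//; apply/idP/idP => [/set_mem//|h]; apply/mem_set.
exists B'; split=> // V F hF.
have <- : \sum_(i <- (j @` B')%fset) F i = \sum_(e <- B') F (j e).
  by rewrite big_imfset//= => ? ? _ _ /j_inj.
symmetry; apply: big_fset_incl => [|i iB iB'].
  by apply/fsubsetP => _ /imfsetP[e /= eB' ->]; rewrite -B'E.
apply: hF => e; apply: contraNneq iB' => ie; apply/imfsetP; exists e => //=.
by rewrite B'E -ie.
Qed.

Lemma has_csum_inj (R : realType) (F : I -> R[i]) l :
  (forall i, (forall e, i != j e) -> F i = 0) ->
  has_csum (F \o j) l -> has_csum F l.
Proof.
move=> F0 h e e0; have [A' hA'] := h _ e0; exists (j @` A')%fset => B AB.
have [B' [B'E ->//]] := sum_preimage B; apply: hA'.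
apply/fsubsetP => k kA'; rewrite B'E (fsubsetP AB)//; exact: in_imfset.
Qed.

End sum_along_injection.

(* The Fock representation of X(E).  A word (v, [:: e_1; ..; e_n]) stands for
   the path e_1 .. e_n starting at v; words that are not paths span an
   invariant complement and do no harm. *)
Section fock_representation.
Variables (R : realType) (E : graph).
Local Notation nc := (@ComplexField.Normc.normc R).

Definition word : countType := (vertex E * seq (edge E))%type.
Local Notation K := (ell2 R word).
Implicit Types (x y : xgraph R E) (a b : c0 R (vertex E)) (h k : K) (p q : word).

Definition word_rng p : vertex E := if p.2 is e :: _ then rng e else p.1.
Definition word_cons q (e : edge E) : word := (q.1, e :: q.2).
Definition word_tail p : word := (p.1, behead p.2).

(** The left creation operator of the Fock space. Whether [e] may be put in front of a word is
    tested only against the range of that word. *)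
Definition creation_fun x k p : R[i] :=
  if p.2 is e :: l then
    if src e == word_rng (p.1, l) then x e * k (p.1, l) else 0
  else 0.

Lemma word_cons_inj q : injective (word_cons q).
Proof. by move=> e f []. Qed.

Lemma creation_fun_cons x k q e : creation_fun x k (word_cons q e) =
  if src e == word_rng q then x e * k q else 0.
Proof. by rewrite /creation_fun /=; case: q. Qed.

Lemma creation_fun_out x k q p : word_tail p = q -> (forall e, p != word_cons q e) ->
  creation_fun x k p = 0.
Proof.
by case: p => v [|e l]//= <- /(_ e) /eqP.
Qed.

(** The words are grouped by their tail [q]. Those with a given tail differ in the first edge only
    and together contribute at most [hat x (word_rng q) * nc (k q) ^+ 2]. *)
Lemma creation_fun_le x k (M : R) : (forall v, hat x v <= M) -> forall A : {fset word},
  \sum_(p <- A) nc (creation_fun x k p) ^+ 2 <= M * hsq k.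
Proof.
move=> hM A; rewrite (partition_big_imfset _ word_tail)/=.
apply: le_trans (_ : \sum_(q <- [fset word_tail p | p in A]%fset) M * nc (k q) ^+ 2 <= _).
  apply: ler_sum => q _; rewrite big_mkcond/=.
  have [B [_ ->]] := sum_preimage (@word_cons_inj q) A; last first.
    by move=> p hp; case: ifP => // /eqP pq; rewrite (creation_fun_out _ _ pq hp) nc0 expr0n.
  apply: le_trans (_ : fsq x (word_rng q) B * nc (k q) ^+ 2 <= _); last first.
    by rewrite ler_wpM2r ?sqr_ge0// (le_trans (fsq_hat _ _ _)).
  rewrite /fsq mulr_suml; apply: ler_sum => e _.
  have -> : word_tail (word_cons q e) == q by apply/eqP; case: q.
  rewrite creation_fun_cons; case: ifP => _; first by rewrite ncM exprMn.
  by rewrite nc0 mul0r expr0n.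
(* In a graph without vertices [M] may be negative, but then there are no words and [k] vanishes. *)
have M0 : 0 <= M \/ (forall q, nc (k q) ^+ 2 = 0 :> R).
  have [[v _]|nv] := pselect (exists v : vertex E, True).
    by left; exact: le_trans (hat_ge0 x v) (hM v).
  by right=> q; case: nv; exists q.1.
case: M0 => [M0|k0]; first by rewrite -mulr_sumr ler_wpM2l ?ell2_hsq_ge.
have -> : hsq k = 0.
  apply/eqP; rewrite eq_le hsq_ge0 andbT; apply: ell2_hsq_le => B.
  by rewrite big1// => q _; rewrite k0.
by rewrite mulr0 big1// => q _; rewrite k0 mulr0.
Qed.

Lemma hat_bounded x : exists M : R, 0 <= M /\ forall v, hat x v <= M ^+ 2.
Proof.
have [M M0 hM] := vanishing_bounded (hat_vanishing x).
exists (Num.sqrt M); split; first exact: sqrtr_ge0.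
move=> v; rewrite sqr_sqrtr//; apply: le_trans (hM v).
by rewrite /= expr0n addr0 sqrtr_sqr ler_norm.
Qed.

Lemma creation_ex x : exists S S' : K -> K,
  [/\ bounded_op S, bounded_op S', adjoint_ops S S' &
      forall k p, S k p = creation_fun x k p].
Proof.
have [M [M0 hM]] := hat_bounded x.
pose S k : K := mk_ell2 (creation_fun_le k hM).
have lS : linear S.
  move=> c h k; apply: ell2_eq => -[v [|e l]].
    by rewrite -[LHS]/(0 : R[i]) -[RHS]/(c * 0 + 0) mulr0 addr0.
  rewrite -[LHS]/(creation_fun x (c *: h + k) (v, e :: l)).
  rewrite -[RHS]/(c * creation_fun x h (v, e :: l) + creation_fun x k (v, e :: l)).
  rewrite /creation_fun/=; case: ifP => _; last by rewrite mulr0 addr0.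
  by rewrite -[X in x e * X]/(c * h (v, l) + k (v, l)) mulrDr mulrCA.
have bS : bounded_op S.
  apply: (mk_bounded_op lS M0) => k.
  rewrite -ler_sqr ?nnegrE ?mulr_ge0 ?hlen_ge0// exprMn !hlen_sq.
  by apply: ell2_hsq_le; exact: creation_fun_le.
have [S' [bS' aS]] := ell2_adjoint_ex bS.
by exists S, S'; split.
Qed.

Lemma diagonal_le a k (A : {fset word}) :
  \sum_(p <- A) nc (a (word_rng p) * k p) ^+ 2 <= c0_norm a ^+ 2 * hsq k.
Proof.
apply: le_trans (_ : \sum_(p <- A) c0_norm a ^+ 2 * nc (k p) ^+ 2 <= _).
  apply: ler_sum => p _; rewrite ncM exprMn ler_wpM2r ?sqr_ge0//.
  by rewrite ler_sqr ?nnegrE ?nc_ge0 ?c0_norm_ge0// c0_norm_ub.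
by rewrite -mulr_sumr ler_wpM2l ?sqr_ge0 ?ell2_hsq_ge.
Qed.

Definition diagonal a k : K := mk_ell2 (diagonal_le a k).

Lemma diagonal_bounded a : bounded_op (diagonal a).
Proof.
have ld : linear (diagonal a).
  move=> c h k; apply: ell2_eq => p.
  rewrite -[RHS]/(c * (a (word_rng p) * h p) + a (word_rng p) * k p).
  by rewrite -[LHS]/(a (word_rng p) * (c * h p + k p)) mulrDr mulrCA.
apply: (mk_bounded_op ld (c0_norm_ge0 a)) => k.
rewrite -ler_sqr ?nnegrE ?mulr_ge0 ?hlen_ge0 ?c0_norm_ge0// exprMn !hlen_sq.
by apply: ell2_hsq_le; exact: diagonal_le.
Qed.

Lemma diagonal_adjoint a : adjoint_ops (diagonal a) (diagonal (cstar a)).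
Proof.
move=> h k; apply: has_csum_unique (ell2_dotP (diagonal a h) k) _.
have := ell2_dotP h (diagonal (cstar a) k); congr has_csum; apply/funext => p.
rewrite -[RHS]/(conjc (a (word_rng p) * h p) * k p) conjcM.
by rewrite -[LHS]/(conjc (h p) * (conjc (a (word_rng p)) * k p)) mulrCA mulrA.
Qed.

Definition fock_pi a : bop K :=
  mk_bop (diagonal_bounded a) (diagonal_bounded (cstar a)) (diagonal_adjoint a).

(** The adjoint is only known to exist, so the operator is not given by a definition; what follows
    holds for any choice of [fock_sigma]. *)
Lemma fock_sigma_ex x : exists S : bop K, forall k p, S k p = creation_fun x k p.
Proof.
by have [S [S' [bS bS' aS hS]]] := creation_ex x; exists (mk_bop bS bS' aS).
Qed.

Section toeplitz.
Variable fock_sigma : xgraph R E -> bop K.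
Hypothesis fock_sigmaE : forall x k p, fock_sigma x k p = creation_fun x k p.

Lemma fock_sigma_linear : linear fock_sigma.
Proof.
move=> c x y; apply: bop_eq => k; apply: ell2_eq => p.
rewrite bop_linE ell2_linE.
rewrite !fock_sigmaE /creation_fun; case: p => v [|e l] /=.
  by rewrite mulr0 addr0.
case: ifP => _; last by rewrite mulr0 addr0.
transitivity ((c * x e + y e) * k (v, l)); first by [].
by rewrite mulrDl mulrA.
Qed.

Lemma fock_pi_star_hom : star_hom fock_pi.
Proof.
split.
- move=> c a b; apply: bop_eq => k; apply: ell2_eq => p.
  transitivity ((c * a (word_rng p) + b (word_rng p)) * k p); first by [].
  by rewrite mulrDl -mulrA.
- move=> a b; apply: bop_eq => k; apply: ell2_eq => p.
  transitivity (a (word_rng p) * b (word_rng p) * k p); first by [].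
  by rewrite -mulrA.
- move=> a; symmetry; apply: (bop_starP (Q := fock_pi (cstar a))).
  exact: diagonal_adjoint.
Qed.

Lemma fock_star_eval x k q :
  bop_star (fock_sigma x) k q = dot (fock_sigma x (ell2_delta R q)) k.
Proof. by rewrite (bop_star_adjoint (fock_sigma x)) dot_delta. Qed.

Lemma fock_sigma_ract x a : fock_sigma (ract x a) = cmul (fock_sigma x) (fock_pi a).
Proof.
apply: bop_eq => k; apply: ell2_eq => p.
transitivity (fock_sigma x (fock_pi a k) p); last by [].
rewrite !fock_sigmaE /creation_fun; case: p => v [|e l] //=.
case: ifP => // /eqP se; transitivity (x e * a (src e) * k (v, l)); first by [].
rewrite -mulrA se; congr (_ * _).
Qed.

Lemma fock_sigma_lact a x : fock_sigma (lact a x) = cmul (fock_pi a) (fock_sigma x).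
Proof.
apply: bop_eq => k; apply: ell2_eq => p.
transitivity (a (word_rng p) * fock_sigma x k p); last by [].
rewrite !fock_sigmaE /creation_fun; case: p => v [|e l] /=; first by rewrite mulr0.
case: ifP => _; last by rewrite mulr0.
transitivity (a (rng e) * x e * k (v, l)); first by [].
by rewrite mulrA.
Qed.

(** Coordinate [q] of the right-hand side is the inner product of [fock_sigma x] applied to the
    point mass at [q] with [fock_sigma y k]. Only the words [word_cons q e] contribute, and they
    leave [k q] times the series of the inner product of [x] and [y] at the range of [q]. *)
Lemma fock_sigma_hip x y :
  fock_pi (hip x y) = cmul (cstar (fock_sigma x)) (fock_sigma y).
Proof.
apply: bop_eq => k; apply: ell2_eq => q.
transitivity (xip x y (word_rng q) * k q); first by [].
transitivity (bop_star (fock_sigma x) (fock_sigma y k) q); last by [].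
rewrite fock_star_eval; apply: has_csum_unique (ell2_dotP _ _).
apply: (has_csum_inj (@word_cons_inj q)) => [p hp|].
  rewrite !fock_sigmaE; case: p hp => v [|e l] hp.
    by rewrite [creation_fun x _ _]/(0 : R[i]) conjc0 mul0r.
  rewrite -[(v, e :: l)]/(word_cons (v, l) e) !creation_fun_cons ell2_deltaE.
  case: (eqVneq ((v, l) : word) q) => [vq|_].
    by have := hp e; rewrite /word_cons -vq eqxx.
  by rewrite mulr0; case: ifP; rewrite conjc0 mul0r.
have := has_csumZ (k q) (xip_has_csum x y (word_rng q)); rewrite [k q * _]mulrC.
congr has_csum; apply/funext => e; rewrite /= !fock_sigmaE !creation_fun_cons /ip_term.
rewrite ell2_deltaE eqxx mulr1; case: ifP => _; last by rewrite mulr0 conjc0 mul0r.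
by rewrite mulrC mulrA.
Qed.

Lemma fock_toeplitz : toeplitz_rep fock_sigma fock_pi.
Proof.
split; [exact: fock_sigma_linear|exact: fock_pi_star_hom|exact: fock_sigma_ract
  |exact: fock_sigma_lact|exact: fock_sigma_hip].
Qed.

End toeplitz.

End fock_representation.

(** The Fock representation factors through [T], and there the point mass at [v] fixes the vector of
    the empty path at [v]. *)
Lemma toeplitz_delta_vertex_neq0 (R : realType) (E : graph) (T : cstarAlgType R)
    (sigma_u : xgraph R E -> T) (pi_u : c0 R (vertex E) -> T) v :
  toeplitz_algebra sigma_u pi_u -> pi_u (delta_vertex R v) <> 0.
Proof.
move=> [_ univ] pv0; have /choice[s sE] := @fock_sigma_ex R E.
have [rho [[[lrho _ _] _ hpi] _]] := univ _ _ _ (fock_toeplitz sE).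
have : fock_pi (delta_vertex R v) = 0.
  by rewrite hpi /= pv0 (linear_for_0 lrho).
pose p : word E := (v, [::]).
move=> /(congr1 (fun S : bop (ell2 R (word E)) => S (ell2_delta R p) p)).
rewrite -[LHS]/(delta_vertex R v v * ell2_delta R p p) ell2_deltaE eqxx mulr1.
rewrite -[LHS]/((v == v)%:R : R[i]) eqxx -[RHS]/(0 : R[i]); exact/eqP/oner_neq0.
Qed.

(** * Uniqueness from the universal property *)

Section universality.
Variables (R : realType) (A : cstarAlgType R) (X : correspondenceType A).
Variables (T : cstarAlgType R) (sigma : X -> T) (pi : A -> T).
Hypothesis toepT : toeplitz_algebra sigma pi.

Lemma star_hom_comp (B C D : cstarAlgType R) (f : C -> D) (g : B -> C) :
  star_hom f -> star_hom g -> star_hom (f \o g).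
Proof.
move=> [lf mf sf] [lg mg sg]; split=> [k x y|a b|a] /=; first by rewrite lg lf.
  by rewrite mg mf.
by rewrite sg sf.
Qed.

Lemma toeplitz_rep_comp (B : cstarAlgType R) (r : T -> B) : star_hom r ->
  toeplitz_rep (r \o sigma) (r \o pi).
Proof.
move=> hr; have [lr mr sr] := hr; have [[ls hp h1 h2 h3] _] := toepT.
split=> [k x y||x a|a x|x y] /=; first by rewrite ls lr.
- exact: star_hom_comp hr hp.
- by rewrite h1 mr.
- by rewrite h2 mr.
- by rewrite h3 mr sr.
Qed.

(** Takes the place of an argument by density of the algebra generated by [sigma] and [pi]: both
    homomorphisms are the unique one belonging to the Toeplitz representation [r1 \o sigma],
    [r1 \o pi]. *)
Lemma toeplitz_hom_unique (B : cstarAlgType R) (r1 r2 : T -> B) :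
  star_hom r1 -> star_hom r2 -> (forall x, r1 (sigma x) = r2 (sigma x)) ->
  (forall a, r1 (pi a) = r2 (pi a)) -> r1 = r2.
Proof.
move=> hr1 hr2 hs hp; have [_ univ] := toepT.
have [r [_ uni]] := univ _ _ _ (toeplitz_rep_comp hr1).
rewrite -(uni r1)//; apply: uni; split=> //; apply/funext => x /=; [exact: hs|exact: hp].
Qed.

Variable H : hilbertType R.
Implicit Type t : T -> H -> H.

Definition rep_bop t (h : star_rep t) (a : T) : bop H :=
  let: And4 b _ _ adj := h in mk_bop (b a) (b (cstar a)) (adj a).

Lemma rep_bopE t (h : star_rep t) a x : rep_bop h a x = t a x.
Proof. by case: h. Qed.

Lemma rep_bop_hom t (h : star_rep t) : star_hom (rep_bop h).
Proof.
have [b l m adj] := h; split=> [k x y|x y|x].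
- by apply: bop_eq => z; rewrite bop_linE !rep_bopE l.
- by apply: bop_eq => z; rewrite rep_bopE m /= -[RHS]/(rep_bop h x (rep_bop h y z)) !rep_bopE.
- symmetry; apply: (bop_starP (Q := rep_bop h (cstar x))) => y z.
  by rewrite !rep_bopE adj.
Qed.

Lemma star_rep_unique t1 t2 : star_rep t1 -> star_rep t2 ->
  (forall x h, t1 (sigma x) h = t2 (sigma x) h) ->
  (forall a h, t1 (pi a) h = t2 (pi a) h) -> forall a h, t1 a h = t2 a h.
Proof.
move=> r1 r2 hs hp a h; rewrite -(rep_bopE r1) -(rep_bopE r2).
rewrite (toeplitz_hom_unique (rep_bop_hom r1) (rep_bop_hom r2))//.
  by move=> x; apply: bop_eq => z; rewrite !rep_bopE.
by move=> x; apply: bop_eq => z; rewrite !rep_bopE.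
Qed.

End universality.

(** * Rank-one operators and point masses *)

Section rank_one.
Variables (R : realType) (H : hilbertType R).
Implicit Types x y z : H.

(** In bra-ket notation |x><y|. *)
Definition rank_one x y z : H := dot y z *: x.

Lemma rank_one_adjoint x y : adjoint_ops (rank_one x y) (rank_one y x).
Proof. by move=> a b; rewrite /rank_one dotZl dotZr -dotC mulrC. Qed.

Lemma rank_one_bounded x y : bounded_op (rank_one x y).
Proof.
apply: (@mk_bounded_op _ _ _ (hlen y * hlen x)) => [||z].
- exact: adjoint_linear (rank_one_adjoint x y).
- by rewrite mulr_ge0 ?hlen_ge0.
- by rewrite hlenZ mulrAC ler_wpM2r ?hlen_ge0// cauchy_schwarz.
Qed.

End rank_one.

Section point_masses.
Variables (R : realType) (E : graph).
Implicit Types (x : xgraph R E) (a : c0 R (vertex E)) (e f : edge E) (v w : vertex E).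
Local Notation dv := (@delta_vertex R E).
Local Notation de := (@delta_edge R E).

Lemma hip_delta_edge e x : hip (de e) x = x e *: dv (src e).
Proof.
apply: c0_eq => v; transitivity (xip (de e) x v); first by [].
transitivity (x e * (v == src e)%:R); last by [].
apply: has_csum_unique (xip_has_csum (de e) x v) _.
have -> : x e * (v == src e)%:R = ip_term (de e) x v e.
  rewrite /ip_term eq_sym; case: ifP => _; last by rewrite mulr0.
  by rewrite [de e e]/((e == e)%:R) eqxx conjc1 mul1r mulr1.
apply: has_csum1 => f /negPf fe; rewrite /ip_term [de e f]/((f == e)%:R) fe.
by rewrite conjc0 mul0r; case: ifP.
Qed.

Lemma cmul_delta_vertex a v : cmul a (dv v) = a v *: dv v.
Proof.
apply: c0_eq => w; transitivity (a w * (w == v)%:R); first by [].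
transitivity (a v * (w == v)%:R); last by [].
by case: eqVneq => [->//|_]; rewrite !mulr0.
Qed.

Lemma delta_vertexE v w : dv v w = (w == v)%:R.
Proof. by []. Qed.

Lemma cstar_delta_vertex v : cstar (dv v) = dv v.
Proof.
apply: c0_eq => w; transitivity (conjc (w == v)%:R : R[i]); first by [].
by rewrite delta_vertexE; case: eqP => _; rewrite ?conjc0 ?conjc1.
Qed.

Lemma ract_delta e v : ract (de e) (dv v) = (src e == v)%:R *: de e.
Proof.
apply: xgraph_eq => f; transitivity ((f == e)%:R * (src f == v)%:R : R[i]); first by [].
transitivity ((src e == v)%:R * (f == e)%:R : R[i]); last by [].
by case: (eqVneq f e) => [->|_]; rewrite ?mulr0 ?mul0r ?mulr1 ?mul1r.
Qed.

Lemma lact_delta e v : lact (dv v) (de e) = (rng e == v)%:R *: de e.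
Proof.
apply: xgraph_eq => f; transitivity ((rng f == v)%:R * (f == e)%:R : R[i]); first by [].
transitivity ((rng e == v)%:R * (f == e)%:R : R[i]); last by [].
by case: (eqVneq f e) => [->|_]; rewrite ?mulr0 ?mul0r ?mulr1 ?mul1r.
Qed.

Lemma hip_self_delta x v : cmul (hip x x) (dv v) = (hat x v)%:C *: dv v.
Proof. by rewrite cmul_delta_vertex -xip_self. Qed.

End point_masses.

(** * Relations between the edge and vertex operators *)

Section representation.
Variables (R : realType) (E : graph) (T : cstarAlgType R).
Variables (sigma : xgraph R E -> T) (pi : c0 R (vertex E) -> T).
Hypothesis toepT : toeplitz_algebra sigma pi.
Variables (H : hilbertType R) (tau : T -> H -> H).
Hypothesis rep : star_rep tau.
Implicit Types (x y : xgraph R E) (a b : c0 R (vertex E)) (e f : edge E)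
  (v w : vertex E) (h k : H).
Local Notation nc := (@ComplexField.Normc.normc R).
Local Notation dv := (@delta_vertex R E).
Local Notation de := (@delta_edge R E).

Definition vertex_op v : H -> H := tau (pi (dv v)).
Definition edge_op e : H -> H := tau (sigma (de e)).
Definition edge_op_adj e : H -> H := tau (cstar (sigma (de e))).
Local Notation P := vertex_op.
Local Notation S := edge_op.
Local Notation S' := edge_op_adj.

Lemma rep_bounded t : bounded_op (tau t).
Proof. by case: rep. Qed.

Lemma rep_linear t : linear (tau t).
Proof. by case: (rep_bounded t). Qed.

Lemma rep_lin (c : R[i]) t u h : tau (c *: t + u) h = c *: tau t h + tau u h.
Proof. by case: rep => _ -> _ _. Qed.

Lemma repM t u h : tau (cmul t u) h = tau t (tau u h).
Proof. by case: rep => _ _ -> _. Qed.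

Lemma rep_adjoint t : adjoint_ops (tau t) (tau (cstar t)).
Proof. by case: rep. Qed.

Lemma rep0 h : tau 0 h = 0.
Proof. by have := rep_lin (-1) 0 0 h; rewrite scaler0 addr0 scaleN1r addNr. Qed.

Lemma repZ (c : R[i]) t h : tau (c *: t) h = c *: tau t h.
Proof. by rewrite -[c *: t]addr0 rep_lin rep0 addr0. Qed.

Let toep : toeplitz_rep sigma pi := proj1 toepT.

Lemma pi_lin (c : R[i]) a b h :
  tau (pi (c *: a + b)) h = c *: tau (pi a) h + tau (pi b) h.
Proof. by have [_ [lp _ _] _ _ _] := toep; rewrite lp rep_lin. Qed.

Lemma piZ (c : R[i]) a h : tau (pi (c *: a)) h = c *: tau (pi a) h.
Proof. by have [_ [lp _ _] _ _ _] := toep; rewrite (linear_for_Z lp) repZ. Qed.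

Lemma piM a b h : tau (pi (cmul a b)) h = tau (pi a) (tau (pi b) h).
Proof. by have [_ [_ mp _] _ _ _] := toep; rewrite mp repM. Qed.

Lemma pi_adjoint a : adjoint_ops (tau (pi a)) (tau (pi (cstar a))).
Proof. by have [_ [_ _ sp] _ _ _] := toep; rewrite sp; exact: rep_adjoint. Qed.

Lemma sigma_lin (c : R[i]) x y h :
  tau (sigma (c *: x + y)) h = c *: tau (sigma x) h + tau (sigma y) h.
Proof. by have [ls _ _ _ _] := toep; rewrite ls rep_lin. Qed.

Lemma sigmaZ (c : R[i]) x h : tau (sigma (c *: x)) h = c *: tau (sigma x) h.
Proof. by have [ls _ _ _ _] := toep; rewrite (linear_for_Z ls) repZ. Qed.

Lemma sigma_ract x a h : tau (sigma (ract x a)) h = tau (sigma x) (tau (pi a) h).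
Proof. by have [_ _ -> _ _] := toep; rewrite repM. Qed.

Lemma sigma_lact a x h : tau (sigma (lact a x)) h = tau (pi a) (tau (sigma x) h).
Proof. by have [_ _ _ -> _] := toep; rewrite repM. Qed.

Lemma sigma_hip x y h :
  tau (pi (hip x y)) h = tau (cstar (sigma x)) (tau (sigma y) h).
Proof. by have [_ _ _ _ ->] := toep; rewrite repM. Qed.

Lemma dot_sigma x y h k :
  dot (tau (sigma x) h) (tau (sigma y) k) = dot h (tau (pi (hip x y)) k).
Proof. by rewrite rep_adjoint sigma_hip. Qed.

(** The adjoint edge operators read off coordinates. This gives the orthogonality relations of the
    edges and, later, the injectivity of [sigma] and the identification of [U x]. *)
Lemma edge_op_adj_sigma e x h : S' e (tau (sigma x) h) = x e *: P (src e) h.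
Proof. by rewrite /edge_op_adj -sigma_hip hip_delta_edge piZ. Qed.

Lemma pi_vertex a v h : tau (pi a) (P v h) = a v *: P v h.
Proof. by rewrite /vertex_op -piM cmul_delta_vertex piZ. Qed.

Lemma vertex_opM v w h : P v (P w h) = if v == w then P w h else 0.
Proof.
rewrite {1}/vertex_op pi_vertex delta_vertexE eq_sym.
by case: ifP => _; rewrite ?scale1r ?scale0r.
Qed.

Lemma vertex_op_idem v h : P v (P v h) = P v h.
Proof. by rewrite vertex_opM eqxx. Qed.

Lemma vertex_op_adjoint v : adjoint_ops (P v) (P v).
Proof. by have := pi_adjoint (dv v); rewrite cstar_delta_vertex. Qed.

Lemma vertex_op_orth v w h : v != w -> P v (P w h) = 0.
Proof. by rewrite vertex_opM => /negPf ->. Qed.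

Lemma vertex_op_bounded v : bounded_op (P v). Proof. exact: rep_bounded. Qed.

Lemma vertex_op_linear v : linear (P v). Proof. exact: rep_linear. Qed.

Lemma edge_op_linear e : linear (S e). Proof. exact: rep_linear. Qed.

Lemma edge_op_adjoint e : adjoint_ops (S e) (S' e).
Proof. exact: rep_adjoint. Qed.

Lemma edge_op_adj_edge e f h : S' e (S f h) = if e == f then P (src e) h else 0.
Proof.
rewrite {1}/edge_op edge_op_adj_sigma.
transitivity ((e == f)%:R *: P (src e) h : H); first by [].
by case: ifP => _; rewrite ?scale1r ?scale0r.
Qed.

Lemma edge_op_src e v h : S e (P v h) = if src e == v then S e h else 0.
Proof.
rewrite /edge_op /vertex_op -sigma_ract ract_delta sigmaZ.
by case: ifP => _; rewrite ?scale1r ?scale0r.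
Qed.

Lemma vertex_edge_op e v h : P v (S e h) = if rng e == v then S e h else 0.
Proof.
rewrite /edge_op /vertex_op -sigma_lact lact_delta sigmaZ.
by case: ifP => _; rewrite ?scale1r ?scale0r.
Qed.

Lemma vertex_edge_op_adj e v h : P v (S' e h) = if src e == v then S' e h else 0.
Proof.
apply: dot_injl => k; rewrite -vertex_op_adjoint -edge_op_adjoint edge_op_src.
by case: ifP => _; rewrite ?edge_op_adjoint// dot0l dot0r.
Qed.

Lemma edge_op_adj_rng e v h : S' e (P v h) = if rng e == v then S' e h else 0.
Proof.
apply: dot_injl => k; rewrite -edge_op_adjoint -vertex_op_adjoint vertex_edge_op.
by case: ifP => _; rewrite ?edge_op_adjoint// dot0l dot0r.
Qed.

Lemma edge_op_orth e f h : e != f -> S' e (S f h) = 0.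
Proof. by rewrite edge_op_adj_edge => /negPf ->. Qed.

Lemma edge_op_piso e h : S e (S' e (S e h)) = S e h.
Proof. by rewrite edge_op_adj_edge eqxx edge_op_src eqxx. Qed.

Lemma vertex_op_piso v h : P v (P v (P v h)) = P v h.
Proof. by rewrite !vertex_op_idem. Qed.

(* With |b| <= M and d = M - sqrt (M^2 - |b|^2), which vanishes at infinity
   like b, one has M^2 |k|^2 - |pi(b) k|^2 = |(M - pi(d)) k|^2 >= 0. *)
Lemma pi_contractive b k : hlen (tau (pi b) k) <= c0_norm b * hlen k.
Proof.
set M := c0_norm b; have M0 : 0 <= M := c0_norm_ge0 b.
have bM v : nc (b v) ^+ 2 <= M ^+ 2.
  by rewrite ler_sqr ?nnegrE ?nc_ge0//; exact: c0_norm_ub.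
pose g v : R := M - Num.sqrt (M ^+ 2 - nc (b v) ^+ 2).
have g0 v : 0 <= g v.
  rewrite /g subr_ge0 -ler_sqr ?nnegrE ?sqrtr_ge0// sqr_sqrtr ?subr_ge0//.
  by rewrite lerBlDr lerDl sqr_ge0.
have gb v : g v <= nc (b v).
  have h1 := c0_norm_ub b v; have h2 := nc_ge0 (b v); rewrite -/M in h1.
  rewrite /g lerBlDr addrC -lerBlDr -ler_sqr ?nnegrE ?sqrtr_ge0 ?subr_ge0//.
  by rewrite sqr_sqrtr ?subr_ge0//; nra.
have vg : vanishing (fun v => (g v)%:C).
  apply: vanishing_le (c0_vanishing b) _ => v.
  by rewrite /= expr0n addr0 sqrtr_sqr ger0_norm.
pose d : c0 R (vertex E) := mk_c0 vg.
have dd : cmul (cstar d) d = (-1) *: cmul (cstar b) b + (2 * M)%:C *: d.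
  apply: c0_eq => v.
  transitivity (conjc (g v)%:C * (g v)%:C); first by [].
  transitivity (-1 * (conjc (b v) * b v) + (2 * M)%:C * (g v)%:C); last by [].
  have hg : g v ^+ 2 = 2 * M * g v - nc (b v) ^+ 2.
    have := sqr_sqrtr (_ : 0 <= M ^+ 2 - nc (b v) ^+ 2); rewrite subr_ge0.
    by move=> /(_ (bM v)) h; rewrite /g; nra.
  rewrite nc_sq in hg; case: (b v) hg => p q /= hg.
  by apply/eqP; rewrite eq_complex/=; apply/andP; split; apply/eqP; lra.
have dC a : dot (tau (pi a) k) (tau (pi a) k) = dot k (tau (pi (cmul (cstar a) a)) k).
  by rewrite pi_adjoint piM.
have h1 : hsq (tau (pi d) k) = - hsq (tau (pi b) k) + 2 * M * complex.Re (dot k (tau (pi d) k)).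
  have := dC d; rewrite dd pi_lin dotDr dotZr piZ dotZr -dC !dot_hsq.
  by case: (dot k _) => p q /(congr1 (@complex.Re R)) /=; lra.
have h2 := hsq_ge0 (M%:C *: k - tau (pi d) k).
rewrite hsqD hsqZ -scaleN1r hsqZ dotZl dotZr nc_sq ncN nc_sq h1 in h2.
rewrite -ler_sqr ?nnegrE ?mulr_ge0 ?hlen_ge0// exprMn !hlen_sq.
by move: h2; case: (dot k _) => p q /=; lra.
Qed.

(** * Vectors killed by the vertex projections, and non-degeneracy *)

Section kernel.
Variable k : H.
Hypothesis Pk : forall v, P v k = 0.

(** A function vanishing at infinity is uniformly close to a finite combination of point masses,
    whose image kills [k]; [pi_contractive] controls the rest. *)
Lemma pi_kernel a : tau (pi a) k = 0.
Proof.
apply: hlen_small => e e0; have k1 : 0 < hlen k + 1 by have := hlen_ge0 k; lra.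
pose d := e / (hlen k + 1); have d0 : 0 < d by rewrite divr_gt0.
have /finite_fsetP[F hF] := (vanishingE a).1 (c0_vanishing a) d d0.
pose s := \sum_(v <- F) a v *: dv v.
have sE v : s v = if v \in F then a v else 0.
  have evl w (r : seq (vertex E)) : (\sum_(u <- r) a u *: dv u) w = \sum_(u <- r) a u * (w == u)%:R.
    by elim: r => [|u r IH]; rewrite ?big_nil// !big_cons -IH.
  rewrite evl; case: ifP => vF.
    rewrite (big_fsetD1 v)//= eqxx mulr1 big_seq big1 ?addr0// => u.
    by rewrite !inE eq_sym => /andP[/negPf -> _]; rewrite mulr0.
  rewrite big_seq big1// => u uF; case: eqVneq => [vu|_]; last by rewrite mulr0.
  by rewrite vu uF in vF.
have nb : c0_norm (a - s) <= d.
  apply: c0_norm_le => [|v]; first exact: ltW.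
  rewrite -[(a - s) v]/(a v - s v) sE; case: ifP => vF.
    by rewrite subrr nc0 ltW.
  rewrite subr0 ltW// ltNge; apply/negP => h.
  suff : [set` F] v by rewrite /= vF.
  by rewrite -hF.
have s0 : tau (pi s) k = 0.
  rewrite /s; elim: (enum_fset F) => [|u r IH].
    by rewrite big_nil -(scale0r 0) piZ scale0r.
  by rewrite big_cons pi_lin IH addr0 -/(P u k) Pk scaler0.
have -> : tau (pi a) k = tau (pi (a - s)) k.
  by rewrite -{1}(subrK s a) -[a - s]scale1r pi_lin s0 addr0 !scale1r.
apply: le_trans (pi_contractive _ _) _.
apply: le_trans (_ : d * (hlen k + 1) <= _); last by rewrite divfK ?gt_eqF.
by rewrite ler_pM ?c0_norm_ge0 ?hlen_ge0// lerDl.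
Qed.

Lemma sigma_kernel x : tau (sigma x) k = 0.
Proof. by apply: hsq_eq0; apply: complexI; rewrite -dot_hsq dot_sigma pi_kernel dot0r. Qed.

End kernel.

Lemma hsq_sigma x v h : P v h = h -> hsq (tau (sigma x) h) = hat x v * hsq h.
Proof.
move=> hv; apply: complexI; rewrite -dot_hsq dot_sigma -{2}hv {1}/vertex_op -piM.
rewrite hip_self_delta piZ -/(vertex_op v h) hv dotZr dot_hsq.
by rewrite rmorphM.
Qed.

(** On one block the squared length of [tau (sigma x) h] is [hat x v * hsq h], and each edge [e]
    with source [v] accounts for [nc (x e) ^+ 2 * hsq h] of it. By the Bessel identity the error is
    a tail of the series for [hat x v]. *)
Lemma sigma_expand_vertex x v h : P v h = h ->
  has_hsum (fun e => S e (S' e (tau (sigma x) h))) (tau (sigma x) h).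
Proof.
move=> hv.
have hx : has_csum (fun e => (if src e == v then nc (x e) ^+ 2 else 0)%:C) (hat x v)%:C.
  rewrite -xip_self; have := xip_has_csum x x v; congr has_csum; apply/funext => e.
  rewrite /ip_term; case: ifP => // _; rewrite nc_sq; case: (x e) => p q.
  by apply/eqP; rewrite eq_complex/=; apply/andP; split; apply/eqP; ring.
move=> e e0; have h1 : 0 < hsq h + 1 by have := hsq_ge0 h; lra.
have [A hA] := hx _ (divr_gt0 (exprn_gt0 2 e0) h1); exists A => B /hA hB.
rewrite hlenB -ler_sqr ?nnegrE ?hlen_ge0 ?(ltW e0)// hlen_sq.
rewrite (piso_bessel_eq edge_op_adjoint edge_op_orth edge_op_piso) (hsq_sigma x hv).
have -> : \sum_(i <- B) hsq (S' i (tau (sigma x) h)) =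
    (\sum_(i <- B) (if src i == v then nc (x i) ^+ 2 else 0)) * hsq h.
  rewrite mulr_suml; apply: eq_bigr => i _; rewrite edge_op_adj_sigma hsqZ.
  rewrite -{1}hv vertex_opM hv; case: ifP => // _.
  by rewrite -hlen_sq hlen0 expr0n mulr0 mul0r.
rewrite -mulrBl; set D := _ - _.
have hD : D <= e ^+ 2 / (hsq h + 1).
  apply: le_trans hB; set z := (X in nc X).
  have zE : complex.Re z = - D by rewrite /z -rmorph_sum -rmorphB /= /D opprB.
  by have := ler_Re_nc z; rewrite zE normrN; exact: le_trans (ler_norm D).
apply: le_trans (_ : e ^+ 2 / (hsq h + 1) * hsq h <= _).
  by rewrite ler_wpM2r ?hsq_ge0.
rewrite mulrAC ler_pdivrMr// ler_pM2l ?exprn_gt0//; lra.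
Qed.

Lemma has_hsum_orth (I : choiceType) (z : I -> H) l k : has_hsum z l ->
  (forall i, dot k (z i) = 0) -> dot k l = 0.
Proof.
move=> hz h0; apply: has_csum_unique (has_hsum_dot k hz) _ => e e0; exists fset0 => B _.
by rewrite big1 ?subrr ?nc0 ?ltW.
Qed.

(** By [sigma_kernel] only the part of [h] inside the blocks matters, and there [tau (sigma x) h] is
    a sum of vectors in the ranges of edge operators. Each of these ranges lies in the range of a
    vertex projection, hence is orthogonal to [k]. *)
Lemma sigma_kernel_orth k x h : (forall v, P v k = 0) -> dot k (tau (sigma x) h) = 0.
Proof.
move=> Pk; pose Ph := piso_sum P P idfun h.
have hPh : has_hsum (fun v => P v (P v h)) Ph.
  exact: (piso_has_hsum vertex_op_adjoint vertex_op_orth vertex_op_piso h (bounded_op_id H)).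
have PPh v : P v Ph = P v h.
  rewrite (piso_adj_sum vertex_op_adjoint vertex_op_orth vertex_op_piso h v (bounded_op_id H)).
  by rewrite /= vertex_op_piso.
have -> : tau (sigma x) h = tau (sigma x) Ph.
  rewrite -{1}(subrK Ph h) (linear_for_D (rep_linear _)) sigma_kernel ?add0r// => v.
  by rewrite (linear_for_B (vertex_op_linear v)) PPh subrr.
apply: has_hsum_orth (has_hsum_op (rep_bounded (sigma x)) hPh) _ => v /=.
apply: has_hsum_orth (sigma_expand_vertex x (v := v) _) _.
  by rewrite vertex_op_idem.
move=> e; set u := S' e _; have -> : S e u = P (rng e) (S e u) by rewrite vertex_edge_op eqxx.
by rewrite -vertex_op_adjoint Pk dot0l.
Qed.

Hypothesis nondeg : nondegenerate_rep tau.

(* Conjugating tau by the reflection in a unit vector k killed by all P v does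
   not change the generators, so the projection q onto the complement of k
   commutes with tau; then q tau is again a representation agreeing with tau on
   generators, whence k is orthogonal to tau(T) H. *)
Lemma vertex_ops_total k : (forall v, P v k = 0) -> k = 0.
Proof.
move=> Pk0; apply/eqP; apply/negPn/negP => kn0.
have lk : 0 < hlen k.
  by rewrite lt_neqAle hlen_ge0 andbT eq_sym; apply: contra_neq kn0; exact: hlen_eq0.
pose c := (hlen k)^-1%:C; pose k1 := c *: k.
have Pk v : P v k1 = 0 by rewrite (linear_for_Z (vertex_op_linear v)) Pk0 scaler0.
have k11 : dot k1 k1 = 1.
  rewrite dot_hsq hsqZ /c nc_sq/= expr0n addr0 -hlen_sq.
  by rewrite -exprMn mulVf ?gt_eqF// expr1n.
pose th := rank_one k1 k1.
have bth : bounded_op th := rank_one_bounded k1 k1.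
have ath : adjoint_ops th th := rank_one_adjoint k1 k1.
have th2 h : th (th h) = th h by rewrite /th /rank_one dotZr k11 mulr1.
have lth := bth.1.
(* [u s] is [1 + s th]: [s = - 2] gives the reflection in [k1], and [s = - 1] the projection onto
   its complement. *)
pose u (s : R[i]) h := s *: th h + h.
have bu s : bounded_op (u s) := bounded_op_lin s bth (bounded_op_id H).
have au s : conjc s = s -> adjoint_ops (u s) (u s).
  by move=> sr h h'; rewrite /u dotDl dotDr dotZl dotZr sr ath.
have uu s h : u s (u s h) = u (s * s + s + s) h.
  rewrite {1}/u (linear_for_D lth) (linear_for_Z lth) th2 /u.
  by rewrite scalerDr scalerA addrA -!scalerDl.
have thx x h : th (tau (sigma x) h) = 0.
  by rewrite /th /rank_one sigma_kernel_orth// scale0r.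
have thp a h : th (tau (pi a) h) = 0.
  by rewrite /th /rank_one -(adjoint_opsC (pi_adjoint a)) pi_kernel// dot0l scale0r.
have ux s x h : u s (tau (sigma x) h) = tau (sigma x) h by rewrite /u thx scaler0 add0r.
have up s a h : u s (tau (pi a) h) = tau (pi a) h by rewrite /u thp scaler0 add0r.
have xth x h : tau (sigma x) (th h) = 0.
  by rewrite (linear_for_Z (rep_linear _)) sigma_kernel// scaler0.
have pth a h : tau (pi a) (th h) = 0.
  by rewrite (linear_for_Z (rep_linear _)) pi_kernel// scaler0.
have u2 h : u (- 2) (u (- 2) h) = h.
  have c0 : - 2 * - 2 + - 2 + - 2 = 0 :> R[i] by ring.
  by rewrite uu c0 /u scale0r add0r.
have r2 : star_rep (fun t => u (- 2) \o tau t \o u (- 2)).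
  split=> [t|s x y|t t'|t].
  - by apply: bounded_op_comp => //; apply: bounded_op_comp => //; exact: rep_bounded.
  - apply/funext => h; rewrite /= rep_lin (bu (- 2)).1.
    by [].
  - by apply/funext => h; rewrite /= repM u2.
  - have a2 : adjoint_ops (u (- 2)) (u (- 2)).
      by apply: au; rewrite conjcN; congr (- _); exact: (rmorph_nat (@conjc R) 2).
    by move=> x y /=; rewrite a2 rep_adjoint a2.
have comm t h : tau t h = u (- 2) (tau t (u (- 2) h)).
  apply: (star_rep_unique toepT rep r2) => [x h'|a h'] /=.
    by rewrite ux /u (linear_for_D (rep_linear _)) (linear_for_Z (rep_linear _)) xth scaler0 add0r.
  by rewrite up /u (linear_for_D (rep_linear _)) (linear_for_Z (rep_linear _)) pth scaler0 add0r.
have comm2 t h : tau t (th h) = th (tau t h).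
  have := comm t (u (- 2) h); rewrite u2 {1}/u {1}/u.
  rewrite (linear_for_D (rep_linear _)) (linear_for_Z (rep_linear _)).
  by move=> /addIr /scalerI; apply; rewrite oppr_eq0 pnatr_eq0.
have q2 h : u (- 1) (u (- 1) h) = u (- 1) h by rewrite uu; congr (_ *: _ + _); ring.
have commq t h : tau t (u (- 1) h) = u (- 1) (tau t h).
  by rewrite /u (linear_for_D (rep_linear _)) (linear_for_Z (rep_linear _)) comm2.
have r3 : star_rep (fun t => u (- 1) \o tau t).
  split=> [t|s x y|t t'|t].
  - by apply: bounded_op_comp => //; exact: rep_bounded.
  - by apply/funext => h; rewrite /= rep_lin (bu (- 1)).1.
  - by apply/funext => h; rewrite /= repM commq q2.
  - have a1 : adjoint_ops (u (- 1)) (u (- 1)).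
      by apply: au; rewrite conjcN conjc1.
    by move=> x y /=; rewrite a1 rep_adjoint commq.
have kt t h : th (tau t h) = 0.
  have : tau t h = u (- 1) (tau t h).
    apply: (star_rep_unique toepT rep r3) => [x h'|a h'] /=; first by rewrite ux.
    by rewrite up.
  by rewrite {1}/u scaleN1r -{1}[tau t h]add0r => /addIr /eqP; rewrite eq_sym oppr_eq0 => /eqP.
have kdot t h : dot k1 (tau t h) = 0.
  have := congr1 (dot k1) (kt t h).
  by rewrite /th /rank_one dotZr k11 mulr1 dot0r.
have : closure [set h | exists n (a : 'I_n -> T) (k : 'I_n -> H),
    h = \sum_(i < n) tau (a i) (k i)] k1 by rewrite nondeg.
(* Some vector of the span lies at distance less than 1 from the unit vector [k1], although it is
   orthogonal to it. *)
move=> /(_ (ball k1 1) (nbhsx_ballx _ _ ltr01))[_ [[n [a [z ->]]]]].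
set s := \sum_(i < n) _; rewrite -ball_normE /ball_/= hlenE ltcR => hs.
have ks : dot k1 s = 0 by rewrite dot_sumr big1.
have k1len : hlen k1 = 1.
  by apply/eqP; rewrite -(@eqrXn2 _ 2)// ?hlen_ge0// hlen_sq expr1n; apply/eqP; apply: complexI; rewrite -dot_hsq k11.
have := cauchy_schwarz k1 (k1 - s); rewrite dotBr ks subr0 k11 k1len mul1r.
by rewrite -lecR -ncE normr1 lecR leNgt hs.
Qed.

Lemma vertex_ops_sum h : has_hsum (fun v => P v h) h.
Proof.
pose Ph := piso_sum P P idfun h.
have hPh : has_hsum (fun v => P v (P v h)) Ph.
  exact: (piso_has_hsum vertex_op_adjoint vertex_op_orth vertex_op_piso h (bounded_op_id H)).
suff PhE : Ph = h.
  by move: hPh; rewrite PhE; congr has_hsum; apply/funext => v; exact: vertex_op_idem.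
apply/eqP; rewrite -subr_eq0; apply/eqP; apply: vertex_ops_total => v.
rewrite (linear_for_B (vertex_op_linear v)).
rewrite (piso_adj_sum vertex_op_adjoint vertex_op_orth vertex_op_piso h v (bounded_op_id H)).
by rewrite /= vertex_op_piso subrr.
Qed.

Lemma ops_eq_on_vertices (F G : H -> H) : bounded_op F -> bounded_op G ->
  (forall v h, P v h = h -> F h = G h) -> forall h, F h = G h.
Proof.
move=> bF bG FG h; apply: has_hsum_unique (has_hsum_op bF (vertex_ops_sum h)) _.
have := has_hsum_op bG (vertex_ops_sum h); congr has_hsum; apply/funext => v /=.
by rewrite (FG v)// vertex_op_idem.
Qed.

(** * The endomorphism Ad *)

Lemma Ad_bounded (w : H -> H) : bounded_op w -> bounded_op (Ad sigma tau w).
Proof. exact: piso_sum_bounded edge_op_adjoint edge_op_orth edge_op_piso w. Qed.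

Lemma Ad_has_hsum (w : H -> H) h : bounded_op w ->
  has_hsum (fun e => S e (w (S' e h))) (Ad sigma tau w h).
Proof. exact: (piso_has_hsum edge_op_adjoint edge_op_orth edge_op_piso). Qed.

Lemma edge_op_adj_Ad (w : H -> H) h e : bounded_op w ->
  S' e (Ad sigma tau w h) = P (src e) (w (S' e h)).
Proof.
move=> bw; rewrite (piso_adj_sum edge_op_adjoint edge_op_orth edge_op_piso h e bw).
by rewrite edge_op_adj_edge eqxx.
Qed.

(** The sum of the [S e \o S' e] need not be the identity of [H], but it fixes the range of
    [tau (sigma x)]: on each block this is [sigma_expand_vertex], and the blocks are total by
    non-degeneracy. *)
Lemma Ad_id_sigma x h : Ad sigma tau idfun (tau (sigma x) h) = tau (sigma x) h.
Proof.
have bA := bounded_op_comp (Ad_bounded (bounded_op_id H)) (rep_bounded (sigma x)).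
apply: (ops_eq_on_vertices bA (rep_bounded (sigma x))) => v k kv /=.
apply: has_hsumE; exact: sigma_expand_vertex kv.
Qed.

(** Term by term, [S' e] turns [tau (sigma x)] into a multiple of a vertex projection, past which
    [w] can be moved. This intertwining relation is the trace of X(E) that [Ad] retains. *)
Lemma Ad_sigma (w : H -> H) x h : (forall v k, P v (w k) = w (P v k)) -> linear w ->
  Ad sigma tau w (tau (sigma x) h) = tau (sigma x) (w h).
Proof.
move=> cw lw; rewrite -[RHS]Ad_id_sigma; congr summability.sum; apply/funext => e.
by rewrite /= -!/(S' e _) !edge_op_adj_sigma (linear_for_Z lw) cw.
Qed.

(** On both sides only the edges with range [v] survive. Consequently [Ad] stays inside the
    commutant of the vertex projections. *)
Lemma vertex_op_Ad (w : H -> H) v h : bounded_op w ->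
  P v (Ad sigma tau w h) = Ad sigma tau w (P v h).
Proof.
move=> bw; apply: has_hsum_unique (has_hsum_op (vertex_op_bounded v) (Ad_has_hsum h bw)) _.
have := Ad_has_hsum (P v h) bw; congr has_hsum; apply/funext => e /=.
rewrite edge_op_adj_rng vertex_edge_op; case: ifP => // _.
by rewrite (linear_for_0 bw.1) (linear_for_0 (edge_op_linear e)).
Qed.

End representation.

(** * Automorphisms of the commutant and the unitary implementing them *)

Lemma normalize_vector (R : realType) (H : hilbertType R) (h : H) :
  h != 0 -> exists c : R[i], dot (c *: h) (c *: h) = 1.
Proof.
move=> h0; exists (hlen h)^-1%:C.
rewrite dot_hsq hsqZ nc_sq/= expr0n addr0 -hlen_sq -exprMn mulVf ?expr1n//.
by apply: contra_neq h0; exact: hlen_eq0.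
Qed.

Section resolutions.
Variables (R : realType) (H : hilbertType R) (I : choiceType).
Implicit Types (h k : H) (v : I) (w : H -> H).

(** Abstracts the vertex projections of a faithful non-degenerate representation: faithfulness makes
    them nonzero, non-degeneracy makes them total. *)
Definition resolution (P : I -> H -> H) :=
  [/\ forall v, adjoint_ops (P v) (P v),
      forall v u h, P v (P u h) = if v == u then P u h else 0,
      forall v, exists h, P v h != 0 &
      forall h, (forall v, P v h = 0) -> h = 0].

Section one_resolution.
Variables (P : I -> H -> H) (resP : resolution P).

Lemma res_adjoint v : adjoint_ops (P v) (P v). Proof. by case: resP. Qed.

Lemma res_idem v h : P v (P v h) = P v h.
Proof. by case: resP => _ -> _ _; rewrite eqxx. Qed.

Lemma res_orth v u h : v != u -> P v (P u h) = 0.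
Proof. by case: resP => _ -> _ _ /negPf ->. Qed.

Lemma res_total h : (forall v, P v h = 0) -> h = 0. Proof. by case: resP => _ _ _; exact. Qed.

Lemma res_nonzero v : exists h, P v h <> 0.
Proof. by case: resP => _ _ /(_ v)[h /eqP]; exists h. Qed.

Lemma res_piso v h : P v (P v (P v h)) = P v h. Proof. by rewrite !res_idem. Qed.

Lemma res_bounded v : bounded_op (P v).
Proof. exact: (piso_bounded res_adjoint res_piso). Qed.

Lemma res_linear v : linear (P v). Proof. by case: (res_bounded v). Qed.

Lemma res_eq h k : (forall v, P v h = P v k) -> h = k.
Proof.
move=> e; apply/eqP; rewrite -subr_eq0; apply/eqP; apply: res_total => v.
by rewrite (linear_for_B (res_linear v)) e subrr.
Qed.

Lemma res_sum h : has_hsum (fun v => P v h) h.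
Proof.
have hs := piso_has_hsum res_adjoint res_orth res_piso h (bounded_op_id H).
suff Ph : piso_sum P P idfun h = h.
  by move: hs; rewrite Ph; congr has_hsum; apply/funext => v; exact: res_idem.
apply: res_eq => v.
by rewrite (piso_adj_sum res_adjoint res_orth res_piso h v (bounded_op_id H)) /= !res_idem.
Qed.

Lemma res_unit v : exists z, P v z = z /\ dot z z = 1.
Proof.
have [h h0] : exists h, P v h != 0 by case: resP.
have [c hc] := normalize_vector h0; exists (c *: P v h); split=> //.
by rewrite (linear_for_Z (res_linear v)) res_idem.
Qed.

Lemma res_block_orth v u h k : v != u -> P v h = h -> P u k = k -> dot h k = 0.
Proof. by move=> vu <- <-; rewrite res_adjoint res_orth// dot0r. Qed.

Variables (W : set (H -> H)) (WP : commutant (range P) = W).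

Lemma resWP w : W w <-> bounded_op w /\ forall v h, w (P v h) = P v (w h).
Proof.
rewrite -WP; split=> [[bw cw]|[bw cw]]; split=> //.
  by move=> v h; exact: (congr1 (fun f => f h) (cw (P v) (ex_intro2 _ _ v Logic.I erefl))).
by move=> _ [v _ <-]; apply/funext => h; exact: cw.
Qed.

Lemma resW_bounded w : W w -> bounded_op w. Proof. by move=> /resWP[]. Qed.

Lemma resW_linear w : W w -> linear w. Proof. by move=> /resW_bounded[]. Qed.

Lemma resW_comm w v h : W w -> w (P v h) = P v (w h). Proof. by move=> /resWP[]. Qed.

Lemma resW_proj v : W (P v).
Proof.
apply/resWP; split=> [|u h]; first exact: res_bounded.
have [->//|vu] := eqVneq v u.
by rewrite !res_orth// eq_sym.
Qed.

Lemma resW_comp w w' : W w -> W w' -> W (w \o w').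
Proof.
move=> Ww Ww'; apply/resWP; split.
  by apply: bounded_op_comp; exact: resW_bounded.
by move=> v h /=; rewrite !resW_comm.
Qed.

Lemma resW_id : W idfun.
Proof. by apply/resWP; split=> //; exact: bounded_op_id. Qed.

Lemma resW0 : W 0.
Proof.
apply/resWP; split=> [|v h]; first exact: bounded_op0.
by rewrite -[LHS]/(0 : H) -[RHS]/(P v (0 : H)) (linear_for_0 (res_linear v)).
Qed.

Lemma resW_rank_one v x y : P v x = x -> P v y = y -> W (rank_one x y).
Proof.
move=> Px Py; apply/resWP; split=> [|u h]; first exact: rank_one_bounded.
rewrite /rank_one (linear_for_Z (res_linear u)) -res_adjoint.
have [->|uv] := eqVneq u v; first by rewrite Px Py.
by rewrite -Px -Py !res_orth// scaler0 dot0l scale0r.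
Qed.

(* rank_one h z carries z to h, so an operator commuting with W is determined on
   the block of z by its value at z. *)
Lemma commutes_scalar (C : H -> H) v z h : (forall w k, W w -> C (w k) = w (C k)) ->
  P v z = z -> dot z z = 1 -> P v h = h -> C h = dot z (C z) *: h.
Proof.
move=> CW Pz zz Ph; have := CW _ z (resW_rank_one Ph Pz).
by rewrite /rank_one zz scale1r.
Qed.

(** W contains all rank-one operators of the block, so [z] acts on it as a scalar [c]; idempotence
    gives [c * c = c]. *)
Lemma central_projection z v : W z -> (forall w k, W w -> z (w k) = w (z k)) ->
  (forall h, z (z h) = z h) ->
  (forall h, z (P v h) = P v h) \/ (forall h, z (P v h) = 0).
Proof.
move=> Wz zW zz; have [x [Px xx]] := res_unit v; set c := dot x (z x).
have zP h : z (P v h) = c *: P v h.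
  exact: commutes_scalar zW Px xx (res_idem v h).
have zx : z x = c *: x by rewrite -Px zP.
have : c * c = c.
  have := zz x; rewrite zx (linear_for_Z (resW_linear Wz)) zx scalerA.
  by move=> /(congr1 (dot x)); rewrite !dotZr xx !mulr1.
have [c0 _|c0] := eqVneq c 0; first by right=> h; rewrite zP c0 scale0r.
rewrite -[RHS]mulr1 => /(mulfI c0) c1.
by left=> h; rewrite zP c1 scale1r.
Qed.

Lemma central_projection_ex z : W z -> (forall w k, W w -> z (w k) = w (z k)) ->
  (forall h, z (z h) = z h) -> z <> 0 -> exists v, forall h, z (P v h) = P v h.
Proof.
move=> Wz zW zz z0; apply: contrapT => nex; apply: z0; apply/funext => h.
apply: (@res_total (z h)) => v; rewrite -resW_comm//.
by have [e|->//] := central_projection v Wz zW zz; case: nex; exists v.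
Qed.

End one_resolution.

Section two_resolutions.
Variables (P Q : I -> H -> H) (resP : resolution P) (resQ : resolution Q).
Variables (W : set (H -> H)).
Hypotheses (WP : commutant (range P) = W) (WQ : commutant (range Q) = W).
Variable gamma : (H -> H) -> H -> H.
Hypothesis gammaW : star_automorphism W gamma.

Let gW w : W w -> W (gamma w).
Proof. by case: gammaW => -[gf _ _] _ _ _ /gf. Qed.

Let ginj u w : W u -> W w -> gamma u = gamma w -> u = w.
Proof. by case: gammaW => -[_ gi _] _ _ _ Wu Ww; apply: gi; apply/mem_set. Qed.

Let gsurj w : W w -> exists2 u, W u & gamma u = w.
Proof. by case: gammaW => -[_ _ gs] _ _ _ /gs. Qed.

Let gM u w h : W u -> W w -> gamma u (gamma w h) = gamma (u \o w) h.
Proof. by case: gammaW => _ _ gm _ Wu Ww; rewrite gm. Qed.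

Let gL (c : R[i]) u w h : W u -> W w -> gamma (c *: u + w) h = c *: gamma u h + gamma w h.
Proof. by case: gammaW => _ gl _ _ Wu Ww; rewrite gl. Qed.

Let gA u w : W u -> W w -> adjoint_ops u w -> adjoint_ops (gamma u) (gamma w).
Proof. by case: gammaW => _ _ _; exact. Qed.

Let g0 : gamma 0 = 0.
Proof.
apply/funext => h; have := gL (-1) h (resW0 resP WP) (resW0 resP WP).
by rewrite scaler0 addr0 scaleN1r addNr.
Qed.

Let gZ (c : R[i]) u h : W u -> gamma (c *: u) h = c *: gamma u h.
Proof.
by move=> Wu; rewrite -[c *: u]addr0 gL ?g0 ?addr0//; exact: (resW0 resP WP).
Qed.

Lemma gamma_preimage_central u p : W u -> gamma u = P p ->
  (forall w k, W w -> u (w k) = w (u k)) /\ (forall h, u (u h) = u h).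
Proof.
move=> Wu gu; split=> [w k Ww|h].
  suff e : u \o w = w \o u by exact: (congr1 (fun f => f k) e).
  apply: ginj; [exact: (resW_comp WP)|exact: (resW_comp WP)|].
  apply/funext => h; rewrite -[LHS]gM// -[RHS]gM// gu (resW_comm WP)//; exact: gW.
suff e : u \o u = u by exact: (congr1 (fun f => f h) e).
apply: ginj => //; first exact: (resW_comp WP).
by apply/funext => k; rewrite -gM// gu (res_idem resP).
Qed.

(** The image of [Q v] is central, idempotent and nonzero, so it is the identity on some block [p].
    The preimage [q] of [P p] then lies below [Q v], and minimality of [Q v] among central
    projections forces [q = Q v]. *)
Lemma gamma_proj_ex v : exists p, gamma (Q v) = P p.
Proof.
have WQv : W (Q v) := resW_proj resQ WQ v.
have Wz := gW WQv.
have zW w k : W w -> gamma (Q v) (w k) = w (gamma (Q v) k).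
  move=> /gsurj[u Wu <-]; rewrite !gM//; congr (gamma _ _).
  by apply/funext => h /=; rewrite (resW_comm WQ).
have zz h : gamma (Q v) (gamma (Q v) h) = gamma (Q v) h.
  by rewrite gM//; congr (gamma _ _); apply/funext => k; exact: (res_idem resQ).
have z0 : gamma (Q v) <> 0.
  rewrite -g0 => /(ginj WQv (resW0 resP WP)) Q0.
  by have [h] := res_nonzero resQ v; apply; rewrite Q0.
have [p hp] := central_projection_ex resP WP Wz zW zz z0; exists p.
have [q Wq gq] := gsurj (resW_proj resP WP p).
have [qW qq] := gamma_preimage_central Wq gq.
have qQ h : q (Q v h) = q h.
  suff e : q \o Q v = q by exact: (congr1 (fun f => f h) e).
  apply: ginj => //; first exact: (resW_comp WP).
  by apply/funext => k; rewrite -gM// gq -zW ?hp//; exact: (resW_proj resP WP).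
have q0 : q <> 0.
  move=> q0; have [h] := res_nonzero resP p; apply.
  by rewrite -gq q0 g0.
suff e : q = Q v by rewrite -e gq.
apply/funext => h; rewrite -qQ.
have [->//|n] := central_projection resQ WQ v Wq qW qq.
by case: q0; apply/funext => k; rewrite -qQ n.
Qed.

(** The preimage of [P p] is a nonzero central idempotent and dominates some [Q v]; then
    [gamma (Q v)] is a [P p'] dominated by [P p], so [p' = p]. *)
Lemma gamma_proj_onto p : exists v, gamma (Q v) = P p.
Proof.
have [q Wq gq] := gsurj (resW_proj resP WP p).
have [qW qq] := gamma_preimage_central Wq gq.
have q0 : q <> 0.
  move=> q0; have [h] := res_nonzero resP p; apply.
  by rewrite -gq q0 g0.
have [v hv] := central_projection_ex resQ WQ Wq qW qq q0; exists v.
have [p' hp'] := gamma_proj_ex v; rewrite hp'; congr P.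
apply/eqP; apply: contrapT => /negP pp'.
have [h] := res_nonzero resP p'; apply.
have Pp' : P p (P p' h) = P p' h.
  rewrite -hp' -gq gM//; last exact: (resW_proj resQ WQ).
  by congr (gamma _ _); apply/funext => k; exact: hv.
by rewrite -Pp' (res_orth resP)// eq_sym.
Qed.

Lemma gamma_proj_bij : exists2 alpha : I -> I, bijective alpha &
  forall v, gamma (Q v) = P (alpha v).
Proof.
have res_inj (S : I -> H -> H) : resolution S -> injective S.
  move=> rS v u e; apply/eqP; apply: contrapT => /negP vu.
  have [h] := res_nonzero rS v; apply.
  by rewrite -(res_idem rS) {2}e (res_orth rS).
have /choice[alpha ha] := gamma_proj_ex; have /choice[beta hb] := gamma_proj_onto.
exists alpha => //; exists beta => v.
  apply: (res_inj _ resQ); apply: ginj; rewrite ?hb//; exact: (resW_proj resQ WQ).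
by apply: (res_inj _ resP); rewrite -ha hb.
Qed.

Section unitary.
Variable alpha : I -> I.
Hypotheses (alpha_bij : bijective alpha) (gQ : forall v, gamma (Q v) = P (alpha v)).

Let WQv v : W (Q v) := resW_proj resQ WQ v.

(** Any unit vector of the block serves as first component. Its rank-one projection has a nonzero
    idempotent image under [gamma], and a normalized vector in the range of that image is fixed by
    it and lies in the block [alpha v]. *)
Lemma block_vectors v : exists xe : H * H, [/\ Q v xe.1 = xe.1,
  gamma (rank_one xe.1 xe.1) xe.2 = xe.2, dot xe.2 xe.2 = 1 & P (alpha v) xe.2 = xe.2].
Proof.
have [x [Qx xx]] := res_unit resQ v.
have We := resW_rank_one resQ WQ Qx Qx; set e := rank_one x x in We.
have ee : e \o e = e by apply/funext => h; rewrite /e /rank_one /= dotZr xx mulr1.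
have [h h0] : exists h, gamma e h != 0.
  apply: contrapT => ne; have : e = 0.
    apply: ginj => //; first exact: (resW0 resP WP).
    rewrite g0; apply/funext => h; apply/eqP; apply: contrapT => /negP e0.
    by case: ne; exists h.
  move=> /(congr1 (fun f : H -> H => dot x (f x))).
  rewrite /e /rank_one xx scale1r xx -[(0 : H -> H) x]/(0 : H) dot0r => /eqP.
  by rewrite oner_eq0.
have [c hc] := normalize_vector h0; exists (x, c *: gamma e h); split=> //=.
  by rewrite (linear_for_Z (resW_linear WP (gW We))) gM// ee.
rewrite (linear_for_Z (res_linear resP _)) -gQ gM//; congr (_ *: gamma _ _).
by apply/funext => k; rewrite /= /e /rank_one (linear_for_Z (res_linear resQ v)) Qx.
Qed.

Section blocks.
Variables (xi eta : I -> H).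
Hypotheses (Qxi : forall v, Q v (xi v) = xi v)
  (geta : forall v, gamma (rank_one (xi v) (xi v)) (eta v) = eta v)
  (eta1 : forall v, dot (eta v) (eta v) = 1)
  (Peta : forall v, P (alpha v) (eta v) = eta v).

Definition block_map v h : H := gamma (rank_one (Q v h) (xi v)) (eta v).

Let Wr v h : W (rank_one (Q v h) (xi v)).
Proof. exact: (resW_rank_one resQ WQ (res_idem resQ v h) (Qxi v)). Qed.

Let Wr' v h : W (rank_one (xi v) (Q v h)).
Proof. exact: (resW_rank_one resQ WQ (Qxi v) (res_idem resQ v h)). Qed.

Let We v : W (rank_one (xi v) (xi v)).
Proof. exact: (resW_rank_one resQ WQ (Qxi v) (Qxi v)). Qed.

(** With x, y the components of [h], [k] in the block, moving one operator across the inner product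
    leaves gamma(|xi><x| |y><xi|), that is <x, y> gamma(|xi><xi|), which multiplies the unit vector
    [eta v] by <x, y>. *)
Lemma block_map_dot v h k : dot (block_map v h) (block_map v k) = dot (Q v h) (Q v k).
Proof.
rewrite /block_map (gA (Wr v h) (Wr' v h) (rank_one_adjoint _ _)) gM//.
have -> : rank_one (xi v) (Q v h) \o rank_one (Q v k) (xi v) =
    dot (Q v h) (Q v k) *: rank_one (xi v) (xi v).
  by apply/funext => z; rewrite /rank_one /= dotZr mulrC -scalerA.
by rewrite gZ// geta dotZr eta1 mulr1.
Qed.

Lemma block_map_hsq v h : hsq (block_map v h) = hsq (Q v h).
Proof. by apply: complexI; rewrite -!dot_hsq block_map_dot. Qed.

Lemma block_map_proj v h : P (alpha v) (block_map v h) = block_map v h.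
Proof.
rewrite -gQ gM//; congr (gamma _ _); apply/funext => k.
by rewrite /= /rank_one (linear_for_Z (res_linear resQ v)) (res_idem resQ).
Qed.

Lemma block_map_gamma w v h : W w -> gamma w (block_map v h) = block_map v (w h).
Proof.
move=> Ww; rewrite gM//; congr (gamma _ _); apply/funext => k.
by rewrite /= /rank_one (linear_for_Z (resW_linear WQ Ww)) (resW_comm WQ).
Qed.

Lemma block_map_linear v : linear (block_map v).
Proof.
move=> c h k; rewrite -gL//; congr (gamma _ _); apply/funext => z.
rewrite -[RHS]/(c *: rank_one (Q v h) (xi v) z + rank_one (Q v k) (xi v) z).
by rewrite /rank_one (res_linear resQ v) scalerDr !scalerA mulrC.
Qed.

(** The rank-one operator carrying [eta v] to [y] lies in W, hence is [gamma u] for some [u]; the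
    preimage of [y] is [u (xi v)]. *)
Lemma block_map_onto v y : P (alpha v) y = y -> exists x, Q v x = x /\ block_map v x = y.
Proof.
move=> Py; have [u Wu gu] := gsurj (resW_rank_one resP WP Py (Peta v)).
have Qu : Q v (u (xi v)) = u (xi v) by rewrite -(resW_comm WQ)// Qxi.
exists (u (xi v)); split=> //; rewrite /block_map Qu.
have -> : rank_one (u (xi v)) (xi v) = u \o rank_one (xi v) (xi v).
  by apply/funext => z; rewrite /rank_one /= (linear_for_Z (resW_linear WQ Wu)).
by rewrite -gM// geta gu /rank_one eta1 scale1r.
Qed.

Definition block_sum h : H := summability.sum (fun v => block_map v h).

Let Palpha_orth v u h : v != u -> P (alpha v) (P (alpha u) h) = 0.
Proof. by move=> vu; rewrite (res_orth resP)// (inj_eq (bij_inj alpha_bij)). Qed.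

Lemma block_sum_has h : has_hsum (fun v => block_map v h) (block_sum h) /\
  hsq (block_sum h) <= hsq h.
Proof.
apply: orthogonal_has_hsum => [v u vu|B].
  by rewrite -block_map_proj -[X in dot _ X]block_map_proj (res_adjoint resP) Palpha_orth// dot0r.
under eq_bigr do rewrite block_map_hsq.
exact: (piso_bessel (res_adjoint resQ) (res_orth resQ) (res_piso resQ)).
Qed.

Lemma proj_block_sum v h : P (alpha v) (block_sum h) = block_map v h.
Proof.
have [hs _] := block_sum_has h.
apply: has_hsum_unique (has_hsum_op (res_bounded resP (alpha v)) hs) _.
rewrite -[block_map v h]block_map_proj.
apply: (@has_hsum1 _ _ _ (P (alpha v) \o (fun u => block_map u h)) v) => u uv /=.
by rewrite -block_map_proj Palpha_orth// eq_sym.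
Qed.

Let alpha_eq h k : (forall v, P (alpha v) h = P (alpha v) k) -> h = k.
Proof.
by move=> e; apply: (res_eq resP) => p; have [beta _ ab] := alpha_bij; rewrite -(ab p).
Qed.

Lemma block_sum_linear : linear block_sum.
Proof.
move=> c h k; apply: alpha_eq => v.
by rewrite (res_linear resP) !proj_block_sum block_map_linear.
Qed.

Lemma block_sum_dot h k : dot (block_sum h) (block_sum k) = dot h k.
Proof.
have [hs _] := block_sum_has k.
apply: has_csum_unique (has_hsum_dot (block_sum h) hs) _.
have := has_hsum_dot h (res_sum resQ k); congr has_csum; apply/funext => v.
rewrite -[block_map v k]block_map_proj -(res_adjoint resP) proj_block_sum block_map_dot.
by rewrite (res_adjoint resQ) (res_idem resQ).
Qed.

Lemma block_sum_onto y : exists x, block_sum x = y.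
Proof.
have /choice[x hx] v : exists x, Q v x = x /\ block_map v x = P (alpha v) y.
  by apply: block_map_onto; exact: (res_idem resP).
have xo v u : v != u -> dot (x v) (x u) = 0.
  by move=> vu; apply: (res_block_orth resQ vu); [case: (hx v)|case: (hx u)].
have [hs _] : has_hsum x (summability.sum x) /\ hsq (summability.sum x) <= hsq y.
  apply: orthogonal_has_hsum => [v u|B]; first exact: xo.
  rewrite (eq_bigr (fun v => hsq (P (alpha v) y))) => [|v _]; last first.
    by have [Qx <-] := hx v; rewrite block_map_hsq Qx.
  apply: (@piso_bessel _ _ _ (fun v => P (alpha v)) (fun v => P (alpha v))) => [v|v u h|v h]; first exact: (res_adjoint resP).
    exact: Palpha_orth.
  exact: (res_piso resP).
exists (summability.sum x); apply: alpha_eq => v; rewrite proj_block_sum.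
have [Qx <-] := hx v.
suff Qs : Q v (summability.sum x) = x v by rewrite /block_map Qs Qx.
apply: has_hsum_unique (has_hsum_op (res_bounded resQ v) hs) _; rewrite -{1}Qx.
apply: (@has_hsum1 _ _ _ (Q v \o x) v) => u uv /=.
by have [<- _] := hx u; rewrite (res_orth resQ)// eq_sym.
Qed.

(** The comparison is made after applying each [P (alpha v)], which commutes with [gamma w], so that
    [gamma] only meets single blocks. *)
Lemma block_sum_gamma w h : W w -> gamma w (block_sum h) = block_sum (w h).
Proof.
move=> Ww; apply: alpha_eq => v; rewrite -(resW_comm WP); last exact: gW.
by rewrite !proj_block_sum block_map_gamma.
Qed.

End blocks.
End unitary.

Lemma automorphism_implemented : exists (V V' : H -> H) (alpha : I -> I),
  [/\ linear V, cancel V V', cancel V' V, forall h k, dot (V h) (V k) = dot h k &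
      [/\ bijective alpha, forall v h, V (Q v h) = P (alpha v) (V h) &
          forall w h, W w -> gamma w (V h) = V (w h)]].
Proof.
have [alpha ba gQ] := gamma_proj_bij.
have /choice[xe hxe] := block_vectors gQ.
pose xi v := (xe v).1; pose eta v := (xe v).2.
have h1 v : Q v (xi v) = xi v by case: (hxe v).
have h2 v : gamma (rank_one (xi v) (xi v)) (eta v) = eta v by case: (hxe v).
have h3 v : dot (eta v) (eta v) = 1 by case: (hxe v).
have h4 v : P (alpha v) (eta v) = eta v by case: (hxe v).
have /choice[V' hV'] := block_sum_onto ba gQ h1 h2 h3 h4.
have dV := block_sum_dot ba gQ h1 h2 h3.
have lV := block_sum_linear ba gQ h1 h2 h3.
have gV := block_sum_gamma ba gQ h1 h2 h3.
exists (block_sum xi eta), V', alpha; split=> //.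
- move=> h; apply: dot_injl => k; rewrite -dV hV'; exact: dV.
- split=> // v h; rewrite -gV ?gQ//; exact: (resW_proj resQ WQ).
Qed.

End two_resolutions.
End resolutions.

(** * Recovering elements of X(E) and of the vertex algebra from a faithful representation *)

Section faithful_representation.
Variables (R : realType) (E : graph) (T : cstarAlgType R).
Variables (sigma : xgraph R E -> T) (pi : c0 R (vertex E) -> T).
Hypothesis toepT : toeplitz_algebra sigma pi.
Variables (H : hilbertType R) (tau : T -> H -> H).
Hypotheses (rep : star_rep tau) (faithful : injective tau)
  (nondeg : nondegenerate_rep tau).
Local Notation P := (vertex_op pi tau).

Lemma vertex_op_resolution : resolution P.
Proof.
split=> [v|v w h|v|h]; first exact: (vertex_op_adjoint toepT rep).
- exact: (vertex_opM toepT rep).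
- apply: contrapT => nex; apply: (toeplitz_delta_vertex_neq0 (v := v) toepT).
  apply: faithful; apply/funext => h; rewrite (rep0 rep); apply/eqP.
  by apply: contrapT => /negP h0; apply: nex; exists h.
- exact: (vertex_ops_total toepT rep nondeg).
Qed.

Lemma vertex_pi a v h : P v (tau (pi a) h) = a v *: P v h.
Proof.
apply: dot_injl => k; rewrite -[LHS](vertex_op_adjoint toepT rep).
rewrite -[LHS](adjoint_opsC (pi_adjoint toepT rep a)).
rewrite (pi_vertex toepT rep) dotZl dotZr (vertex_op_adjoint toepT rep).
by rewrite -[(cstar a : c0 R (vertex E)) v]/(conjc (a v)) conjcK.
Qed.

(** Applying [edge_op_adj f] leaves [x f] and [y f] times the same vector [P (src f) h], which is
    nonzero for a suitable [h]. *)
Lemma sigma_faithful x y : (forall h, tau (sigma x) h = tau (sigma y) h) -> x = y.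
Proof.
move=> e; apply: xgraph_eq => f; have [h h0] := res_nonzero vertex_op_resolution (src f).
have := congr1 (edge_op_adj sigma tau f) (e h).
rewrite !(edge_op_adj_sigma toepT rep) => /eqP; rewrite -subr_eq0 -scalerBl scaler_eq0.
by move=> /orP[|/eqP//]; rewrite subr_eq0 => /eqP.
Qed.

Lemma pi_faithful a b : (forall h, tau (pi a) h = tau (pi b) h) -> a = b.
Proof.
move=> e; apply: c0_eq => v; have [h h0] := res_nonzero vertex_op_resolution v.
have := congr1 (P v) (e h); rewrite !vertex_pi => /eqP.
rewrite -subr_eq0 -scalerBl scaler_eq0 => /orP[|/eqP//].
by rewrite subr_eq0 => /eqP.
Qed.

End faithful_representation.

(** * The automorphism induced by a coherent unitary equivalence *)

Section coherent_equivalence.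
Variables (R : realType) (A : cstarAlgType R) (X : correspondenceType A).
Variables (T : cstarAlgType R) (sigma : X -> T) (pi : A -> T).

Lemma toeplitz_rep_equivalence (U : X -> X) (alpha : A -> A) :
  toeplitz_rep sigma pi -> coherent_unitary_equivalence U alpha ->
  toeplitz_rep (sigma \o U) (pi \o alpha).
Proof.
move=> [ls hp h1 h2 h3] [lU [ha _] Ur Ul [V [UK VK hip_U]]].
split=> [k x y||x a|a x|x y] /=; first by rewrite lU ls.
- exact: star_hom_comp hp ha.
- by rewrite Ur h1.
- by rewrite Ul h2.
- by rewrite -h3 hip_U UK.
Qed.

Lemma coherent_equivalence_inverse (U : X -> X) (alpha : A -> A) :
  coherent_unitary_equivalence U alpha ->
  exists (U' : X -> X) (alpha' : A -> A), [/\ cancel U U', cancel U' U,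
    cancel alpha alpha', cancel alpha' alpha & coherent_unitary_equivalence U' alpha'].
Proof.
move=> [lU [[la ma sa] [alpha' aK a'K]] Ur Ul [V [UK VK hip_U]]].
have injU := can_inj UK; have inja := can_inj aK.
exists V, alpha'; split=> //; split.
- by move=> k x y; apply: injU; rewrite lU !VK.
- split; last by exists alpha.
  split=> [k a b|a b|a]; apply: inja; first by rewrite la !a'K.
    by rewrite ma !a'K.
  by rewrite sa !a'K.
- by move=> x a; apply: injU; rewrite Ur !VK a'K.
- by move=> a x; apply: injU; rewrite Ul !VK a'K.
- exists U; split=> // x y; apply: inja.
  by rewrite a'K -{2}(VK x) hip_U UK.
Qed.

(** The universal property is applied to the equivalence and to its inverse; both composites fix the
    generators, so uniqueness makes them the identity. *)
Lemma induced_automorphism_ex (U : X -> X) (alpha : A -> A) :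
  toeplitz_algebra sigma pi -> coherent_unitary_equivalence U alpha ->
  exists Gamma : T -> T, induced_automorphism sigma pi U alpha Gamma.
Proof.
move=> toepT eqU; have [rep0 univ] := toepT.
have [U' [alpha' [UK VK aK a'K eqU']]] := coherent_equivalence_inverse eqU.
have [G [[hG Gs Gp] _]] := univ _ _ _ (toeplitz_rep_equivalence rep0 eqU).
have [G' [[hG' G's G'p] _]] := univ _ _ _ (toeplitz_rep_equivalence rep0 eqU').
have {}Gs x : G (sigma x) = sigma (U x) := esym (congr1 (fun f => f x) Gs).
have {}Gp a : G (pi a) = pi (alpha a) := esym (congr1 (fun f => f a) Gp).
have {}G's x : G' (sigma x) = sigma (U' x) := esym (congr1 (fun f => f x) G's).
have {}G'p a : G' (pi a) = pi (alpha' a) := esym (congr1 (fun f => f a) G'p).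
have hid : star_hom (@idfun T) by [].
exists G; split=> //; split=> //; exists G' => t.
  suff e : G' \o G = idfun by exact: (congr1 (fun f => f t) e).
  apply: (toeplitz_hom_unique toepT (star_hom_comp hG' hG) hid) => x /=.
    by rewrite Gs G's UK.
  by rewrite Gp G'p aK.
suff e : G \o G' = idfun by exact: (congr1 (fun f => f t) e).
apply: (toeplitz_hom_unique toepT (star_hom_comp hG hG') hid) => x /=.
  by rewrite G's Gs VK.
by rewrite G'p Gp a'K.
Qed.

End coherent_equivalence.

(** * Transport of X(E) from one representation to the other *)

Section transport.
Variables (R : realType) (E : graph) (T : cstarAlgType R).
Variables (sigma : xgraph R E -> T) (pi : c0 R (vertex E) -> T).
Hypothesis toepT : toeplitz_algebra sigma pi.
Variables (H : hilbertType R) (tau1 tau2 : T -> H -> H).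
Hypotheses (rep1 : star_rep tau1) (rep2 : star_rep tau2)
  (faithful1 : injective tau1)
  (nondeg1 : nondegenerate_rep tau1) (nondeg2 : nondegenerate_rep tau2).
Variable W : set (H -> H).
Hypotheses (W1 : commutant (vertex_ops pi tau1) = W)
  (W2 : commutant (vertex_ops pi tau2) = W).
Variables (V V' : H -> H) (alpha' : vertex E -> vertex E).
Hypotheses (VK : cancel V V') (V'K : cancel V' V)
  (dotV : forall h k, dot (V h) (V k) = dot h k)
  (alpha'_inj : injective alpha')
  (V'P : forall v h, V' (vertex_op pi tau1 v h) = vertex_op pi tau2 (alpha' v) (V' h))
  (V'W : forall w, W w -> W (V' \o w \o V))
  (AdV : forall w h, W w ->
    Ad sigma tau1 w (V h) = V (Ad sigma tau2 (V' \o w \o V) h)).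
Local Notation nc := (@ComplexField.Normc.normc R).
Local Notation P := (vertex_op pi tau1).
Local Notation S := (edge_op sigma tau1).
Local Notation S' := (edge_op_adj sigma tau1).

Let resP : resolution P := vertex_op_resolution toepT rep1 faithful1 nondeg1.
Let WP : commutant (range P) = W := W1.
Let WQ : commutant (range (vertex_op pi tau2)) = W := W2.

(* B = V tau2(x) V^* satisfies Ad_1(w) B = B w for w in W.  Hence S_f^* B
   commutes with W and is a scalar y(f) on the block of src f, and B = Ad_1(1) B
   is the sum of the S_f S_f^* B, that is tau1(y). *)
Lemma sigma_transport x : exists y, forall h,
  V (tau2 (sigma x) h) = tau1 (sigma y) (V h).
Proof.
have /choice[z hz] := res_unit resP.
pose B h := V (tau2 (sigma x) (V' h)).
have AdB w h : W w -> Ad sigma tau1 w (B h) = B (w h).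
  move=> Ww; rewrite AdV// (Ad_sigma toepT rep2 nondeg2) /= ?V'K//.
    by move=> v k; exact: esym (resW_comm WQ v k (V'W Ww)).
  exact: (resW_linear WQ (V'W Ww)).
(* [S' f] applied after [Ad w] is [P (src f) \o w \o S' f]; the projection commutes with [w] and is
   absorbed by [S' f]. *)
have CW f w h : W w -> S' f (B (w h)) = w (S' f (B h)).
  move=> Ww; rewrite -AdB// (edge_op_adj_Ad toepT rep1)//; last exact: (resW_bounded WP Ww).
  by rewrite -(resW_comm WP _ _ Ww) (vertex_edge_op_adj toepT rep1) eqxx.
(* The scalar is evaluated at the unit vector [z (src f)], with [S' f] moved to the other side of
   the inner product. *)
pose yf f := dot (S f (z (src f))) (B (z (src f))).
have S'B f h : S' f (B h) = yf f *: P (src f) h.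
  have -> : S' f (B h) = S' f (B (P (src f) h)).
    rewrite CW; last exact: (resW_proj resP WP).
    by rewrite (vertex_edge_op_adj toepT rep1) eqxx.
  have [Pz zz] := hz (src f).
  rewrite (commutes_scalar resP WP (C := fun h => S' f (B h)) (v := src f) (z := z (src f)))//.
  - by rewrite -(edge_op_adjoint sigma rep1).
  - by move=> w k; exact: CW.
  - exact: (res_idem resP).
(* [V' (z v)] is a unit vector in block [alpha' v] of [tau2]. By Bessel this value bounds the
   partial sums of squares of [yf] over the edges with source [v]. *)
have Bz v : hsq (B (z v)) = hat x (alpha' v).
  have [Pz zz] := hz v.
  have dV' k m : dot (V' k) (V' m) = dot k m by rewrite -dotV !V'K.
  have -> : hsq (B (z v)) = hsq (tau2 (sigma x) (V' (z v))).
    by apply: complexI; rewrite -!dot_hsq dotV.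
  rewrite (hsq_sigma toepT rep2 x (v := alpha' v)) -?V'P ?Pz// -[RHS]mulr1; congr (_ * _).
  by apply: complexI; rewrite -dot_hsq dV' zz.
have memy : yf \in xgraph_pred (E := E).
  apply: (@xgraph_mem _ _ _ (fun v => hat x (alpha' v))) => [v A|].
    rewrite -Bz; apply: le_trans (_ : \sum_(f <- A) hsq (S' f (B (z v))) <= _).
      apply: ler_sum => f _; case: ifP => [/eqP fv|_]; last exact: hsq_ge0.
      rewrite S'B -fv; have [-> zz] := hz (src f); rewrite hsqZ.
      have -> : hsq (z (src f)) = 1 by apply: complexI; rewrite -dot_hsq zz.
      by rewrite mulr1.
    exact: (piso_bessel (edge_op_adjoint sigma rep1) (edge_op_orth toepT rep1)
      (edge_op_piso toepT rep1)).
  (* The bound [hat x \o alpha'] vanishes at infinity because preimages of finite sets under the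
     injective [alpha'] are finite. *)
  move=> e e0; have := finite_preimage (in2W alpha'_inj) (hat_vanishing x e0).
  exact.
exists (XGraph memy) => h; rewrite -{1}(VK h) -/(B (V h)).
rewrite -[B _](AdB idfun); last exact: (resW_id WP).
rewrite -[RHS](Ad_id_sigma toepT rep1 nondeg1); congr summability.sum.
apply/funext => f /=; congr (tau1 _ _).
by rewrite -!/(S' f _) S'B (edge_op_adj_sigma toepT rep1).
Qed.

End transport.

(** * Assembling the equivalence *)

Lemma isometry_bounded (R : realType) (H : hilbertType R) (V : H -> H) :
  linear V -> (forall h k, dot (V h) (V k) = dot h k) -> bounded_op V.
Proof.
move=> lV dV; apply: (mk_bounded_op (M := 1)) => // h; rewrite mul1r.
rewrite -ler_sqr ?nnegrE ?hlen_ge0// !hlen_sq.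
by rewrite -lecR -!dot_hsq dV.
Qed.

Section relabelling.
Variables (R : realType) (T : Type) (f g : T -> T).
Hypothesis gK : cancel g f.

Lemma c0_comp_subproof (a : c0 R T) : vanishing (a \o g).
Proof.
move=> e e0.
exact: finite_preimage (in2W (can_inj gK)) (c0_vanishing a e0).
Qed.

(** Composition with [g], so that for mutually inverse [f] and [g] the point mass at v goes to the
    one at [f v]. *)
Definition c0_comp (a : c0 R T) : c0 R T := mk_c0 (c0_comp_subproof a).

End relabelling.

Lemma c0_comp_star_iso (R : realType) (T : Type) (f g : T -> T)
  (fK : cancel f g) (gK : cancel g f) : star_iso (@c0_comp R T f g gK).
Proof.
split; first by split=> [k a b|a b|a]; apply: c0_eq.
by exists (c0_comp fK) => a; apply: c0_eq => v; rewrite /= ?fK ?gK.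
Qed.

Theorem theorem3p4 (R : realType) (E : graph)
  (T : cstarAlgType R)
  (sigma_u : xgraph R E -> T) (pi_u : c0 R (vertex E) -> T)
  (toeplitzT : toeplitz_algebra sigma_u pi_u)
  (H : hilbertType R) (tau1 tau2 : T -> H -> H)
  (rep1 : star_rep tau1) (rep2 : star_rep tau2)
  (faithful1 : injective tau1) (faithful2 : injective tau2)
  (nondeg1 : nondegenerate_rep tau1) (nondeg2 : nondegenerate_rep tau2)
  (W : set (H -> H))
  (W1 : commutant (vertex_ops pi_u tau1) = W)
  (W2 : commutant (vertex_ops pi_u tau2) = W)
  (Ad_conj : conjugate_endomorphisms W (Ad sigma_u tau1) (Ad sigma_u tau2)) :
  exists (U : xgraph R E -> xgraph R E)
         (alpha : c0 R (vertex E) -> c0 R (vertex E)),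
    coherent_unitary_equivalence U alpha /\
    exists Gamma : T -> T,
      induced_automorphism sigma_u pi_u U alpha Gamma /\
      unitarily_equivalent tau2 (tau1 \o Gamma).
Proof.
have res1 : resolution (vertex_op pi_u tau1) := vertex_op_resolution toeplitzT rep1 faithful1 nondeg1.
have res2 : resolution (vertex_op pi_u tau2) := vertex_op_resolution toeplitzT rep2 faithful2 nondeg2.
have WP : commutant (range (vertex_op pi_u tau1)) = W := W1.
have WQ : commutant (range (vertex_op pi_u tau2)) = W := W2.
have [gamma [autW AdC]] := Ad_conj.
have [V [V' [f [lV VK V'K dV [[g fK gK] VP gV]]]]] :=
  automorphism_implemented res1 res2 WP WQ autW.
have [[gW ginj gsurj] _ _ _] := autW.
have gE w h : W w -> gamma w h = V (w (V' h)) by move=> Ww; rewrite -gV// V'K.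
have lV' : linear V' by move=> c h k; apply: (can_inj VK); rewrite lV !V'K.
have dV' h k : dot (V' h) (V' k) = dot h k by rewrite -dV !V'K.
have bV := isometry_bounded lV dV; have bV' := isometry_bounded lV' dV'.
have V'P v h : V' ((vertex_op pi_u tau1) v h) = (vertex_op pi_u tau2) (g v) (V' h).
  by apply: (can_inj VK); rewrite V'K VP gK V'K.
have WAd2 w : W w -> W (Ad sigma_u tau2 w).
  move=> Ww; have bw := resW_bounded WQ Ww; apply/(resWP WQ); split.
    exact: (Ad_bounded toeplitzT rep2 bw).
  by move=> v h; rewrite (vertex_op_Ad toeplitzT rep2).
have VW w : W w -> W (V \o w \o V').
  move=> Ww; have -> : V \o w \o V' = gamma w by apply/funext => h; rewrite gE.
  exact: gW.
have V'WV w : W w -> exists2 u, W u & V' \o w \o V = u /\ gamma u = w.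
  move=> Ww; have [u Wu guw] := gsurj _ Ww; exists u => //; split=> //.
  by apply/funext => h; rewrite /= -guw gV// VK.
(* The conjugacy relation, with [gamma] rewritten as conjugation by [V]. *)
have AdV u h : W u -> Ad sigma_u tau1 (gamma u) (V h) = V (Ad sigma_u tau2 u h).
  by move=> Wu; rewrite AdC// gV//; exact: WAd2.
have V'W w : W w -> W (V' \o w \o V) by move=> /V'WV[u Wu [-> _]].
have AdV1 w h : W w ->
    Ad sigma_u tau1 w (V h) = V (Ad sigma_u tau2 (V' \o w \o V) h).
  by move=> /V'WV[u Wu [-> <-]]; exact: AdV.
have AdV2 w h : W w ->
    Ad sigma_u tau2 w (V' h) = V' (Ad sigma_u tau1 (V \o w \o V') h).
  move=> Ww; have -> : V \o w \o V' = gamma w by apply/funext => k; rewrite gE.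
  by apply: (can_inj VK); rewrite V'K -AdV// V'K.
have /choice[U hU] := sigma_transport toeplitzT rep1 rep2 faithful1 nondeg1 nondeg2
  W1 W2 VK V'K dV (can_inj gK) V'P V'W AdV1.
(* The representations exchange roles, and so do [V] and [V'], [f] and [g]; this will be the inverse
   of [U]. *)
have /choice[U' hU'] := sigma_transport toeplitzT rep2 rep1 faithful2 nondeg2 nondeg1
  W2 W1 V'K VK dV' (can_inj fK) VP VW AdV2.
pose al := c0_comp (R := R) gK; exists U, al.
have inj1 x y : (forall h, tau1 (sigma_u x) (V h) = tau1 (sigma_u y) (V h)) -> x = y.
  move=> e; apply: (sigma_faithful toeplitzT rep1 faithful1 nondeg1) => h.
  by rewrite -(V'K h) e.
have Vpi a h : V (tau2 (pi_u a) h) = tau1 (pi_u (al a)) (V h).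
  apply: (res_eq res1) => v; rewrite -(gK v) -VP (vertex_pi toeplitzT rep2).
  rewrite (linear_for_Z lV) VP (vertex_pi toeplitzT rep1).
  by rewrite -[(al a : c0 R (vertex E)) _]/(a (g (f (g v)))) gK.
have eqU : coherent_unitary_equivalence U al.
  split.
  - move=> c x y; apply: inj1 => h.
    rewrite -hU (sigma_lin toeplitzT rep2) lV !hU.
    by rewrite (sigma_lin toeplitzT rep1).
  - exact: (c0_comp_star_iso R fK gK).
  - move=> x a; apply: inj1 => h.
    rewrite -hU (sigma_ract toeplitzT rep2) hU Vpi.
    by rewrite (sigma_ract toeplitzT rep1).
  - move=> a x; apply: inj1 => h.
    rewrite -hU (sigma_lact toeplitzT rep2) Vpi hU.
    by rewrite (sigma_lact toeplitzT rep1).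
  - have hU'' y h : tau1 (sigma_u y) (V h) = V (tau2 (sigma_u (U' y)) h).
      by apply: (can_inj V'K); rewrite hU' !VK.
    exists U'; split=> [x|y|x y].
    + apply: (sigma_faithful toeplitzT rep2 faithful2 nondeg2) => h.
      by apply: (can_inj VK); rewrite -hU'' hU.
    + by apply: inj1 => h; rewrite -hU hU''.
    (* Inner products in X(E) are recovered from matrix coefficients:
       [dot (tau (sigma x) h) (tau (sigma y) k)] is [dot h (tau (pi (hip x y)) k)]. *)
    + apply: (pi_faithful toeplitzT rep1 faithful1 nondeg1) => h; rewrite -(V'K h).
      apply: dot_injl => k; rewrite -(V'K k) -(dot_sigma toeplitzT rep1) -Vpi.
      by rewrite -hU hU'' !dV (dot_sigma toeplitzT rep2).
split=> //; have [Gamma hG] := induced_automorphism_ex toeplitzT eqU.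
exists Gamma; split=> //; have [[[lG mG sG] _] Gs Gp] := hG.
exists V; split=> //; first by exists V'.
(* Conjugating [tau1 \o Gamma] back by [V] gives a representation that agrees with [tau2] on the
   generators, hence on [T] by uniqueness. *)
have rep3 : star_rep (fun t => V' \o tau1 (Gamma t) \o V).
  split=> [t|c s t|s t|t].
  - by apply: bounded_op_comp => //; apply: bounded_op_comp => //; exact: (rep_bounded rep1).
  - by apply/funext => h; rewrite /= lG (rep_lin rep1) lV'.
  - by apply/funext => h; rewrite /= mG (repM rep1) V'K.
  - by move=> h k; rewrite /= -dV V'K (rep_adjoint rep1) -sG -[RHS]dV V'K.
move=> t; apply/funext => h /=; apply: (can_inj V'K); rewrite VK.
apply: (star_rep_unique toeplitzT rep2 rep3) => [x k|a k] /=.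
  by rewrite Gs -hU VK.
by rewrite Gp -Vpi VK.
Qed.
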